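(* There is an isomorphism of von Neumann algebras \[\mathbb{C}^2 \ast \mathbb{C}^2 \cong M_2(L\mathbb{Z}),\] where $\mathbb{C}^2=\mathbb{C}\oplus\mathbb{C}$ carries the uniform trace $(\lambda,\mu)\mapsto \frac12(\lambda+\mu)$.
   Context: A finite von Neumann algebra is a von Neumann algebra equipped with a fixed faithful normal tracial state $tr$. The symbol $\ast$ denotes the von Neumann algebra free product with respect to the given tracial states. $L\mathbb{Z}$ is the group von Neumann algebra of $\mathbb{Z}$, and $M_2(B)=M_2(\mathbb{C})\otimes B$ is the algebra of $2\times 2$ matrices over $B$, with normalized trace $tr((b_{i,j}))=\frac12(tr(b_{1,1})+tr(b_{2,2}))$. The symbol $\cong$ denotes isomorphism of von Neumann algebras. *)

(* Defs.v *)
From HB Require Import structures.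
From mathcomp Require Import all_boot all_order all_algebra.
From mathcomp Require Import all_classical all_reals all_analysis.
From mathcomp Require Import complex sesquilinear ring lra.
Set Implicit Arguments.
Unset Strict Implicit.
Unset Printing Implicit Defensive.
Import Order.TTheory GRing.Theory Num.Theory numFieldNormedType.Exports.
Local Open Scope classical_set_scope.
Local Open Scope ring_scope.

(* Unordered sums of real and complex families; they are only meaningful for
   absolutely summable families. *)
Definition abs_summable (R : realType) (T : choiceType) (F : T -> R) : Prop :=
  (\esum_(i in [set: T]) `|F i|%:E < +oo)%E.

Definition rsum (R : realType) (T : choiceType) (F : T -> R) : R :=
  fine (\esum_(i in [set: T]) (Num.max (F i) 0)%:E)%E
  - fine (\esum_(i in [set: T]) (Num.max (- F i) 0)%:E)%E.

Definition csum (R : realType) (T : choiceType) (F : T -> R[i]) : R[i] :=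
  Complex (rsum (fun i => complex.Re (F i))) (rsum (fun i => complex.Im (F i))).

Section Sums.
Variable R : realType.
Implicit Types T : choiceType.

Lemma esumZ T (r : R) (a : T -> R) : 0 <= r -> (forall i, 0 <= a i) ->
  (\esum_(i in [set: T]) (r * a i)%:E = r%:E * \esum_(i in [set: T]) (a i)%:E)%E.
Proof.
move=> r0 a0; rewrite /esum -ereal_supZl //; last first.
  by apply/set0P; exists (\sum_(x \in set0) (a x)%:E)%E, set0 => //; exact: fsets_set0.
congr ereal_sup; rewrite image_comp; apply: eq_imagel => A _ /=.
by rewrite ge0_mule_fsumr// => i; rewrite lee_fin.
Qed.

Lemma abs_summable_le T (F G : T -> R) : (forall i, `|F i| <= G i) ->
  abs_summable G -> abs_summable F.
Proof.
move=> FG; apply: le_lt_trans; apply: le_esum => i _; rewrite lee_fin.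
by rewrite (le_trans (FG i))// ler_norm.
Qed.

Lemma abs_summableD T (F G : T -> R) : abs_summable F -> abs_summable G ->
  abs_summable (fun i => F i + G i).
Proof.
move=> sF sG.
have : abs_summable (fun i => `|F i| + `|G i|).
  rewrite /abs_summable (_ : esum _ _ = \esum_(i in [set: T]) (`|F i|%:E + `|G i|%:E))%E.
    by rewrite esumD// lte_add_pinfty.
  by apply: eq_esum => i _; rewrite ger0_norm ?addr_ge0.
by apply: abs_summable_le => i; exact: ler_normD.
Qed.

Lemma abs_summableZ T (r : R) (F : T -> R) : abs_summable F ->
  abs_summable (fun i => r * F i).
Proof.
move=> sF; rewrite /abs_summable.
under eq_esum do rewrite normrM.
rewrite esumZ// lte_mul_pinfty//.
Qed.

Lemma abs_summableN T (F : T -> R) : abs_summable F ->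
  abs_summable (fun i => - F i).
Proof. by apply: le_lt_trans; apply: le_esum => i _; rewrite normrN. Qed.

Lemma esum_fin T (F : T -> R) : (forall i, 0 <= F i) -> abs_summable F ->
  (\esum_(i in [set: T]) (F i)%:E \is a fin_num)%E.
Proof.
move=> F0 sF; rewrite ge0_fin_numE; last by apply: esum_ge0 => i _; rewrite lee_fin.
by apply: le_lt_trans sF; apply: le_esum => i _; rewrite lee_fin ler_norm.
Qed.

Lemma rsumB T (F G : T -> R) : (forall i, 0 <= F i) -> (forall i, 0 <= G i) ->
  abs_summable F -> abs_summable G ->
  rsum (fun i => F i - G i) =
  fine (\esum_(i in [set: T]) (F i)%:E)%E - fine (\esum_(i in [set: T]) (G i)%:E)%E.
Proof.
move=> F0 G0 sF sG.
have sP : abs_summable (fun i => Num.max (F i - G i) 0).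
  apply: abs_summable_le sF => i; rewrite ger0_norm; last by rewrite le_max lexx orbT.
  by rewrite ge_max F0 lerBlDr lerDl G0.
have sN : abs_summable (fun i => Num.max (- (F i - G i)) 0).
  apply: abs_summable_le sG => i; rewrite ger0_norm; last by rewrite le_max lexx orbT.
  by rewrite ge_max G0 opprB lerBlDr lerDl F0.
have := @esumB R T [set: T] (EFin \o F) (EFin \o G).
rewrite /summable /= => /(_ sF sG).
have H1 : forall i : T, [set: T] i -> (0 <= (EFin \o F) i)%E by move=> i _; rewrite lee_fin.
have H2 : forall i : T, [set: T] i -> (0 <= (EFin \o G) i)%E by move=> i _; rewrite lee_fin.
move=> /(_ H1 H2).
have e1 : (\esum_(i in [set: T]) ((EFin \o F) \- (EFin \o G))^\+%E i =
  \esum_(i in [set: T]) (Num.max (F i - G i) 0)%:E)%E.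
  by apply: eq_esum => i _; rewrite funeposE EFin_max.
have e2 : (\esum_(i in [set: T]) ((EFin \o F) \- (EFin \o G))^\-%E i =
  \esum_(i in [set: T]) (Num.max (- (F i - G i)) 0)%:E)%E.
  by apply: eq_esum => i _; rewrite funenegE EFin_max.
rewrite e1 e2 /rsum => e.
rewrite -!fineB ?esum_fin ?e// => i; by rewrite le_max lexx orbT.
Qed.

Lemma maxr0_ge0 (x : R) : 0 <= Num.max x 0.
Proof. by rewrite le_max lexx orbT. Qed.

Lemma maxr0_le (x : R) : Num.max x 0 <= `|x|.
Proof. by rewrite ge_max ler_norm normr_ge0. Qed.

Lemma maxr0B (x : R) : x = Num.max x 0 - Num.max (- x) 0.
Proof.
have [x0|x0] := leP x 0.
  by rewrite max_l ?oppr_ge0// sub0r opprK.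
by rewrite max_r ?subr0// oppr_le0 ltW.
Qed.

Lemma abs_summable_pos T (F : T -> R) : abs_summable F ->
  abs_summable (fun i => Num.max (F i) 0).
Proof.
move=> sF; apply: (@abs_summable_le _ _ (fun i => `|F i|)) => [i|].
  by rewrite ger0_norm ?maxr0_ge0// maxr0_le.
by apply: le_lt_trans sF; apply: le_esum => i _; rewrite normr_id.
Qed.

Lemma rsumD T (F G : T -> R) : abs_summable F -> abs_summable G ->
  rsum (fun i => F i + G i) = rsum F + rsum G.
Proof.
move=> sF sG.
have sF' := abs_summable_pos sF; have sG' := abs_summable_pos sG.
have sFn := abs_summable_pos (abs_summableN sF).
have sGn := abs_summable_pos (abs_summableN sG).
have -> : (fun i => F i + G i) = (fun i => (Num.max (F i) 0 + Num.max (G i) 0) -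
   (Num.max (- F i) 0 + Num.max (- G i) 0)).
  by apply/funext => i; rewrite {1}(maxr0B (F i)) {1}(maxr0B (G i)) opprD addrACA.
rewrite rsumB; first last.
- exact: abs_summableD.
- exact: abs_summableD.
- by move=> i; rewrite addr_ge0 ?maxr0_ge0.
- by move=> i; rewrite addr_ge0 ?maxr0_ge0.
under eq_esum do rewrite EFinD.
rewrite esumD; try by move=> i _; rewrite lee_fin maxr0_ge0.
under [X in _ - fine X]eq_esum do rewrite EFinD.
rewrite esumD; try by move=> i _; rewrite lee_fin maxr0_ge0.
rewrite !fineD ?esum_fin//; try by move=> i; rewrite maxr0_ge0.
by rewrite /rsum opprD addrACA.
Qed.

Lemma rsum_ge0 T (F : T -> R) : (forall i, 0 <= F i) ->
  rsum F = fine (\esum_(i in [set: T]) (F i)%:E)%E.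
Proof.
move=> F0; rewrite /rsum [X in _ - fine X]esum1 ?subr0.
  by congr fine; apply: eq_esum => i _; rewrite max_l.
by move=> i _; rewrite max_r// oppr_le0.
Qed.

Lemma rsumN T (F : T -> R) : rsum (fun i => - F i) = - rsum F.
Proof.
rewrite /rsum opprB; congr (_ - fine _).
by apply: eq_esum => i _; rewrite opprK.
Qed.

Lemma rsumZ T (r : R) (F : T -> R) : rsum (fun i => r * F i) = r * rsum F.
Proof.
wlog r0 : r / 0 <= r.
  move=> H; have [/H//|r0] := leP 0 r.
  have := H (- r); rewrite oppr_ge0 => /(_ (ltW r0)).
  under eq_fun do rewrite mulNr.
  by rewrite rsumN mulNr => /oppr_inj.
have fM (x : \bar R) : fine (r%:E * x)%E = r * fine x.
  case: x => [x| |] //=.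
  - by rewrite mulr0; have [->|rN] := eqVneq r 0; rewrite ?mul0e// gt0_muley// lte_fin lt_def rN.
  - by rewrite mulr0; have [->|rN] := eqVneq r 0; rewrite ?mul0e// gt0_muleNy// lte_fin lt_def rN.
have mM (x : R) : Num.max (r * x) 0 = r * Num.max x 0 by rewrite maxr_pMr// mulr0.
rewrite /rsum mulrBr -!fM -!esumZ//; try by move=> i; exact: maxr0_ge0.
congr (fine _ - fine _); apply: eq_esum => i _.
  by rewrite mM.
by rewrite -mulrN mM.
Qed.

Lemma eq_rsum T (F G : T -> R) : F =1 G -> rsum F = rsum G.
Proof. by move=> /funext ->. Qed.

Lemma esum_single T (j : T) (a : T -> R) : (forall i, 0 <= a i) ->
  (forall i, i != j -> a i = 0) ->
  (\esum_(i in [set: T]) (a i)%:E = (a j)%:E)%E.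
Proof.
move=> a0 aj; have -> : (\esum_(i in [set: T]) (a i)%:E =
   \esum_(i in [set j]) (a i)%:E)%E.
  rewrite [RHS]esum_mkcond; apply: eq_esum => i _.
  by rewrite in_set1; case: eqVneq => // ij; rewrite aj.
by rewrite esum_set1// lee_fin.
Qed.

Lemma abs_summable_single T (j : T) (F : T -> R) :
  (forall i, i != j -> F i = 0) -> abs_summable F.
Proof.
move=> Fj; rewrite /abs_summable (@esum_single _ j) ?ltry// => i ij.
by rewrite Fj// normr0.
Qed.

Lemma rsum_single T (j : T) (F : T -> R) : (forall i, i != j -> F i = 0) ->
  rsum F = F j.
Proof.
move=> Fj; rewrite /rsum !(@esum_single _ j) /=; first last.
- by move=> i ij; rewrite Fj// maxxx.
- by move=> i; rewrite maxr0_ge0.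
- by move=> i ij; rewrite Fj// oppr0 maxxx.
- by move=> i; rewrite maxr0_ge0.
by rewrite -maxr0B.
Qed.

Lemma esum_bij T T' (e : T -> T') (a : T' -> R) : bijective e ->
  (forall i, 0 <= a i) ->
  (\esum_(i in [set: T']) (a i)%:E = \esum_(i in [set: T]) (a (e i))%:E)%E.
Proof.
move=> be a0; apply: (@reindex_esum R T T' [set: T] [set: T'] e (fun i => (a i)%:E)).
by rewrite setTT_bijective.
Qed.

Lemma rsum_bij T T' (e : T -> T') (F : T' -> R) : bijective e ->
  rsum F = rsum (fun i => F (e i)).
Proof.
move=> be; rewrite /rsum.
by congr (fine _ - fine _); apply: esum_bij => // i; exact: maxr0_ge0.
Qed.

Lemma esum_parity (a : nat -> R) : (forall i, 0 <= a i) ->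
  (\esum_(i in [set: nat]) (a i)%:E =
   \esum_(i in [set: nat]) (a i.*2)%:E + \esum_(i in [set: nat]) (a i.*2.+1)%:E)%E.
Proof.
move=> a0; have a0' i : (0 <= (a i)%:E)%E by rewrite lee_fin.
rewrite (esumID [set n | ~~ odd n])// !setTI; congr (_ + _)%E.
- apply: (@reindex_esum R nat nat [set: nat] [set n | ~~ odd n] double (fun i => (a i)%:E)) => //.
  split => [n _|x y _ _ /double_inj //|n /= /negbTE on].
    by rewrite /= odd_double.
  by exists n./2 => //; rewrite -[RHS]odd_double_half on.
- apply: (@reindex_esum R nat nat [set: nat] (~` [set n | ~~ odd n]) (fun n => n.*2.+1) (fun i => (a i)%:E)) => //.
  split => [n _|x y _ _ [/double_inj] //|n /= /negP].
    by apply/negP; rewrite negbK /= odd_double.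
  by rewrite negbK => on; exists n./2 => //; rewrite -[RHS]odd_double_half on.
Qed.

Lemma rsum_parity (F : nat -> R) : abs_summable F ->
  rsum F = rsum (fun i => F i.*2) + rsum (fun i => F i.*2.+1).
Proof.
move=> sF.
have h (G : nat -> R) : (forall i, 0 <= G i) -> abs_summable G ->
    (\esum_(i in [set: nat]) (G i.*2)%:E \is a fin_num /\
    \esum_(i in [set: nat]) (G i.*2.+1)%:E \is a fin_num)%E.
  move=> G0 sG; apply/andP; have := esum_fin G0 sG.
  by rewrite (esum_parity G0) fin_numD.
have sF1 := abs_summable_pos sF.
have sF2 := abs_summable_pos (abs_summableN sF).
have [p1 p2] := h (fun i => Num.max (F i) 0) (fun i => maxr0_ge0 (F i)) sF1.
have [p3 p4] := h (fun i => Num.max (- F i) 0) (fun i => maxr0_ge0 (- F i)) sF2.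
rewrite /rsum (esum_parity (fun i => maxr0_ge0 (F i))).
rewrite (esum_parity (fun i => maxr0_ge0 (- F i))).
by rewrite (fineD p1 p2) (fineD p3 p4) opprD addrACA.
Qed.

End Sums.

Section Csum.
Variable R : realType.
Implicit Types T : choiceType.
Local Notation C := R[i].

Definition cabs (z : C) : R := complex.Re `|z|.

Lemma cabsE z : (cabs z)%:C%C = `|z|.
Proof. by rewrite RRe_real// normr_real. Qed.

Lemma cabs_ge0 z : 0 <= cabs z.
Proof. by have := normr_ge0 z; rewrite -cabsE lecR. Qed.

Lemma cabsD z w : cabs (z + w) <= cabs z + cabs w.
Proof. by have := ler_normD z w; rewrite -!cabsE -rmorphD lecR. Qed.

Lemma cabsM z w : cabs (z * w) = cabs z * cabs w.
Proof. by apply: (@complexI R); rewrite rmorphM [LHS]cabsE normrM -!cabsE. Qed.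

Lemma cabsJ z : cabs (Num.conj z) = cabs z.
Proof. by rewrite /cabs norm_conjC. Qed.

Lemma cabs0 : cabs 0 = 0. Proof. by rewrite /cabs normr0. Qed.

Lemma cabs_eq0 z : cabs z = 0 -> z = 0.
Proof. by move=> z0; apply/eqP; rewrite -normr_eq0 -cabsE z0. Qed.

Lemma cabs_sqr z : cabs z ^+ 2 = complex.Re z ^+ 2 + complex.Im z ^+ 2.
Proof.
apply: (@complexI R); rewrite rmorphXn [X in X ^+ 2]cabsE.
by rewrite add_Re2_Im2.
Qed.

Lemma Re_le_cabs z : `|complex.Re z| <= cabs z.
Proof.
rewrite -(@ler_pXn2r _ 2)// ?nnegrE ?cabs_ge0// cabs_sqr real_normK ?num_real//.
by rewrite lerDl sqr_ge0.
Qed.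

Lemma Im_le_cabs z : `|complex.Im z| <= cabs z.
Proof.
rewrite -(@ler_pXn2r _ 2)// ?nnegrE ?cabs_ge0// cabs_sqr real_normK ?num_real//.
by rewrite lerDr sqr_ge0.
Qed.

Definition csummable T (F : T -> C) := abs_summable (fun i => cabs (F i)).

Lemma csummable_Re T (F : T -> C) : csummable F ->
  abs_summable (fun i => complex.Re (F i)).
Proof. by apply: abs_summable_le => i; exact: Re_le_cabs. Qed.

Lemma csummable_Im T (F : T -> C) : csummable F ->
  abs_summable (fun i => complex.Im (F i)).
Proof. by apply: abs_summable_le => i; exact: Im_le_cabs. Qed.

Lemma csummable_le T (F : T -> C) (G : T -> R) : (forall i, cabs (F i) <= G i) ->
  abs_summable G -> csummable F.
Proof.
by move=> FG; apply: abs_summable_le => i; rewrite ger0_norm ?cabs_ge0.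
Qed.

Lemma csummableD T (F G : T -> C) : csummable F -> csummable G ->
  csummable (fun i => F i + G i).
Proof.
move=> sF sG; apply: csummable_le (abs_summableD sF sG) => i; exact: cabsD.
Qed.

Lemma csummableZ T a (F : T -> C) : csummable F -> csummable (fun i => a * F i).
Proof.
move=> sF; apply: csummable_le (abs_summableZ (cabs a) sF) => i.
by rewrite cabsM.
Qed.

Lemma ReD (u v : C) : complex.Re (u + v) = complex.Re u + complex.Re v.
Proof. by case: u; case: v. Qed.

Lemma ImD (u v : C) : complex.Im (u + v) = complex.Im u + complex.Im v.
Proof. by case: u; case: v. Qed.

Lemma csumD T (F G : T -> C) : csummable F -> csummable G ->
  csum (fun i => F i + G i) = csum F + csum G.
Proof.
move=> sF sG; rewrite /csum.
under [X in Complex (rsum X) _]funext do rewrite ReD.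
under [X in Complex _ (rsum X)]funext do rewrite ImD.
rewrite !rsumD//; [exact: csummable_Im..|exact: csummable_Re|exact: csummable_Re].
Qed.

Lemma csumZ T a (F : T -> C) : csummable F -> csum (fun i => a * F i) = a * csum F.
Proof.
move=> sF; have sR := csummable_Re sF; have sI := csummable_Im sF.
case: a => a b; rewrite /csum.
have -> : (fun i => complex.Re (Complex a b * F i)) =
    (fun i => a * complex.Re (F i) + - b * complex.Im (F i)).
  by apply/funext => i; case: (F i) => c d /=; rewrite mulNr.
have -> : (fun i => complex.Im (Complex a b * F i)) =
    (fun i => a * complex.Im (F i) + b * complex.Re (F i)).
  by apply/funext => i; case: (F i) => c d.
rewrite !rsumD ?rsumZ; try exact: abs_summableZ.
by rewrite mulNr.
Qed.

Lemma csumJ T (F : T -> C) : csum (fun i => Num.conj (F i)) = Num.conj (csum F).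
Proof.
rewrite /csum /=; congr Complex.
  by apply: eq_rsum => i; case: (F i).
by rewrite -rsumN; apply: eq_rsum => i; case: (F i).
Qed.

Lemma csum_real T (F : T -> R) : csum (fun i => (F i)%:C%C) = (rsum F)%:C%C.
Proof.
rewrite /csum /=; congr Complex.
by rewrite rsum_ge0// esum1.
Qed.

Lemma csum_single T (j : T) (F : T -> C) : (forall i, i != j -> F i = 0) ->
  csum F = F j.
Proof.
move=> Fj; rewrite /csum !(@rsum_single _ _ j); first by case: (F j).
  by move=> i ij; rewrite Fj.
by move=> i ij; rewrite Fj.
Qed.

Lemma csummable_single T (j : T) (F : T -> C) : (forall i, i != j -> F i = 0) ->
  csummable F.
Proof.
by move=> Fj; apply: (@abs_summable_single _ _ j) => i ij; rewrite Fj// cabs0.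
Qed.

Lemma csum_bij T T' (e : T -> T') (F : T' -> C) : bijective e ->
  csum F = csum (fun i => F (e i)).
Proof. by move=> be; rewrite /csum; congr Complex; exact: rsum_bij. Qed.

Lemma csum_parity (F : nat -> C) : csummable F ->
  csum F = csum (fun i => F i.*2) + csum (fun i => F i.*2.+1).
Proof.
move=> sF; rewrite /csum rsum_parity; last exact: csummable_Re.
by rewrite [X in Complex _ X = _]rsum_parity//; exact: csummable_Im.
Qed.

End Csum.


Definition dnorm (R : realType) (H : lmodType R[i]) (dot : H -> H -> R[i])
  (x : H) : R := Num.sqrt (complex.Re (dot x x)).

(* Complex Hilbert spaces; [hdot] is linear in its first variable and
   conjugate-linear in the second one. *)
Record hilbert (R : realType) := Hilbert {
  hsort :> lmodType R[i];
  hdot : {dot hsort for @Num.conj R[i]};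
  hcomplete : forall u : nat -> hsort,
    (forall e : R, 0 < e -> exists N : nat, forall m n : nat,
       (N <= m)%N -> (N <= n)%N -> dnorm hdot (u m - u n) < e) ->
    exists l : hsort, (fun n => dnorm hdot (u n - l)) @ \oo --> (0 : R) }.

Definition hnorm (R : realType) (H : hilbert R) (x : H) : R :=
  dnorm (@hdot R H) x.

(* A bounded operator on H, bundled with its (unique) adjoint. *)
Record bop (R : realType) (H : hilbert R) := Bop {
  bfun :> H -> H;
  badj : H -> H;
  bfun_linear : linear bfun;
  bfun_bounded : exists K : R, forall x, hnorm (bfun x) <= K * hnorm x;
  badjP : forall x y, hdot H (bfun x) y = hdot H x (badj y) }.

Section Hilbert.
Variables (R : realType) (H : hilbert R).
Implicit Types (x y : H) (S T : bop H).
Local Notation C := R[i].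
Local Notation "''[' x , y ]" := (hdot H x y).

Lemma hdotC x y : '[x, y] = Num.conj '[y, x].
Proof. by rewrite hermC expr0 mul1r. Qed.

Lemma hdot0l y : '[0, y] = 0. Proof. exact: linear0l. Qed.
Lemma hdot0r x : '[x, 0] = 0. Proof. exact: linear0r. Qed.
Lemma hdotDl x y z : '[x + y, z] = '[x, z] + '[y, z]. Proof. exact: linearDl. Qed.
Lemma hdotDr x y z : '[x, y + z] = '[x, y] + '[x, z]. Proof. exact: linearDr. Qed.
Lemma hdotNl x y : '[- x, y] = - '[x, y]. Proof. exact: linearNl. Qed.
Lemma hdotNr x y : '[x, - y] = - '[x, y]. Proof. exact: linearNr. Qed.
Lemma hdotZl a x y : '[a *: x, y] = a * '[x, y]. Proof. exact: linearZl_LR. Qed.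
Lemma hdotZr a x y : '[x, a *: y] = Num.conj a * '[x, y].
Proof. exact: linearZr_LR. Qed.

Lemma hdot_ge0 x : 0 <= '[x, x]. Proof. exact: dnorm_ge0. Qed.

Lemma hdot_eq0 x : '[x, x] = 0 -> x = 0.
Proof. by move/eqP; rewrite dnorm_eq0 => /eqP. Qed.

Lemma hdot_ext x y : (forall z, '[z, x] = '[z, y]) -> x = y.
Proof.
move=> e; apply/subr0_eq/hdot_eq0.
by rewrite hdotDr hdotNr e subrr.
Qed.

Lemma hdot_extl x y : (forall z, '[x, z] = '[y, z]) -> x = y.
Proof. by move=> e; apply: hdot_ext => z; rewrite hdotC e -hdotC. Qed.

Lemma hnorm_ge0 x : 0 <= hnorm x. Proof. exact: sqrtr_ge0. Qed.

Lemma Re_hdot_ge0 x : 0 <= complex.Re '[x, x].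
Proof. by have := hdot_ge0 x; rewrite lecE => /andP[]. Qed.

Lemma hnormE x : ((hnorm x) ^+ 2)%:C%C = '[x, x].
Proof.
rewrite /hnorm /dnorm sqr_sqrtr ?Re_hdot_ge0//.
by rewrite RRe_real// ger0_real// hdot_ge0.
Qed.

Lemma hnorm_sqr x : (hnorm x) ^+ 2 = complex.Re '[x, x].
Proof. by rewrite -hnormE. Qed.

Lemma CauchySchwarz_Re x y : complex.Re '[x, y] <= hnorm x * hnorm y.
Proof.
have ReD (u v : C) : complex.Re (u + v) = complex.Re u + complex.Re v by case: u; case: v.
have ReN (u : C) : complex.Re (- u) = - complex.Re u by case: u.
have ReC (u : C) : complex.Re (Num.conj u) = complex.Re u by case: u.
have ReZ (r : R) (u : C) : complex.Re (r%:C%C * u) = r * complex.Re u.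
  by case: u => a b /=; rewrite mul0r subr0.
have key (a b : R) : 2 * (a * b * complex.Re '[x, y]) <=
    a ^+ 2 * hnorm x ^+ 2 + b ^+ 2 * hnorm y ^+ 2.
  have := Re_hdot_ge0 (a%:C%C *: x - b%:C%C *: y).
  rewrite hdotDl !hdotDr !hdotNl !hdotNr opprK !hdotZl !hdotZr.
  have conjR (r : R) : Num.conj (r%:C%C : C) = r%:C%C by exact: conjc_real.
  rewrite !conjR (hdotC y x) !(ReD, ReN, ReZ, ReC) !hnorm_sqr.
  by move=> h; lra.
have [x0|xN] := eqVneq (hnorm x) 0.
  have -> : x = 0 by apply: hdot_eq0; rewrite -hnormE x0 expr0n.
  by rewrite hdot0l /= mulr_ge0 ?hnorm_ge0.
have [y0|yN] := eqVneq (hnorm y) 0.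
  have -> : y = 0 by apply: hdot_eq0; rewrite -hnormE y0 expr0n.
  by rewrite hdot0r /= mulr_ge0 ?hnorm_ge0.
have := key (hnorm y) (hnorm x).
have xp : 0 < hnorm x by rewrite lt_def xN hnorm_ge0.
have yp : 0 < hnorm y by rewrite lt_def yN hnorm_ge0.
have p2 : 0 < 2 * (hnorm y * hnorm x) by rewrite !mulr_gt0.
by move=> h; rewrite -(ler_pM2l p2); lra.
Qed.

Lemma bop_eq S T : (forall x, S x = T x) -> S = T.
Proof.
case: S T => [f f' fl fb fP] [g g' gl gb gP] /= e.
have {e}e : f = g by apply/funext.
have e' : f' = g'.
  by apply/funext => y; apply: hdot_ext => x; rewrite -fP -gP e.
subst g g'; congr Bop; exact: Prop_irrelevance.
Qed.

HB.instance Definition _ T := GRing.isLinear.Build C H H _ (bfun T) (bfun_linear T).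

Lemma badj_linear T : linear (badj T).
Proof.
move=> a x y; apply: hdot_ext => z.
by rewrite -badjP !(hdotDr, hdotZr) -!badjP.
Qed.

Lemma badj_bounded T : exists K : R, forall x, hnorm (badj T x) <= K * hnorm x.
Proof.
have [K TK] := bfun_bounded T; exists K => x.
have [x0|xN] := eqVneq (hnorm (badj T x)) 0.
  rewrite x0; have [xx|xxN] := eqVneq (hnorm x) 0; first by rewrite xx mulr0.
  have K0 : 0 <= K.
    have := le_trans (hnorm_ge0 _) (TK x).
    by rewrite pmulr_lge0// lt_def xxN hnorm_ge0.
  by rewrite mulr_ge0 ?hnorm_ge0.
have xp : 0 < hnorm (badj T x) by rewrite lt_def xN hnorm_ge0.
rewrite -(ler_pM2l xp) -expr2 hnorm_sqr -badjP.
apply: (le_trans (CauchySchwarz_Re _ _)).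
by rewrite mulrA [_ * K]mulrC ler_wpM2r ?hnorm_ge0.
Qed.

Lemma badj_adj T x y : '[badj T x, y] = '[x, T y].
Proof. by rewrite hdotC -badjP -hdotC. Qed.

Definition bstar T : bop H :=
  Bop (@badj_linear T) (@badj_bounded T) (@badj_adj T).

Fact bzero_linear : linear (fun _ : H => 0 : H).
Proof. by move=> a x y; rewrite scaler0 addr0. Qed.

Fact bzero_bounded : exists K : R, forall x : H, hnorm (0 : H) <= K * hnorm x.
Proof.
exists 0 => x; rewrite mul0r /hnorm /dnorm.
by rewrite hdot0l /= sqrtr0.
Qed.

Fact bzero_adj x y : '[0, y] = '[x, 0]. Proof. by rewrite hdot0l hdot0r. Qed.

Definition bzero : bop H := Bop bzero_linear bzero_bounded bzero_adj.

Fact bone_linear : linear (fun x : H => x). Proof. by []. Qed.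

Fact bone_bounded : exists K : R, forall x : H, hnorm x <= K * hnorm x.
Proof. by exists 1 => x; rewrite mul1r. Qed.

Definition bone : bop H := Bop bone_linear bone_bounded (fun x y => erefl '[x, y]).

Lemma hnormZ a x : hnorm (a *: x) = cabs a * hnorm x.
Proof.
apply/eqP; rewrite -(@eqrXn2 _ 2)// ?mulr_ge0 ?hnorm_ge0 ?cabs_ge0//.
apply/eqP/(@complexI R); rewrite exprMn [RHS]rmorphM [LHS]hnormE.
rewrite [X in _ = _ * X]hnormE hdotZl hdotZr mulrA -normCK [X in _ = X * _]rmorphXn.
by rewrite [X in _ = X ^+ 2 * _]cabsE.
Qed.

Lemma hnormD x y : hnorm (x + y) <= hnorm x + hnorm y.
Proof.
rewrite -(@ler_pXn2r _ 2)// ?nnegrE ?addr_ge0 ?hnorm_ge0//.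
rewrite sqrrD !hnorm_sqr hdotDl !hdotDr (hdotC y x).
have := CauchySchwarz_Re x y.
case: '[x, y] => a b /=; case: '[x, x] => c d; case: '[y, y] => e f /= h.
lra.
Qed.

Fact badd_linear S T : linear (fun x => S x + T x).
Proof. by move=> a x y; rewrite !linearP scalerDr addrACA. Qed.

Fact badd_bounded S T : exists K : R, forall x, hnorm (S x + T x) <= K * hnorm x.
Proof.
have [K SK] := bfun_bounded S; have [L TL] := bfun_bounded T.
by exists (K + L) => x; rewrite mulrDl (le_trans (hnormD _ _))// lerD.
Qed.

Fact badd_adj S T x y : '[S x + T x, y] = '[x, badj S y + badj T y].
Proof. by rewrite hdotDl hdotDr !badjP. Qed.

Definition badd S T : bop H :=
  Bop (@badd_linear S T) (badd_bounded S T) (@badd_adj S T).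

Fact bscale_linear a T : linear (fun x => a *: T x).
Proof. by move=> b x y; rewrite linearP scalerDr !scalerA mulrC. Qed.

Fact bscale_bounded (a : C) T : exists K : R, forall x, hnorm (a *: T x) <= K * hnorm x.
Proof.
have [K TK] := bfun_bounded T; exists (cabs a * K) => x.
by rewrite hnormZ -mulrA ler_wpM2l// cabs_ge0.
Qed.

Fact bscale_adj a T x y : '[a *: T x, y] = '[x, Num.conj a *: badj T y].
Proof. by rewrite hdotZl hdotZr badjP conjCK. Qed.

Definition bscale a T : bop H :=
  Bop (@bscale_linear a T) (bscale_bounded a T) (@bscale_adj a T).

Fact bmul_linear S T : linear (fun x => S (T x)).
Proof. by move=> a x y; rewrite !linearP. Qed.

Fact bmul_bounded S T : exists K : R, forall x, hnorm (S (T x)) <= K * hnorm x.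
Proof.
have [K SK] := bfun_bounded S; have [L TL] := bfun_bounded T.
exists (Num.max K 0 * L) => x; rewrite -mulrA.
apply: (le_trans (SK _)); apply: (@le_trans _ _ (Num.max K 0 * hnorm (T x))).
  by rewrite ler_wpM2r ?hnorm_ge0// le_max lexx.
by rewrite ler_wpM2l// le_max lexx orbT.
Qed.

Fact bmul_adj S T x y : '[S (T x), y] = '[x, badj T (badj S y)].
Proof. by rewrite !badjP. Qed.

Definition bmul S T : bop H :=
  Bop (@bmul_linear S T) (bmul_bounded S T) (@bmul_adj S T).

HB.instance Definition _ := gen_eqMixin (bop H).
HB.instance Definition _ := gen_choiceMixin (bop H).

Fact baddA : associative badd.
Proof. by move=> S T U; apply: bop_eq => x; rewrite /= addrA. Qed.
Fact baddC : commutative badd.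
Proof. by move=> S T; apply: bop_eq => x; rewrite /= addrC. Qed.
Fact badd0 : left_id bzero badd.
Proof. by move=> S; apply: bop_eq => x; rewrite /= add0r. Qed.
Fact baddN : left_inverse bzero (bscale (-1)) badd.
Proof. by move=> S; apply: bop_eq => x; rewrite /= scaleN1r addNr. Qed.

HB.instance Definition _ := GRing.isZmodule.Build (bop H) baddA baddC badd0 baddN.

Fact bmulA : associative bmul. Proof. by move=> S T U; apply: bop_eq. Qed.
Fact bmul1l : left_id bone bmul. Proof. by move=> S; apply: bop_eq. Qed.
Fact bmul1r : right_id bone bmul. Proof. by move=> S; apply: bop_eq. Qed.
Fact bmulDl : left_distributive bmul +%R.
Proof. by move=> S T U; apply: bop_eq. Qed.
Fact bmulDr : right_distributive bmul +%R.
Proof. by move=> S T U; apply: bop_eq => x; rewrite /= linearD. Qed.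

HB.instance Definition _ := GRing.Zmodule_isPzRing.Build (bop H)
  bmulA bmul1l bmul1r bmulDl bmulDr.

Fact bscaleA a b T : bscale a (bscale b T) = bscale (a * b) T.
Proof. by apply: bop_eq => x; rewrite /= scalerA. Qed.
Fact bscale1 : left_id 1 bscale.
Proof. by move=> T; apply: bop_eq => x; rewrite /= scale1r. Qed.
Fact bscaleDr : right_distributive bscale +%R.
Proof. by move=> a S T; apply: bop_eq => x; rewrite /= scalerDr. Qed.
Fact bscaleDl T : {morph bscale^~ T : a b / a + b}.
Proof. by move=> a b; apply: bop_eq => x; rewrite /= scalerDl. Qed.

HB.instance Definition _ := GRing.Zmodule_isLmodule.Build C (bop H)
  bscaleA bscale1 bscaleDr bscaleDl.

Lemma bopD S T x : (S + T) x = S x + T x. Proof. by []. Qed.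
Lemma bopZ a T x : (a *: T) x = a *: T x. Proof. by []. Qed.
Lemma bopM S T x : (S * T) x = S (T x). Proof. by []. Qed.
Lemma bop1 x : (1 : bop H) x = x. Proof. by []. Qed.

Lemma bopN T x : (- T) x = - T x.
Proof. by rewrite -[RHS]scaleN1r. Qed.

Lemma bstarK T : bstar (bstar T) = T. Proof. exact: bop_eq. Qed.

Lemma bstarM S T : bstar (S * T) = bstar T * bstar S.
Proof. exact: bop_eq. Qed.

Lemma bstarP T x y : '[T x, y] = '[x, bstar T y].
Proof. exact: badjP. Qed.

End Hilbert.

(* The Hilbert space of square-summable families indexed by T. *)
Section L2.
Variables (R : realType) (T : choiceType).
Local Notation C := R[i].

Definition square_summable (f : T -> C) : Prop :=
  (\esum_(i in [set: T]) (cabs (f i) ^+ 2)%:E < +oo)%E.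

Lemma square_summableE f :
  square_summable f = abs_summable (fun i => cabs (f i) ^+ 2).
Proof.
rewrite /square_summable /abs_summable.
have -> : (\esum_(i in [set: T]) `|cabs (f i) ^+ 2|%:E =
    \esum_(i in [set: T]) (cabs (f i) ^+ 2)%:E)%E => //.
by apply: eq_esum => i _; rewrite ger0_norm ?sqr_ge0.
Qed.

Definition l2_pred : {pred T -> C} := fun f => `[< square_summable f >].

Fact l2_pred_submod : submod_closed l2_pred.
Proof.
split=> [|a f g]; rewrite !unfold_in.
  apply/asboolP; rewrite square_summableE; apply: abs_summable_le (_ : abs_summable (fun _ => 0)).
    by move=> i; rewrite cabs0 expr0n normr0.
  by rewrite /abs_summable esum1 ?ltry// => i _; rewrite normr0.
move=> /asboolP + /asboolP; rewrite !square_summableE => sf sg; apply/asboolP.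
apply: abs_summable_le (abs_summableD (abs_summableZ (2 * cabs a ^+ 2) sf) (abs_summableZ 2 sg)).
move=> i; rewrite ger0_norm ?sqr_ge0//.
have h1 : cabs (a * f i + g i) <= cabs a * cabs (f i) + cabs (g i).
  by rewrite -cabsM cabsD.
apply: (@le_trans _ _ ((cabs a * cabs (f i) + cabs (g i)) ^+ 2)).
  rewrite ler_pXn2r// ?nnegrE ?addr_ge0 ?mulr_ge0 ?cabs_ge0//.
have := sqr_ge0 (cabs a * cabs (f i) - cabs (g i)).
by move=> h; lra.
Qed.

HB.instance Definition _ := GRing.isSubmodClosed.Build C (T -> C) l2_pred l2_pred_submod.

Record l2 := L2 { l2_val :> T -> C; _ : l2_pred l2_val }.

HB.instance Definition _ := [isSub for l2_val].
HB.instance Definition _ := [Choice of l2 by <:].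
HB.instance Definition _ := [SubChoice_isSubLmodule of l2 by <:].

Implicit Types f g : l2.

Lemma l2P f : abs_summable (fun i => cabs (f i) ^+ 2).
Proof. by rewrite -square_summableE; apply/asboolP; exact: (valP f). Qed.

Lemma l2_eq f g : (forall i, f i = g i) -> f = g.
Proof. by move=> e; apply/val_inj/funext. Qed.

Lemma l2D f g i : (f + g) i = f i + g i. Proof. by []. Qed.
Lemma l2N f i : (- f) i = - f i. Proof. by []. Qed.
Lemma l2Z a f i : (a *: f) i = a * f i. Proof. by []. Qed.
Lemma l20 i : (0 : l2) i = 0. Proof. by []. Qed.

Definition l2_dot f g : C := csum (fun i => f i * Num.conj (g i)).

Lemma l2_dot_summable f g : csummable (fun i => f i * Num.conj (g i)).
Proof.
apply: csummable_le (abs_summableD (l2P f) (l2P g)) => i.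
rewrite cabsM cabsJ.
have := sqr_ge0 (cabs (f i) - cabs (g i)).
have := mulr_ge0 (cabs_ge0 (f i)) (cabs_ge0 (g i)).
by move=> h1 h2; lra.
Qed.

Fact l2_dotC f g : l2_dot f g = (-1) ^+ false * Num.conj (l2_dot g f).
Proof.
rewrite expr0 mul1r /l2_dot -csumJ; congr csum; apply/funext => i.
by rewrite rmorphM /= conjCK mulrC.
Qed.

Fact l2_dotl g : linear_for *%R (l2_dot^~ g).
Proof.
move=> a f f'; have s1 := l2_dot_summable f g; have s2 := l2_dot_summable f' g.
rewrite /l2_dot -(csumZ a s1).
rewrite -(csumD (csummableZ a s1) s2).
by congr csum; apply/funext => i; rewrite l2D l2Z mulrDl mulrA.
Qed.

Fact l2_dotr f : linear_for (Num.conj \; *%R) (l2_dot f).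
Proof.
move=> a g g'; rewrite l2_dotC l2_dotl expr0 mul1r rmorphD rmorphM /=.
by rewrite [l2_dot f g]l2_dotC [l2_dot f g']l2_dotC !expr0 !mul1r.
Qed.

Lemma l2_dotE f : l2_dot f f = (rsum (fun i => cabs (f i) ^+ 2))%:C%C.
Proof.
rewrite /l2_dot -csum_real; congr csum; apply/funext => i.
by rewrite -normCK -cabsE rmorphXn.
Qed.

Fact l2_dot_gt0 f : f != 0 -> 0 < l2_dot f f.
Proof.
move=> fN; rewrite l2_dotE ltcR.
have [j fj] : exists j, f j != 0.
  apply/not_existsP => h; move/eqP: fN; apply; apply: l2_eq => i.
  by apply/eqP; apply/negPn/negP; exact: h.
have fj0 : 0 < cabs (f j) ^+ 2.
  rewrite exprn_gt0// lt_def cabs_ge0 andbT; apply/eqP => /cabs_eq0 /eqP.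
  exact/negP.
apply: (lt_le_trans fj0); rewrite rsum_ge0; last by move=> i; rewrite sqr_ge0.
rewrite -lee_fin fineK; last by apply: esum_fin (l2P f) => i; rewrite sqr_ge0.
rewrite (esumID [set j]); last by move=> i _; rewrite lee_fin sqr_ge0.
rewrite setTI esum_set1 ?lee_fin ?sqr_ge0// leeDl// esum_ge0// => i _.
by rewrite lee_fin sqr_ge0.
Qed.

HB.instance Definition _ := @bilinear_isBilinear.Build C l2 l2 C *%R
  (Num.conj \; *%R) l2_dot (l2_dotl, l2_dotr).
HB.instance Definition _ := @isHermitianSesquilinear.Build C l2 false Num.conj
  l2_dot l2_dotC.
HB.instance Definition _ := @isDotProduct.Build C l2 l2_dot l2_dot_gt0.

Lemma l2_dnorm_sqr f : (dnorm l2_dot f) ^+ 2 = rsum (fun i => cabs (f i) ^+ 2).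
Proof.
rewrite /dnorm sqr_sqrtr l2_dotE//= rsum_ge0; last by move=> i; rewrite sqr_ge0.
by rewrite fine_ge0// esum_ge0// => i _; rewrite lee_fin sqr_ge0.
Qed.

Lemma l2_dnorm_ge0 f : 0 <= dnorm l2_dot f. Proof. exact: sqrtr_ge0. Qed.

Lemma l2_fsum_le f (A : set T) : finite_set A ->
  \sum_(i \in A) cabs (f i) ^+ 2 <= (dnorm l2_dot f) ^+ 2.
Proof.
move=> fA; rewrite l2_dnorm_sqr rsum_ge0; last by move=> i; rewrite sqr_ge0.
rewrite -lee_fin fineK; last by apply: esum_fin (l2P f) => i; rewrite sqr_ge0.
by rewrite -fsumEFin//; apply: ereal_sup_ubound; exists A => //; split.
Qed.

Lemma l2_coef_le f i : cabs (f i) <= dnorm l2_dot f.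
Proof.
rewrite -(@ler_pXn2r _ 2)// ?nnegrE ?cabs_ge0 ?l2_dnorm_ge0//.
by apply: le_trans (l2_fsum_le f (finite_set1 i)); rewrite fsbig_set1.
Qed.

Lemma l2_of_fsum (F : T -> C) (K : R) :
  (forall A : set T, finite_set A -> \sum_(i \in A) cabs (F i) ^+ 2 <= K) ->
  l2_pred F /\ rsum (fun i => cabs (F i) ^+ 2) <= K.
Proof.
move=> FK.
have h : (\esum_(i in [set: T]) (cabs (F i) ^+ 2)%:E <= K%:E)%E.
  apply: ge_ereal_sup => _ [A [fA _] <-]; rewrite fsumEFin// lee_fin; exact: FK.
split; first by apply/asboolP; apply: (le_lt_trans h); rewrite ltry.
rewrite rsum_ge0; last by move=> i; rewrite sqr_ge0.
rewrite -lee_fin fineK// ge0_fin_numE; last by apply: esum_ge0 => i _; rewrite lee_fin sqr_ge0.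
by apply: (le_lt_trans h); rewrite ltry.
Qed.

Fact l2_complete (u : nat -> l2) :
  (forall e : R, 0 < e -> exists N : nat, forall m n : nat,
     (N <= m)%N -> (N <= n)%N -> dnorm l2_dot (u m - u n) < e) ->
  exists l : l2, (fun n => dnorm l2_dot (u n - l)) @ \oo --> (0 : R).
Proof.
move=> cu.
have creal (v : nat -> R) : (forall e : R, 0 < e -> exists N : nat, forall m n : nat,
    (N <= m)%N -> (N <= n)%N -> `|v m - v n| < e) -> exists l : R, v @ \oo --> l.
  move=> cv; suff : cvgn v by move=> h; exists (limn v).
  apply: R_complete; apply: cauchy_exP => e e0.
  have [N vN] := cv e e0; exists (v N).
  by exists N => // n /= Nn; rewrite /ball /=; exact: vN.
have dB (z w : C) : complex.Re z - complex.Re w = complex.Re (z - w) /\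
    complex.Im z - complex.Im w = complex.Im (z - w) by case: z; case: w.
have /boolp.choice[l1 l1P] : forall i, exists l : R, (fun n => complex.Re (u n i)) @ \oo --> l.
  move=> i; apply: creal => e e0; have [N uN] := cu e e0.
  exists N => m n Nm Nn; apply: le_lt_trans (uN m n Nm Nn).
  by rewrite (dB _ _).1; apply: le_trans (Re_le_cabs _) (l2_coef_le (u m - u n) i).
have /boolp.choice[l2' l2P'] : forall i, exists l : R, (fun n => complex.Im (u n i)) @ \oo --> l.
  move=> i; apply: creal => e e0; have [N uN] := cu e e0.
  exists N => m n Nm Nn; apply: le_lt_trans (uN m n Nm Nn).
  by rewrite (dB _ _).2; apply: le_trans (Im_le_cabs _) (l2_coef_le (u m - u n) i).
pose l i : C := Complex (l1 i) (l2' i).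
have key (e : R) : 0 < e -> exists N : nat, forall n, (N <= n)%N ->
    forall A : set T, finite_set A -> \sum_(i \in A) cabs (u n i - l i) ^+ 2 <= e ^+ 2.
  move=> e0; have [N uN] := cu e e0; exists N => n Nn A fA.
  have cv : (fun m => \sum_(i \in A) cabs (u n i - u m i) ^+ 2) @ \oo -->
      \sum_(i \in A) cabs (u n i - l i) ^+ 2.
    rewrite fsbig_finite//=; under eq_fun do rewrite fsbig_finite//=.
    apply: cvg_big => [|i _]; first exact: add_continuous.
    have -> : cabs (u n i - l i) ^+ 2 = (complex.Re (u n i) - l1 i) ^+ 2 +
        (complex.Im (u n i) - l2' i) ^+ 2.
      by rewrite cabs_sqr -(dB _ _).1 -(dB _ _).2.
    under eq_fun do rewrite cabs_sqr -(dB _ _).1 -(dB _ _).2 !expr2.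
    rewrite !expr2; apply: cvgD; apply: cvgM; apply: cvgB => //; exact: cvg_cst.
  rewrite -(cvg_lim _ cv)//; apply: limr_le; first by apply/cvg_ex; eexists; exact: cv.
  exists N => // m /= Nm.
  apply: le_trans (l2_fsum_le (u n - u m) fA) _.
  by rewrite ler_pXn2r ?nnegrE ?l2_dnorm_ge0 ?(ltW e0)// ltW// uN.
have [N1 N1P] := key 1 ltr01.
have [p1 _] := l2_of_fsum (N1P N1 (leqnn _)).
have p2 : l2_pred l.
  have -> : l = -1 *: ((fun i => u N1 i - l i) : T -> C) + l2_val (u N1).
    apply/funext => i; rewrite -[RHS]/(-1 * (u N1 i - l i) + u N1 i).
    by rewrite mulN1r opprB subrK.
  by apply: (l2_pred_submod.2) => //; exact: (valP (u N1)).
exists (L2 p2); apply/cvgrPdist_lt => e e0.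
have [N NP] := key (e / 2) (divr_gt0 e0 (ltr0Sn _ _)).
exists N => // n /= Nn; rewrite sub0r normrN ger0_norm ?l2_dnorm_ge0//.
apply: (@le_lt_trans _ _ (e / 2)); last by lra.
rewrite -(@ler_pXn2r _ 2)// ?nnegrE ?l2_dnorm_ge0//; last by lra.
by rewrite l2_dnorm_sqr; exact: (l2_of_fsum (NP n Nn)).2.
Qed.

Definition l2_hilbert : hilbert R := Hilbert l2_complete.

Fact l2_delta_pred (j : T) : l2_pred (fun i => if i == j then 1 else 0).
Proof.
apply/asboolP; rewrite square_summableE; apply: (@abs_summable_single _ _ j).
by move=> i /negbTE ->; rewrite cabs0 expr0n.
Qed.

Definition l2_delta (j : T) : l2_hilbert := L2 (l2_delta_pred j).

Lemma l2_deltaE (j i : T) : (l2_delta j : l2) i = if i == j then 1 else 0.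
Proof. by []. Qed.

Lemma hdot_delta (f : l2_hilbert) (j : T) :
  hdot l2_hilbert f (l2_delta j) = (f : l2) j.
Proof.
rewrite -[LHS]/(l2_dot f (l2_delta j)) /l2_dot (@csum_single _ _ j).
  by rewrite l2_deltaE eqxx conjC1 mulr1.
by move=> i /negbTE ij; rewrite l2_deltaE ij conjC0 mulr0.
Qed.

End L2.

Section Double.
Variables (R : realType) (H : hilbert R).
Local Notation C := R[i].
Local Notation HH := (hsort H * hsort H)%type.

Definition double_dot (x y : HH) : C := hdot H x.1 y.1 + hdot H x.2 y.2.

Fact double_dotC (x y : HH) : double_dot x y = (-1) ^+ false * Num.conj (double_dot y x).
Proof. by rewrite expr0 mul1r /double_dot rmorphD /= -!hdotC. Qed.

Fact double_dotl (y : HH) : linear_for *%R (double_dot^~ y).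
Proof.
by move=> a x x'; rewrite /double_dot /= !hdotDl !hdotZl mulrDr addrACA.
Qed.

Fact double_dotr (x : HH) : linear_for (Num.conj \; *%R) (double_dot x).
Proof.
by move=> a y y'; rewrite /double_dot /= !hdotDr !hdotZr mulrDr addrACA.
Qed.

Fact double_dot_gt0 (x : HH) : x != 0 -> 0 < double_dot x x.
Proof.
move=> xN; rewrite lt_def addr_ge0 ?hdot_ge0// andbT.
apply: contraNN xN; rewrite paddr_eq0 ?hdot_ge0// => /andP[/eqP x1 /eqP x2].
by apply/eqP; case: x x1 x2 => x1 x2 /= /hdot_eq0 -> /hdot_eq0 ->.
Qed.

HB.instance Definition _ := @bilinear_isBilinear.Build C HH HH C *%R
  (Num.conj \; *%R) double_dot (double_dotl, double_dotr).
HB.instance Definition _ := @isHermitianSesquilinear.Build C HH false Num.conj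
  double_dot double_dotC.
HB.instance Definition _ := @isDotProduct.Build C HH double_dot double_dot_gt0.

Lemma double_dnorm_sqr (x : HH) :
  (dnorm double_dot x) ^+ 2 = hnorm x.1 ^+ 2 + hnorm x.2 ^+ 2.
Proof.
rewrite /dnorm sqr_sqrtr /double_dot ReD -?hnorm_sqr//.
by rewrite addr_ge0 ?sqr_ge0.
Qed.

Lemma double_dnorm_ge1 (x : HH) : hnorm x.1 <= dnorm double_dot x.
Proof.
rewrite -(@ler_pXn2r _ 2)// ?nnegrE ?hnorm_ge0 ?sqrtr_ge0//.
by rewrite double_dnorm_sqr lerDl sqr_ge0.
Qed.

Lemma double_dnorm_ge2 (x : HH) : hnorm x.2 <= dnorm double_dot x.
Proof.
rewrite -(@ler_pXn2r _ 2)// ?nnegrE ?hnorm_ge0 ?sqrtr_ge0//.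
by rewrite double_dnorm_sqr lerDr sqr_ge0.
Qed.

Lemma double_dnorm_le (x : HH) : dnorm double_dot x <= hnorm x.1 + hnorm x.2.
Proof.
rewrite -(@ler_pXn2r _ 2)// ?nnegrE ?addr_ge0 ?hnorm_ge0 ?sqrtr_ge0//.
rewrite double_dnorm_sqr sqrrD addrAC lerDl mulrn_wge0// mulr_ge0 ?hnorm_ge0//.
Qed.

Fact double_complete (u : nat -> HH) :
  (forall e : R, 0 < e -> exists N : nat, forall m n : nat,
     (N <= m)%N -> (N <= n)%N -> dnorm double_dot (u m - u n) < e) ->
  exists l : HH, (fun n => dnorm double_dot (u n - l)) @ \oo --> (0 : R).
Proof.
move=> cu.
have [l1 l1P] := @hcomplete R H (fun n => (u n).1) (fun e e0 =>
  let: ex_intro N uN := cu e e0 in ex_intro _ N (fun m n Nm Nn =>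
    le_lt_trans (double_dnorm_ge1 (u m - u n)) (uN m n Nm Nn))).
have [l2 l2P] := @hcomplete R H (fun n => (u n).2) (fun e e0 =>
  let: ex_intro N uN := cu e e0 in ex_intro _ N (fun m n Nm Nn =>
    le_lt_trans (double_dnorm_ge2 (u m - u n)) (uN m n Nm Nn))).
exists (l1, l2).
move/cvgrPdist_lt: l1P => c1; move/cvgrPdist_lt: l2P => c2.
apply/cvgrPdist_lt => e e0; have e2 : 0 < e / 2 by rewrite divr_gt0.
have [N1 _ N1P] := c1 _ e2; have [N2 _ N2P] := c2 _ e2.
exists (maxn N1 N2) => // n /=; rewrite geq_max => /andP[/N1P /= + /N2P /=].
rewrite !sub0r !normrN !ger0_norm ?sqrtr_ge0// => h1 h2.
apply: le_lt_trans (double_dnorm_le (u n - (l1, l2))) _.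
by rewrite [e]splitr ltrD.
Qed.

(* The Hilbert space direct sum of two copies of H. *)
Definition hdouble : hilbert R := Hilbert double_complete.

(* For i j : bool, [bentry i j T] is the (i, j) entry of the operator T on the
   direct sum of two copies of H, seen as a 2 x 2 matrix of operators on H;
   the value false stands for the first index. *)
Definition dproj (i : bool) (x : hdouble) : H :=
  if i then (x : HH).2 else (x : HH).1.

Definition dinj (i : bool) (x : H) : hdouble :=
  if i then ((0, x) : HH) else ((x, 0) : HH).

Fact bentry_linear i j (T : bop hdouble) : linear (fun x => dproj i (T (dinj j x))).
Proof.
move=> a x y.
have -> : dinj j (a *: x + y) = a *: dinj j x + dinj j y.
  by case: j; congr pair; rewrite /= ?scaler0 ?addr0.
by rewrite linearP; case: i.
Qed.

Lemma hnorm_dinj i x : hnorm (dinj i x) = hnorm x.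
Proof.
rewrite /hnorm /dnorm /= /double_dot; case: i => /=; by rewrite hdot0l ?add0r ?addr0.
Qed.

Lemma hdot_dproj i x (y : H) : hdot H (dproj i x) y = hdot hdouble x (dinj i y).
Proof.
by rewrite -[RHS]/(double_dot _ _) /double_dot; case: i; rewrite /= hdot0r ?add0r ?addr0.
Qed.

Fact bentry_bounded i j (T : bop hdouble) :
  exists K : R, forall x, hnorm (dproj i (T (dinj j x))) <= K * hnorm x.
Proof.
have [K TK] := bfun_bounded T; exists K => x.
have := TK (dinj j x); rewrite hnorm_dinj; apply: le_trans.
by case: i; [exact: double_dnorm_ge2|exact: double_dnorm_ge1].
Qed.

Fact bentry_adj i j (T : bop hdouble) x y :
  hdot H (dproj i (T (dinj j x))) y = hdot H x (dproj j (badj T (dinj i y))).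
Proof. by rewrite hdot_dproj badjP hdotC -hdot_dproj -hdotC. Qed.

Definition bentry (i j : bool) (T : bop hdouble) : bop H :=
  Bop (@bentry_linear i j T) (bentry_bounded i j T) (@bentry_adj i j T).

Lemma dinjE (x : hdouble) : x = dinj false (dproj false x) + dinj true (dproj true x).
Proof. by case: x => x1 x2; congr pair; rewrite /= ?add0r ?addr0. Qed.

Lemma dprojD i (x y : hdouble) : dproj i (x + y) = dproj i x + dproj i y.
Proof. by case: i. Qed.

Lemma dprojZ i a (x : hdouble) : dproj i (a *: x) = a *: dproj i x.
Proof. by case: i. Qed.

Lemma bentryM i j (S T : bop hdouble) : bentry i j (S * T) =
  bentry i false S * bentry false j T + bentry i true S * bentry true j T.
Proof.
apply: bop_eq => x; rewrite bopD !bopM -[LHS]/(dproj i (S (T (dinj j x)))).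
by rewrite [in LHS](dinjE (T _)) linearD dprojD.
Qed.

Lemma bentryP i j a (S T : bop hdouble) :
  bentry i j (a *: S + T) = a *: bentry i j S + bentry i j T.
Proof. by apply: bop_eq => x; rewrite /= dprojD dprojZ. Qed.

Lemma bentry_star i j T : bentry i j (bstar T) = bstar (bentry j i T).
Proof. exact: bop_eq. Qed.

Lemma bentry1 i j : bentry i j 1 = if i == j then 1 else 0.
Proof. by apply: bop_eq => x; case: i; case: j. Qed.

Lemma bentry_eq (S T : bop hdouble) : (forall i j, bentry i j S = bentry i j T) -> S = T.
Proof.
move=> e; apply: bop_eq => x.
have key (U : bop hdouble) i : dproj i (U x) =
    bentry i false U (dproj false x) + bentry i true U (dproj true x).
  by rewrite {1}(dinjE x) linearD dprojD.
by rewrite (dinjE (S x)) (dinjE (T x)) !key !e.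
Qed.

Fact bdouble_linear (X : bop H) :
  linear (fun x : hdouble => ((X (dproj false x), X (dproj true x)) : HH) : hdouble).
Proof. by move=> a x y; congr pair; rewrite ?dprojD ?dprojZ linearP. Qed.

Fact bdouble_bounded (X : bop H) : exists K : R, forall x : hdouble,
  hnorm (((X (dproj false x), X (dproj true x)) : HH) : hdouble) <= K * hnorm x.
Proof.
have [K XK] := bfun_bounded X; exists (Num.max K 0 + Num.max K 0) => x.
have h y : hnorm (X y) <= Num.max K 0 * hnorm y.
  by apply: le_trans (XK y) _; rewrite ler_wpM2r ?hnorm_ge0// le_max lexx.
apply: le_trans (double_dnorm_le _) _; rewrite mulrDl lerD//= (le_trans (h _))//.
  by rewrite ler_wpM2l// ?le_max ?lexx ?orbT//; exact: double_dnorm_ge1.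
by rewrite ler_wpM2l// ?le_max ?lexx ?orbT//; exact: double_dnorm_ge2.
Qed.

Fact bdouble_adj (X : bop H) (x y : hdouble) :
  hdot hdouble (((X (dproj false x), X (dproj true x)) : HH) : hdouble) y =
  hdot hdouble x (((badj X (dproj false y), badj X (dproj true y)) : HH) : hdouble).
Proof.
by rewrite -[LHS]/(double_dot _ _) -[RHS]/(double_dot _ _) /double_dot /= !badjP.
Qed.

Definition bdouble (X : bop H) : bop hdouble :=
  Bop (@bdouble_linear X) (bdouble_bounded X) (@bdouble_adj X).

Lemma bentry_double i j X : bentry i j (bdouble X) = if i == j then X else 0.
Proof. by apply: bop_eq => x; case: i; case: j => //=; rewrite linear0. Qed.

End Double.

Definition commutant (R : realType) (H : hilbert R) (S : set (bop H)) : set (bop H) :=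
  [set T | forall s, S s -> T * s = s * T].

Lemma commutant_le (R : realType) (H : hilbert R) (S S' : set (bop H)) :
  S `<=` S' -> commutant S' `<=` commutant S.
Proof. by move=> SS T TS s /SS; exact: TS. Qed.

Lemma sub_bicommutant (R : realType) (H : hilbert R) (S : set (bop H)) :
  S `<=` commutant (commutant S).
Proof. by move=> s Ss T TS; rewrite TS. Qed.

Lemma tricommutant (R : realType) (H : hilbert R) (S : set (bop H)) :
  commutant (commutant (commutant S)) = commutant S.
Proof.
apply/seteqP; split; last exact: sub_bicommutant.
exact/commutant_le/sub_bicommutant.
Qed.

Lemma commutant_star (R : realType) (H : hilbert R) (S : set (bop H)) :
  (forall s, S s -> S (bstar s)) -> forall s, commutant S s -> commutant S (bstar s).
Proof.
move=> Sst s sS t St.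
by rewrite -[t]bstarK -!bstarM sS//; exact: Sst.
Qed.

(* A von Neumann algebra: a self-adjoint set of bounded operators on a Hilbert
   space that is equal to its bicommutant. Such a set automatically is a
   subalgebra containing the identity operator. *)
Record vnalg (R : realType) := VNAlg {
  vn_space : hilbert R;
  vn_set : set (bop vn_space);
  vn_star : forall x, vn_set x -> vn_set (bstar x);
  vn_bicommutant : commutant (commutant vn_set) = vn_set }.

Arguments vn_set {R} v _.

(* The restriction of phi to M belongs to the predual of M, i.e., is
   ultraweakly continuous. *)
Definition normal_on (R : realType) (H : hilbert R) (M : set (bop H))
    (phi : bop H -> R[i]) : Prop :=
  exists xi eta : nat -> H,
    [/\ (\esum_(n in [set: nat]) (hnorm (xi n) ^+ 2)%:E < +oo)%E,
        (\esum_(n in [set: nat]) (hnorm (eta n) ^+ 2)%:E < +oo)%E &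
        forall x, M x -> phi x = csum (fun n => hdot H (x (xi n)) (eta n))].

(* A finite von Neumann algebra: a von Neumann algebra together with a faithful
   normal tracial state; only the values of [vn_tr] on the algebra matter. *)
Record fvnalg (R : realType) := FVNAlg {
  fvn :> vnalg R;
  vn_tr : bop (vn_space fvn) -> R[i];
  vn_tr_linear : forall a x y, vn_set fvn x -> vn_set fvn y ->
    vn_tr (a *: x + y) = a * vn_tr x + vn_tr y;
  vn_tr1 : vn_tr 1 = 1;
  vn_tr_ge0 : forall x, vn_set fvn x -> 0 <= vn_tr (bstar x * x);
  vn_tr_faithful : forall x, vn_set fvn x -> vn_tr (bstar x * x) = 0 -> x = 0;
  vn_tr_trace : forall x y, vn_set fvn x -> vn_set fvn y -> vn_tr (x * y) = vn_tr (y * x);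
  vn_tr_normal : normal_on (vn_set fvn) vn_tr }.

Section Commutant.
Variables (R : realType) (M : vnalg R).
Implicit Types x y : bop (vn_space M).

Lemma vn_mul x y : vn_set M x -> vn_set M y -> vn_set M (x * y).
Proof.
rewrite -(vn_bicommutant M) => xM yM t tM.
by rewrite -mulrA yM// mulrA xM// mulrA.
Qed.

Lemma vn_lin a x y : vn_set M x -> vn_set M y -> vn_set M (a *: x + y).
Proof.
rewrite -(vn_bicommutant M) => xM yM t tM; rewrite mulrDl mulrDr yM//.
congr (_ + _); apply: bop_eq => z.
have := congr1 (fun U : bop (vn_space M) => U z) (xM t tM); rewrite !bopM !bopZ => ->.
by rewrite linearZ.
Qed.

Lemma vn_add x y : vn_set M x -> vn_set M y -> vn_set M (x + y).
Proof. by move=> xM yM; rewrite -[x]scale1r; exact: vn_lin. Qed.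

Lemma vn_one : vn_set M 1.
Proof. by rewrite -(vn_bicommutant M) => t _; rewrite mul1r mulr1. Qed.

Lemma vn_zero : vn_set M 0.
Proof. by rewrite -(vn_bicommutant M) => t _; rewrite mul0r mulr0. Qed.

End Commutant.

Section Normal.
Variables (R : realType) (H : hilbert R) (M : set (bop H)).
Local Notation C := R[i].

Lemma hnorm_single (x : H) :
  (\esum_(n in [set: nat]) (hnorm (if n == 0%N then x else 0 : H) ^+ 2)%:E < +oo)%E.
Proof.
rewrite (@esum_single _ _ 0%N) ?ltry//= => [i|i /negbTE ->]; first exact: sqr_ge0.
by rewrite hnorm_sqr hdot0l.
Qed.

Lemma normal_vector (x y : H) : normal_on M (fun T => hdot H (T x) y).
Proof.
exists (fun n => if n == 0%N then x else 0), (fun n => if n == 0%N then y else 0).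
split; [exact: hnorm_single|exact: hnorm_single|move=> T _].
by rewrite (@csum_single _ _ 0%N)// => i /negbTE ->; rewrite hdot0r.
Qed.

Lemma hdot_cabs_le (x y : H) : cabs (hdot H x y) <= hnorm x ^+ 2 + hnorm y ^+ 2.
Proof.
set z := hdot H x y; have [->|zN] := eqVneq z 0.
  by rewrite cabs0 addr_ge0 ?sqr_ge0.
pose w : C := `|z| / z.
have w1 : `|w| = 1 by rewrite normrM normrV ?unitfE// normr_id divff// normr_eq0.
have wz : hdot H (w *: x) y = `|z| by rewrite hdotZl -mulrA mulVf ?mulr1.
have := CauchySchwarz_Re (w *: x) y; rewrite wz -/(cabs z).
have -> : hnorm (w *: x) = hnorm x.
  by rewrite /hnorm /dnorm hdotZl hdotZr mulrA -normCK w1 expr1n mul1r.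
move=> h; apply: (le_trans h).
have := sqr_ge0 (hnorm x - hnorm y).
have := mulr_ge0 (hnorm_ge0 x) (hnorm_ge0 y).
move=> h1 h2; lra.
Qed.

Lemma normal_summable (T : bop H) (xi eta : nat -> H) :
  (\esum_(n in [set: nat]) (hnorm (xi n) ^+ 2)%:E < +oo)%E ->
  (\esum_(n in [set: nat]) (hnorm (eta n) ^+ 2)%:E < +oo)%E ->
  csummable (fun n => hdot H (T (xi n)) (eta n)).
Proof.
move=> h1 h2; have [K TK] := bfun_bounded T.
have abs (u : nat -> H) : (\esum_(n in [set: nat]) (hnorm (u n) ^+ 2)%:E < +oo)%E ->
    abs_summable (fun n => hnorm (u n) ^+ 2).
  by apply: le_lt_trans; apply: le_esum => i _; rewrite ger0_norm ?sqr_ge0.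
apply: csummable_le (abs_summableD (abs_summableZ (K ^+ 2) (abs _ h1)) (abs _ h2)) => n.
apply: le_trans (hdot_cabs_le _ _) _; rewrite lerD2r -exprMn.
have := TK (xi n) => hn; rewrite ler_pXn2r ?nnegrE ?hnorm_ge0//.
exact: le_trans (hnorm_ge0 _) hn.
Qed.

Lemma normalD (phi psi : bop H -> C) : normal_on M phi -> normal_on M psi ->
  normal_on M (fun T => phi T + psi T).
Proof.
move=> [xi [eta [h1 h2 h3]]] [xi' [eta' [h1' h2' h3']]].
pose mix (u v : nat -> H) n := if odd n then v n./2 else u n./2.
have mix0 u v n : mix u v n.*2 = u n by rewrite /mix odd_double doubleK.
have mix1 u v n : mix u v n.*2.+1 = v n.
  by rewrite /mix /= odd_double /= uphalf_double.
have mixS u v : (\esum_(n in [set: nat]) (hnorm (u n) ^+ 2)%:E < +oo)%E ->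
    (\esum_(n in [set: nat]) (hnorm (v n) ^+ 2)%:E < +oo)%E ->
    (\esum_(n in [set: nat]) (hnorm (mix u v n) ^+ 2)%:E < +oo)%E.
  move=> su sv; rewrite esum_parity; last by move=> i; exact: sqr_ge0.
  under eq_esum do rewrite mix0.
  under [X in (_ + X)%E]eq_esum do rewrite mix1.
  by rewrite lte_add_pinfty.
exists (mix xi xi'), (mix eta eta'); split; [exact: mixS|exact: mixS|].
move=> T MT; rewrite csum_parity; last by apply: normal_summable; exact: mixS.
under eq_fun do rewrite !mix0.
under [X in _ = _ + csum X]eq_fun do rewrite !mix1.
by rewrite h3// h3'.
Qed.

Lemma normalZ a (phi : bop H -> C) : normal_on M phi ->
  normal_on M (fun T => a * phi T).
Proof.
move=> [xi [eta [h1 h2 h3]]]; exists (fun n => a *: xi n), eta; split=> //.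
  have -> : (\esum_(n in [set: nat]) (hnorm (a *: xi n) ^+ 2)%:E =
     \esum_(n in [set: nat]) (cabs a ^+ 2 * (hnorm (xi n) ^+ 2))%:E)%E.
    apply: eq_esum => n _; congr EFin; apply: (@complexI R).
    rewrite [LHS]hnormE hdotZl hdotZr mulrA -normCK [RHS]rmorphM.
    by rewrite [X in _ = _ * X]hnormE [X in _ = X * _]rmorphXn [X in _ = X ^+ 2 * _]cabsE.
  rewrite esumZ ?sqr_ge0//; last by move=> i; exact: sqr_ge0.
  by rewrite lte_mul_pinfty// ?lee_fin ?sqr_ge0// esum_ge0.
move=> T MT; rewrite h3// -csumZ; last exact: normal_summable.
by congr csum; apply/funext => n; rewrite linearZ hdotZl.
Qed.

End Normal.

Section GroupVN.
Variables (R : realType) (G : zmodType).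
Local Notation C := R[i].
Local Notation H := (l2_hilbert R G).

Fact translate_pred (g : G) (f : l2 R G) : l2_pred (fun h => f (h - g)).
Proof.
apply/asboolP; rewrite /square_summable.
rewrite -(@esum_bij _ _ _ (fun h => h - g) (fun h => cabs (f h) ^+ 2)).
- by apply/asboolP; exact: (valP f).
- by exists (fun h => h + g) => h; rewrite ?subrK ?addrK.
- by move=> i; exact: sqr_ge0.
Qed.

Definition translate_fun (g : G) (f : H) : H := L2 (translate_pred g f).

Fact translate_linear g : linear (translate_fun g).
Proof. by move=> a x y; apply: l2_eq. Qed.

Lemma translate_dot g (f f' : H) :
  hdot H (translate_fun g f) f' = hdot H f (translate_fun (- g) f').
Proof.
rewrite -[LHS]/(l2_dot _ _) -[RHS]/(l2_dot _ _) /l2_dot.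
rewrite (@csum_bij _ _ _ (fun h => h + g)); last first.
  by exists (fun h => h - g) => h; rewrite ?subrK ?addrK.
by congr csum; apply/funext => h; rewrite /= addrK opprK.
Qed.

Fact translate_bounded g :
  exists K : R, forall f : H, hnorm (translate_fun g f) <= K * hnorm f.
Proof.
exists 1 => f; rewrite mul1r /hnorm /dnorm translate_dot.
suff -> : translate_fun (- g) (translate_fun g f) = f by [].
by apply: l2_eq => h /=; rewrite opprK addrK.
Qed.

(* The left regular representation of the (abelian, discrete) group G on the
   square-summable families indexed by G. *)
Definition translate (g : G) : bop H :=
  Bop (translate_linear g) (translate_bounded g) (@translate_dot g).

Lemma translateE g (f : H) h : (translate g f : l2 R G) h = (f : l2 R G) (h - g).
Proof. by []. Qed.

Lemma translate_star g : bstar (translate g) = translate (- g).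
Proof. exact: bop_eq. Qed.

Lemma translateC g g' : translate g * translate g' = translate g' * translate g.
Proof. by apply: bop_eq => f; apply: l2_eq => h /=; rewrite addrAC. Qed.

Lemma translate_delta g h : translate g (l2_delta R h) = l2_delta R (h + g).
Proof. by apply: l2_eq => k /=; rewrite subr_eq. Qed.

Definition groupvn_set : set (bop H) := commutant (commutant (range translate)).

Fact groupvn_star x : groupvn_set x -> groupvn_set (bstar x).
Proof.
apply: commutant_star; apply: commutant_star => _ [g _ <-].
by rewrite translate_star; exists (- g).
Qed.

Definition groupvn : vnalg R := VNAlg groupvn_star (tricommutant _).

Definition groupvn_tr (x : bop H) : C := hdot H (x (l2_delta R 0)) (l2_delta R 0).

Lemma groupvn_comm x y : groupvn_set x -> groupvn_set y -> x * y = y * x.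
Proof.
move=> xG yG; apply: xG => _ [g _ <-]; apply/esym; rewrite yG//.
by move=> _ [g' _ <-]; exact: translateC.
Qed.

Lemma groupvn_translate g : groupvn_set (translate g).
Proof. by apply: sub_bicommutant; exists g. Qed.

Lemma hnorm_delta (T : choiceType) (j : T) :
  hdot (l2_hilbert R T) (l2_delta R j) (l2_delta R j) = 1.
Proof. by rewrite hdot_delta l2_deltaE eqxx. Qed.

Fact groupvn_tr_linear a x y : groupvn_set x -> groupvn_set y ->
  groupvn_tr (a *: x + y) = a * groupvn_tr x + groupvn_tr y.
Proof. by move=> _ _; rewrite /groupvn_tr bopD bopZ hdotDl hdotZl. Qed.

Fact groupvn_tr1 : groupvn_tr 1 = 1.
Proof. exact: hnorm_delta. Qed.

Lemma groupvn_tr_star x :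
  groupvn_tr (bstar x * x) = hdot H (x (l2_delta R 0)) (x (l2_delta R 0)).
Proof. by rewrite /groupvn_tr bopM bstarP bstarK. Qed.

Fact groupvn_tr_ge0 x : groupvn_set x -> 0 <= groupvn_tr (bstar x * x).
Proof. by rewrite groupvn_tr_star => _; exact: hdot_ge0. Qed.

Fact groupvn_tr_trace x y : groupvn_set x -> groupvn_set y ->
  groupvn_tr (x * y) = groupvn_tr (y * x).
Proof. by move=> xG yG; rewrite groupvn_comm. Qed.

Lemma groupvn_delta0 x : groupvn_set x -> x (l2_delta R 0) = 0 ->
  forall g, x (l2_delta R g) = 0.
Proof.
move=> xG x0 g; rewrite -[g]add0r -translate_delta -bopM.
by rewrite (groupvn_comm xG (groupvn_translate g)) bopM x0 linear0.
Qed.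

Fact groupvn_tr_faithful x : groupvn_set x -> groupvn_tr (bstar x * x) = 0 -> x = 0.
Proof.
move=> xG x0; have xs := groupvn_star xG.
have xs0 : bstar x (l2_delta R 0) = 0.
  apply: hdot_eq0; rewrite -groupvn_tr_star bstarK.
  by rewrite groupvn_tr_trace.
apply: bop_eq => f; apply: l2_eq => g.
by rewrite -hdot_delta bstarP groupvn_delta0// hdot0r.
Qed.

Definition groupvn_fvn : fvnalg R := @FVNAlg R groupvn groupvn_tr
  groupvn_tr_linear groupvn_tr1 groupvn_tr_ge0 groupvn_tr_faithful
  groupvn_tr_trace (normal_vector _ _ _).

End GroupVN.

Definition LZ (R : realType) : fvnalg R := groupvn_fvn R int.

Section TwoPoints.
Variable R : realType.
Local Notation C := R[i].
Local Notation H := (l2_hilbert R bool).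

Section Coord.
Variables (T : choiceType) (j : T).
Local Notation K := (l2_hilbert R T).

Definition coord_fun (f : K) : K := (f : l2 R T) j *: l2_delta R j.

Fact coord_linear : linear coord_fun.
Proof. by move=> a f g; rewrite /coord_fun l2D l2Z scalerDl scalerA. Qed.

Fact coord_bounded : exists A : R, forall f : K, hnorm (coord_fun f) <= A * hnorm f.
Proof.
exists 1 => f; rewrite mul1r -(@ler_pXn2r _ 2)// ?nnegrE ?hnorm_ge0//.
have -> : hnorm (coord_fun f) ^+ 2 = cabs ((f : l2 R T) j) ^+ 2.
  apply: (@complexI R); rewrite [LHS]hnormE hdotZl hdotZr hnorm_delta mulr1 -normCK.
  by rewrite [RHS]rmorphXn [X in _ = X ^+ 2]cabsE.
by rewrite ler_pXn2r ?nnegrE ?hnorm_ge0 ?cabs_ge0//; exact: l2_coef_le.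
Qed.

Fact coord_adj f g : hdot K (coord_fun f) g = hdot K f (coord_fun g).
Proof.
rewrite hdotZl hdotZr hdotC !hdot_delta mulrC; congr (_ * _).
Qed.

Definition coord_proj : bop K := Bop coord_linear coord_bounded coord_adj.

End Coord.

(* C (+) C, acting on the Hilbert space C (+) C by diagonal operators *)
Definition C2_set : set (bop H) :=
  [set T | exists a : bool -> C, forall (f : H) i,
     (T f : l2 R bool) i = a i * (f : l2 R bool) i].

Fact C2_star x : C2_set x -> C2_set (bstar x).
Proof.
move=> [a xa]; exists (fun i => Num.conj (a i)) => f i.
rewrite -[LHS]hdot_delta bstarP bstarK.
have -> : x (l2_delta R i) = a i *: l2_delta R i.
  apply: l2_eq => k; rewrite xa l2Z l2_deltaE.
  by case: eqVneq => [->//|_]; rewrite !mulr0.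
by rewrite hdotZr hdot_delta.
Qed.

Fact C2_bicommutant : commutant (commutant C2_set) = C2_set.
Proof.
apply/seteqP; split=> [x xC|]; last exact: sub_bicommutant.
exists (fun i => (x (l2_delta R i) : l2 R bool) i) => f i.
have cC : commutant C2_set (coord_proj i).
  move=> s [a sa]; apply: bop_eq => g; rewrite !bopM; apply: l2_eq => k.
  rewrite sa !l2Z sa l2_deltaE.
  by case: eqVneq => [->|_]; rewrite ?mulr1 ?mulr0.
have := congr1 (fun U : bop H => (U f : l2 R bool) i) (xC _ cC).
rewrite !bopM l2Z l2_deltaE eqxx mulr1 => <-.
by rewrite /= /coord_fun linearZ l2Z mulrC.
Qed.

Definition C2_vn : vnalg R := VNAlg C2_star C2_bicommutant.

Definition C2_tr (x : bop H) : C :=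
  2^-1 * (hdot H (x (l2_delta R false)) (l2_delta R false) +
          hdot H (x (l2_delta R true)) (l2_delta R true)).

Fact C2_tr_linear a x y : C2_set x -> C2_set y ->
  C2_tr (a *: x + y) = a * C2_tr x + C2_tr y.
Proof.
move=> _ _; rewrite /C2_tr !bopD !bopZ !hdotDl !hdotZl.
by rewrite addrACA -(mulrDr a) [LHS]mulrDr mulrCA.
Qed.

Fact C2_tr1 : C2_tr 1 = 1.
Proof. by rewrite /C2_tr !hnorm_delta mulVf// pnatr_eq0. Qed.

Lemma C2_tr_star x : C2_tr (bstar x * x) =
  2^-1 * (hdot H (x (l2_delta R false)) (x (l2_delta R false)) +
          hdot H (x (l2_delta R true)) (x (l2_delta R true))).
Proof. by rewrite /C2_tr !bopM !bstarP !bstarK. Qed.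

Fact C2_tr_ge0 x : C2_set x -> 0 <= C2_tr (bstar x * x).
Proof.
by move=> _; rewrite C2_tr_star mulr_ge0 ?invr_ge0 ?addr_ge0 ?hdot_ge0 ?ler0n.
Qed.

Fact C2_tr_faithful x : C2_set x -> C2_tr (bstar x * x) = 0 -> x = 0.
Proof.
move=> [a xa]; rewrite C2_tr_star => /eqP.
rewrite mulf_eq0 invr_eq0 pnatr_eq0 orFb paddr_eq0 ?hdot_ge0//.
move=> /andP[/eqP h0 /eqP h1].
have x0 := @hdot_eq0 R H _ h0; have x1 := @hdot_eq0 R H _ h1.
have a0 i : a i = 0.
  have xi : x (l2_delta R i) = 0 by case: i.
  by have := xa (l2_delta R i) i; rewrite xi l2_deltaE eqxx mulr1 => <-.
by apply: bop_eq => f; apply: l2_eq => i; rewrite xa a0 mul0r.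
Qed.

Fact C2_tr_trace x y : C2_set x -> C2_set y -> C2_tr (x * y) = C2_tr (y * x).
Proof.
move=> [a xa] [b yb]; suff -> : x * y = y * x by [].
by apply: bop_eq => f; apply: l2_eq => i; rewrite !bopM !(xa, yb) mulrCA.
Qed.

Fact C2_tr_normal : normal_on C2_set C2_tr.
Proof. by apply/normalZ/normalD; exact: normal_vector. Qed.

Definition C2 : fvnalg R := @FVNAlg R C2_vn C2_tr C2_tr_linear C2_tr1
  C2_tr_ge0 C2_tr_faithful C2_tr_trace C2_tr_normal.

End TwoPoints.

Section M2.
Variables (R : realType) (B : fvnalg R).
Local Notation C := R[i].
Local Notation H := (vn_space B).
Local Notation K := (hdouble H).
Local Notation tr := (@vn_tr R B).
Implicit Types x y : bop K.

Definition M2_set : set (bop K) := [set T | forall i j, vn_set B (bentry i j T)].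

Fact M2_star x : M2_set x -> M2_set (bstar x).
Proof. by move=> xM i j; rewrite bentry_star; exact/vn_star. Qed.

Fact M2_bicommutant : commutant (commutant M2_set) = M2_set.
Proof.
apply/seteqP; split=> [x xC i j|]; last exact: sub_bicommutant.
rewrite -(vn_bicommutant B) => X XB.
have dX : commutant M2_set (bdouble X).
  move=> s sM; apply: bentry_eq => k l; rewrite !bentryM !bentry_double.
  by case: k; case: l; rewrite /= ?mul0r ?mulr0 ?addr0 ?add0r; apply: XB.
have := congr1 (bentry i j) (xC _ dX); rewrite !bentryM !bentry_double.
by case: i; case: j; rewrite /= ?mul0r ?mulr0 ?addr0 ?add0r.
Qed.

Definition M2_vn : vnalg R := VNAlg M2_star M2_bicommutant.

Definition M2_tr x : C :=
  2^-1 * (tr (bentry false false x) + tr (bentry true true x)).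

Fact M2_tr_linear a x y : M2_set x -> M2_set y ->
  M2_tr (a *: x + y) = a * M2_tr x + M2_tr y.
Proof.
move=> xM yM; rewrite /M2_tr !bentryP !vn_tr_linear//.
by rewrite addrACA -(mulrDr a) [LHS]mulrDr mulrCA.
Qed.

Fact M2_tr1 : M2_tr 1 = 1.
Proof. by rewrite /M2_tr !bentry1 !vn_tr1 mulVf// pnatr_eq0. Qed.

Lemma vn_trD (x y : bop H) : vn_set B x -> vn_set B y -> tr (x + y) = tr x + tr y.
Proof. by move=> xB yB; rewrite -[x]scale1r vn_tr_linear// scale1r mul1r. Qed.

Lemma M2_trM x y : M2_set x -> M2_set y -> M2_tr (x * y) =
  2^-1 * (tr (bentry false false x * bentry false false y) +
          tr (bentry false true x * bentry true false y) +
         (tr (bentry true false x * bentry false true y) +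
          tr (bentry true true x * bentry true true y))).
Proof.
move=> xM yM; rewrite /M2_tr !bentryM !vn_trD//; exact: vn_mul.
Qed.

Lemma M2_tr_star x : M2_set x -> M2_tr (bstar x * x) =
  2^-1 * (tr (bstar (bentry false false x) * bentry false false x) +
          tr (bstar (bentry true false x) * bentry true false x) +
         (tr (bstar (bentry false true x) * bentry false true x) +
          tr (bstar (bentry true true x) * bentry true true x))).
Proof. by move=> xM; rewrite M2_trM ?bentry_star//; exact: M2_star. Qed.

Fact M2_tr_ge0 x : M2_set x -> 0 <= M2_tr (bstar x * x).
Proof.
move=> xM; rewrite M2_tr_star// mulr_ge0 ?invr_ge0 ?ler0n//.
by rewrite !addr_ge0// vn_tr_ge0.
Qed.

Fact M2_tr_faithful x : M2_set x -> M2_tr (bstar x * x) = 0 -> x = 0.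
Proof.
move=> xM; rewrite M2_tr_star// => /eqP.
rewrite mulf_eq0 invr_eq0 pnatr_eq0 /= paddr_eq0; last 2 first.
- by rewrite addr_ge0// vn_tr_ge0.
- by rewrite addr_ge0// vn_tr_ge0.
rewrite !paddr_eq0 ?vn_tr_ge0// => /andP[/andP[/eqP h00 /eqP h10] /andP[/eqP h01 /eqP h11]].
have z i j : bentry i j x = 0.
  by case: i; case: j; apply: vn_tr_faithful (xM _ _) _.
by apply: bentry_eq => i j; rewrite z; apply: bop_eq => v; case: i.
Qed.

Fact M2_tr_trace x y : M2_set x -> M2_set y -> M2_tr (x * y) = M2_tr (y * x).
Proof.
move=> xM yM; rewrite !M2_trM//; congr (_ * _).
rewrite (vn_tr_trace (xM false false) (yM false false)).
rewrite (vn_tr_trace (xM false true) (yM true false)).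
rewrite (vn_tr_trace (xM true false) (yM false true)).
rewrite (vn_tr_trace (xM true true) (yM true true)).
by rewrite addrACA.
Qed.

Lemma normal_bentry i : normal_on M2_set (fun x => tr (bentry i i x)).
Proof.
have [xi [eta [h1 h2 h3]]] := @vn_tr_normal R B.
exists (fun n => dinj i (xi n)), (fun n => dinj i (eta n)); split.
- by under eq_esum do rewrite hnorm_dinj.
- by under eq_esum do rewrite hnorm_dinj.
move=> x xM; rewrite h3//; congr csum; apply/funext => n.
by rewrite -hdot_dproj.
Qed.

Fact M2_tr_normal : normal_on M2_set M2_tr.
Proof. by apply/normalZ/normalD; exact: normal_bentry. Qed.

(* The 2 x 2 matrices with entries in B, acting on the direct sum of two copies
   of the Hilbert space of B. *)
Definition M2 : fvnalg R := @FVNAlg R M2_vn M2_tr M2_tr_linear M2_tr1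
  M2_tr_ge0 M2_tr_faithful M2_tr_trace M2_tr_normal.

End M2.

(* Isomorphism of von Neumann algebras (not required to preserve any trace):
   a bijective *-homomorphism, which is automatically unital and normal. *)
Definition vn_isomorphic (R : realType) (M N : vnalg R) : Prop :=
  exists phi : bop (vn_space M) -> bop (vn_space N),
    [/\ set_bij (vn_set M) (vn_set N) phi,
        forall a x y, vn_set M x -> vn_set M y ->
          phi (a *: x + y) = a *: phi x + phi y,
        forall x y, vn_set M x -> vn_set M y -> phi (x * y) = phi x * phi y &
        forall x, vn_set M x -> phi (bstar x) = bstar (phi x)].

(* Trace-preserving unital *-homomorphism; it is automatically injective and
   normal. *)
Definition trace_embedding (R : realType) (A M : fvnalg R)
    (phi : bop (vn_space A) -> bop (vn_space M)) : Prop :=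
  [/\ forall x, vn_set A x -> vn_set M (phi x),
      phi 1 = 1,
      forall a x y, vn_set A x -> vn_set A y ->
        phi (a *: x + y) = a *: phi x + phi y,
      forall x y, vn_set A x -> vn_set A y -> phi (x * y) = phi x * phi y &
      (forall x, vn_set A x -> phi (bstar x) = bstar (phi x)) /\
      (forall x, vn_set A x -> vn_tr (phi x) = vn_tr x)].

(* Freeness of two sets of operators S false and S true with respect to tau:
   tau vanishes on nonempty products of tau-centered elements taken alternately
   from the two sets. *)
Definition free_sets (R : realType) (H : hilbert R) (tau : bop H -> R[i])
    (S : bool -> set (bop H)) : Prop :=
  forall (b : bool) (s : seq (bop H)), s != [::] ->
    (forall k, (k < size s)%N -> S (b (+) odd k) s`_k /\ tau s`_k = 0) ->
    tau (\prod_(x <- s) x) = 0.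

(* M, together with the embeddings phi1 and phi2, is the free product of the
   finite von Neumann algebras A1 and A2. These conditions determine the triple
   (M, phi1, phi2) up to a trace-preserving isomorphism. *)
Definition is_free_product (R : realType) (A1 A2 M : fvnalg R)
    (phi1 : bop (vn_space A1) -> bop (vn_space M))
    (phi2 : bop (vn_space A2) -> bop (vn_space M)) : Prop :=
  let B1 := phi1 @` vn_set A1 in
  let B2 := phi2 @` vn_set A2 in
  [/\ trace_embedding phi1, trace_embedding phi2,
      free_sets (@vn_tr R M) (fun b => if b then B2 else B1) &
      commutant (commutant (B1 `|` B2)) = vn_set M].

Arguments is_free_product {R} A1 A2 M phi1 phi2.

(* Main.v *)
(* In M_2(L Z) let T be the generating unitary of L Z. Its square root r with
   Fourier coefficients i c / (2 n - 1) lies in L Z (it is -e^{i t / 2} for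
   0 < t < 2 pi), and u = [[0, 1], [1, 0]], v = [[0, r^*], [r, 0]] are
   symmetries with u v = diag(r, r^* ). Since the coefficients of r are purely
   imaginary, all nontrivial alternating words in u and v have trace 0, so u
   and v are free; they generate M_2(L Z) because an operator that intertwines
   r and r^* becomes, after composition with the flip n |-> -n of l^2(Z), an
   element of the commutant of T, while the flip conjugates r to -r^*.

   Conversely, every free product of two copies of C^2 is generated by two such
   symmetries, and the moments of words in them are determined. Two finite von
   Neumann algebras A, B with generators of equal moments are isomorphic: let N
   be the von Neumann algebra generated by the direct sums a_j (+) b_j. The
   compression N -> A is injective because the traces are controlled by vectors
   of an amplification, in which polynomials in the generators approximate the
   elements of N. It is surjective because, N -> A being injective, the
   translates of the space of A under the commutant N' are total, which allows
   one to extend any x in A to an operator commuting with N'. *)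
From Pilot Require Import Defs.
From HB Require Import structures.
From mathcomp Require Import all_boot all_order all_algebra.
From mathcomp Require Import all_classical all_reals all_analysis.
From mathcomp Require Import complex sesquilinear ring lra zify.
(* [hnormD] is now the triangle inequality rather than the lemma of sesquilinear. *)
Import Pilot.Defs.
Set Implicit Arguments.
Unset Strict Implicit.
Unset Printing Implicit Defensive.
Import Order.TTheory GRing.Theory Num.Theory numFieldNormedType.Exports.
Local Open Scope classical_set_scope.
Local Open Scope ring_scope.

(** * Projections and extension of operators in a Hilbert space *)

(** The algebras act on arbitrary Hilbert spaces, so the trace need not be a vector state and equal
    moments give no unitary between the given spaces. Normality bridges the gap: it bounds the trace
    norm by one vector of a countable amplification, where approximation by polynomials is a
    projection argument that asks for no control of their operator norms. A second constraint is
    that an operator carries its adjoint as data; hence every operator obtained by extension is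
    prescribed together with a candidate adjoint. The square root r arises in this way, without
    integrals or functional calculus: unitarity of r amounts to orthogonality of the shifts of the
    sequence 1/(2k-1), which follows from partial fractions and telescoping. The constant c, in fact
    2/pi, appears as the inverse norm of that sequence, so its value is never computed. The matrix
    model also settles the existence of the free product. *)

Section HilbertBasics.
Variables (R : realType) (H : hilbert R).
Local Notation C := R[i].
Implicit Types (x y z : H) (D : set H).

Lemma hnorm0 : hnorm (0 : H) = 0.
Proof. by rewrite /hnorm /dnorm hdot0l /= sqrtr0. Qed.

Lemma hnorm_eq0 x : hnorm x = 0 -> x = 0.
Proof. by move=> x0; apply: hdot_eq0; rewrite -hnormE x0 expr0n. Qed.

Lemma hnormN x : hnorm (- x) = hnorm x.
Proof. by rewrite /hnorm /dnorm hdotNl hdotNr opprK. Qed.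

Lemma hnormB x y : hnorm (x - y) = hnorm (y - x).
Proof. by rewrite -hnormN opprB. Qed.

Lemma ler_dist_hnorm x y : `|hnorm x - hnorm y| <= hnorm (x - y).
Proof.
have h (a b : H) : hnorm a - hnorm b <= hnorm (a - b).
  by rewrite lerBlDr -{1}(subrK b a) hnormD.
by rewrite ler_norml h andbT lerNl opprB hnormB.
Qed.

Lemma hdot_cauchy_schwarz x y : cabs (hdot H x y) <= hnorm x * hnorm y.
Proof.
set z := hdot H x y; have [->|zN] := eqVneq z 0.
  by rewrite cabs0 mulr_ge0 ?hnorm_ge0.
pose w : C := `|z| / z.
have w1 : cabs w = 1.
  by rewrite /cabs normrM normrV ?unitfE// normr_id divff// normr_eq0.
have wz : hdot H (w *: x) y = `|z| by rewrite hdotZl -mulrA mulVf ?mulr1.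
by have := CauchySchwarz_Re (w *: x) y; rewrite wz -/(cabs z) hnormZ w1 mul1r.
Qed.

Lemma le0_small (r K : R) : (forall e : R, 0 < e -> r <= e * K) -> r <= 0.
Proof.
move=> h; apply/ler_addgt0Pl => e e0; rewrite addr0.
have K1 : 0 < `|K| + 1 by rewrite ltr_wpDl.
apply: (le_trans (h (e / (`|K| + 1)) _)); first by rewrite divr_gt0.
rewrite -mulrA ger_pMr// mulrC ler_pdivrMr// mul1r.
by rewrite (le_trans (ler_norm K))// lerDl.
Qed.

Lemma hnormB_sqr x y :
  hnorm (x - y) ^+ 2 = hnorm x ^+ 2 + hnorm y ^+ 2 - 2 * complex.Re (hdot H x y).
Proof.
rewrite !hnorm_sqr !(hdotDl, hdotDr, hdotNl, hdotNr) opprK (hdotC y x).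
by case: (hdot H x y) (hdot H x x) (hdot H y y) => [a b] [c d] [f g] /=; ring.
Qed.

Lemma hnormD_sqr x y :
  hnorm (x + y) ^+ 2 = hnorm x ^+ 2 + hnorm y ^+ 2 + 2 * complex.Re (hdot H x y).
Proof.
rewrite -{1}[y]opprK hnormB_sqr hnormN hdotNr.
by case: (hdot H x y) => a b /=; ring.
Qed.

Lemma parallelogram x y :
  hnorm (x + y) ^+ 2 + hnorm (x - y) ^+ 2 = 2 * (hnorm x ^+ 2 + hnorm y ^+ 2).
Proof. by rewrite hnormD_sqr hnormB_sqr; ring. Qed.

Lemma hdot_suml (I : Type) (r : seq I) (F : I -> H) (v : H) :
  hdot H (\sum_(i <- r) F i) v = \sum_(i <- r) hdot H (F i) v.
Proof. by elim/big_rec2: _ => [|i x y _ <-]; rewrite ?hdot0l ?hdotDl. Qed.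

Lemma hdot_sumr (I : Type) (r : seq I) (F : I -> H) (v : H) :
  hdot H v (\sum_(i <- r) F i) = \sum_(i <- r) hdot H v (F i).
Proof. by elim/big_rec2: _ => [|i x y _ <-]; rewrite ?hdot0r ?hdotDr. Qed.

Definition subspace D := D 0 /\ forall a x y, D x -> D y -> D (a *: x + y).

Definition adherent D x := forall e : R, 0 < e -> exists2 d, D d & hnorm (x - d) < e.

Lemma adherentP D a x y : subspace D -> adherent D x -> adherent D y ->
  adherent D (a *: x + y).
Proof.
move=> [_ Dl] Dx Dy e e0.
have a1 : 0 < 2 * (cabs a + 1) by rewrite mulr_gt0 ?ltr_wpDl ?cabs_ge0.
have [d Dd xd] := Dx (e / (2 * (cabs a + 1))) (divr_gt0 e0 a1).
have [d' Dd' yd] := Dy (e / 2) (divr_gt0 e0 (ltr0Sn _ _)).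
exists (a *: d + d'); first exact: Dl.
rewrite opprD addrACA -scalerBr; apply: le_lt_trans (hnormD _ _) _.
rewrite [e]splitr; apply: ler_ltD => //; rewrite hnormZ.
apply: le_trans (_ : (cabs a + 1) * hnorm (x - d) <= _).
  by rewrite ler_wpM2r ?hnorm_ge0// lerDl.
move/ltW: xd; rewrite ler_pdivlMr// => h.
rewrite ler_pdivlMr//; lra.
Qed.

Lemma adherent_orth D x y : (forall d, D d -> hdot H x d = 0) ->
  adherent D y -> hdot H x y = 0.
Proof.
move=> xD Dy; apply: cabs_eq0; apply/eqP; rewrite eq_le cabs_ge0 andbT.
apply: (@le0_small _ (hnorm x)) => e e0.
have [d Dd yd] := Dy e e0.
have -> : hdot H x y = hdot H x (y - d) by rewrite hdotDr hdotNr (xD d)// subr0.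
apply: le_trans (hdot_cauchy_schwarz _ _) _.
by rewrite mulrC ler_wpM2r ?hnorm_ge0// ltW.
Qed.

Lemma hcauchy_cvg (u : nat -> H) (v : nat -> R) : v @ \oo --> (0 : R) ->
  (forall m n, hnorm (u m - u n) <= v m + v n) ->
  exists l, (fun n => hnorm (u n - l)) @ \oo --> (0 : R).
Proof.
move=> v0 uv; apply: hcomplete => e e0.
move/cvgrPdist_lt: v0 => /(_ (e / 2) (divr_gt0 e0 (ltr0Sn _ _))) [N _ vN].
exists N => m n Nm Nn; apply: le_lt_trans (uv m n) _.
have := vN _ Nm; have := vN _ Nn; rewrite /= !sub0r !normrN.
move=> /(le_lt_trans (ler_norm _)) h1 /(le_lt_trans (ler_norm _)) h2; lra.
Qed.

(** [D] need not be closed, so the nearest point is sought in its closure, as the limit of a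
    minimising sequence. *)
Lemma orth_proj_exists D x : subspace D ->
  exists l, adherent D l /\ forall d, D d -> hdot H (x - l) d = 0.
Proof.
move=> [D0 Dl].
pose A : set R := [set hnorm (x - d) ^+ 2 | d in D].
have A0 : A !=set0 by exists (hnorm (x - 0) ^+ 2), 0.
have Alb : lbound A 0 by move=> _ [d _ <-]; exact: sqr_ge0.
have hA : has_inf A by split=> //; exists 0.
pose m := inf A.
have mle d : D d -> m <= hnorm (x - d) ^+ 2.
  by move=> Dd; apply: ge_inf; [exists 0|exists d].
(* The slack is a square because the parallelogram law bounds the squared distance of [u p] and
   [u n] by twice the sum of the two slacks; the distance is then at most 2/(p+1) + 2/(n+1). *)
have /boolp.choice[u uP] : forall n : nat, exists d, D d /\
    hnorm (x - d) ^+ 2 < m + n.+1%:R^-1 ^+ 2.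
  move=> n; have e0 : 0 < n.+1%:R^-1 ^+ 2 :> R by rewrite exprn_gt0 ?invr_gt0.
  have [_ [d Dd <-] hd] := inf_adherent e0 hA.
  by exists d.
have [l ll] : exists l, (fun n => hnorm (u n - l)) @ \oo --> (0 : R).
  apply: (@hcauchy_cvg u (fun n => 2 * n.+1%:R^-1)).
    rewrite -[0](mulr0 2); apply: cvgM; first exact: cvg_cst.
    exact: cvg_harmonic.
  move=> p n; have [Dp up] := uP p; have [Dn un] := uP n.
  have := parallelogram (x - u p) (x - u n).
  have -> : x - u p + (x - u n) = 2 *: (x - (2^-1 *: u p + 2^-1 *: u n)).
    rewrite scalerBr scalerDr !scalerA mulfV ?pnatr_eq0// !scale1r.
    by rewrite scaler_nat mulr2n opprD addrACA.
  have -> : x - u p - (x - u n) = u n - u p.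
    by rewrite opprB addrC addrA subrK.
  rewrite hnormZ (hnormB (u n)) exprMn.
  have -> : cabs (2 : C) = 2.
    by rewrite /cabs ger0_norm ?ler0n//.
  have : m <= hnorm (x - (2^-1 *: u p + 2^-1 *: u n)) ^+ 2.
    apply: mle; apply: (Dl) => //; rewrite -[_ *: _]addr0; exact: Dl.
  move=> h1 h2.
  rewrite -(@ler_pXn2r _ 2)// ?nnegrE ?hnorm_ge0 ?addr_ge0 ?mulr_ge0 ?invr_ge0//.
  have : 0 <= (p.+1%:R^-1 : R) by rewrite invr_ge0.
  have : 0 <= (n.+1%:R^-1 : R) by rewrite invr_ge0.
  move: up un h1 h2; set a := p.+1%:R^-1; set b := n.+1%:R^-1.
  set c := hnorm _ ^+ 2; set d := hnorm _ ^+ 2; set f := hnorm _ ^+ 2.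
  set g := hnorm _ ^+ 2 => up un h1 h2 a0 b0.
  have := mulr_ge0 a0 b0; have := sqr_ge0 a; have := sqr_ge0 b; lra.
have Dadh : adherent D l.
  move=> e e0; move/cvgrPdist_lt: ll => /(_ e e0) [N _ /(_ N (leqnn N))].
  rewrite /= sub0r normrN ger0_norm ?hnorm_ge0// hnormB => h.
  by exists (u N) => //; have [] := uP N.
exists l; split=> // d Dd.
(* Comparing [u n] with its perturbation by [c / q] times [d], where [c] is the inner product of
   [x - u n] with [d], bounds [c]. The summand 1 keeps [q] positive even for [d = 0] and at least
   1. *)
pose q : R := hnorm d ^+ 2 + 1.
have q0 : 0 < q by rewrite ltr_wpDl ?sqr_ge0.
have q1 : 0 <= q - 1 by rewrite addrK sqr_ge0.
have small n : cabs (hdot H (x - u n) d) <= n.+1%:R^-1 * q.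
  have [Dn un] := uP n; set c := hdot H (x - u n) d.
  have := mle _ (Dl (q^-1%:C%C * c) d (u n) Dd Dn).
  rewrite [_ *: _ + _]addrC opprD addrA hnormB_sqr hdotZr -/c.
  have -> : complex.Re (Num.conj ((q^-1)%:C%C * c) * c) = q^-1 * cabs c ^+ 2.
    by rewrite cabs_sqr; case: (c) => a b /=; ring.
  rewrite hnormZ cabsM (_ : cabs _ = q^-1); last first.
    by rewrite /cabs ger0_norm// lecR invr_ge0 ltW.
  move: un; rewrite exprMn (_ : hnorm d ^+ 2 = q - 1); last by rewrite /q addrK.
  set w := cabs c; set v := hnorm _ ^+ 2; set r := _^-1; move=> un h.
  have w0 : 0 <= w by exact: cabs_ge0.
  have r0 : 0 < r by rewrite invr_gt0.
  have h1 : q^-1 * w ^+ 2 <= r ^+ 2.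
    have e : (q^-1 * w) ^+ 2 * (q - 1) = q^-1 * w ^+ 2 - (q^-1 * w) ^+ 2.
      by rewrite exprMn; field; rewrite gt_eqF.
    have := sqr_ge0 (q^-1 * w); move: h; rewrite e; lra.
  rewrite -(@ler_pXn2r _ 2)// ?nnegrE ?mulr_ge0 ?(ltW r0) ?(ltW q0)//.
  move: h1; rewrite mulrC ler_pdivrMr// => /le_trans; apply.
  rewrite exprMn ler_wpM2l ?sqr_ge0//; nra.
apply: cabs_eq0; apply/eqP; rewrite eq_le cabs_ge0 andbT.
apply: (@le0_small _ (q + hnorm d)) => e e0.
move/cvgrPdist_lt: ll => /(_ e e0) [N1 _ NP].
have [N2 _ NP2] := near_infty_natSinv_lt (PosNum e0).
pose n := maxn N1 N2.
have := NP n (leq_maxl _ _); have := NP2 n (leq_maxr _ _).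
rewrite /= sub0r normrN ger0_norm ?hnorm_ge0// => h2 h1.
have -> : x - l = (x - u n) + (u n - l) by rewrite addrA subrK.
rewrite hdotDl mulrDr; apply: le_trans (cabsD _ _) _; apply: lerD.
  by apply: le_trans (small n) _; rewrite ler_wpM2r ?ltW.
by apply: le_trans (hdot_cauchy_schwarz _ _) _; rewrite ler_wpM2r ?hnorm_ge0 ?ltW.
Qed.

Lemma orth_proj_uniq D x l l' : subspace D -> adherent D l -> adherent D l' ->
  (forall d, D d -> hdot H (x - l) d = 0) ->
  (forall d, D d -> hdot H (x - l') d = 0) -> l = l'.
Proof.
move=> sD Dl Dl' xl xl'; apply/subr0_eq/hdot_eq0.
have Dll : adherent D (l - l') by rewrite addrC -scaleN1r; exact: adherentP.
have {1}-> : l - l' = (x - l') - (x - l) by rewrite opprB addrCA addrAC subrr add0r.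
by rewrite hdotDl hdotNl !(adherent_orth _ Dll)// subr0.
Qed.

Lemma orth_projection D : subspace D -> exists Q : bop H,
  [/\ forall x, adherent D (Q x), forall x d, D d -> hdot H (x - Q x) d = 0 &
      forall d, D d -> Q d = d].
Proof.
move=> sD; have [D0 Dl] := sD.
have /boolp.choice[Q QP] := fun x => orth_proj_exists x sD.
have uniq x l : adherent D l -> (forall d, D d -> hdot H (x - l) d = 0) -> Q x = l.
  by move=> Dl' xl; have [QD Qx] := QP x; exact: (orth_proj_uniq sD QD Dl' Qx).
have QQ x y : hdot H (x - Q x) (Q y) = 0.
  by apply: adherent_orth (QP y).1; exact: (QP x).2.
have Qlin : linear Q.
  move=> a x y; apply: uniq => [|d Dd]; first exact: adherentP (QP x).1 (QP y).1.
  by rewrite opprD addrACA -scalerBr hdotDl hdotZl !(QP _).2// mulr0 addr0.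
have Qadj x y : hdot H (Q x) y = hdot H x (Q y).
  have h (a b : H) : hdot H a (Q b) = hdot H (Q a) (Q b).
    by apply/subr0_eq; rewrite -hdotNl -hdotDl QQ.
  by rewrite hdotC h -hdotC -h.
have Qbd : exists K : R, forall x, hnorm (Q x) <= K * hnorm x.
  exists 1 => x; rewrite mul1r -(@ler_pXn2r _ 2)// ?nnegrE ?hnorm_ge0//.
  rewrite -[in leRHS](subrK (Q x) x) hnormD_sqr QQ /= mulr0 addr0.
  by rewrite lerDr sqr_ge0.
exists (Bop Qlin Qbd Qadj); split=> [x|x d|d Dd]; [exact: (QP x).1|exact: (QP x).2|].
apply: uniq => [e e0|d' _]; first by exists d; rewrite ?subrr ?hnorm0.
by rewrite subrr hdot0l.
Qed.

Lemma adherent_dense D : subspace D ->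
  (forall y, (forall d, D d -> hdot H y d = 0) -> y = 0) -> forall x, adherent D x.
Proof.
move=> sD Dy x; have [Q [QD Qx _]] := orth_projection sD.
by rewrite -(subrK (Q x) x) (Dy (x - Q x)) ?add0r//; exact: Qx.
Qed.

(** [T (Q x)] has the two properties that characterise [Q (T x)]: boundedness of [T] keeps it in the
    closure of [D], and invariance under the adjoint gives orthogonality of the difference. *)
Lemma projection_commute D (Q T : bop H) : subspace D ->
  (forall x, adherent D (Q x)) -> (forall x d, D d -> hdot H (x - Q x) d = 0) ->
  (forall d, D d -> D (T d)) -> (forall d, D d -> D (bstar T d)) -> T * Q = Q * T.
Proof.
move=> sD QD Qx TD TsD; apply: bop_eq => x; rewrite !bopM.
apply: (orth_proj_uniq sD _ (QD _) _ (Qx (T x))) => [e e0|d Dd].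
  have [K TK] := bfun_bounded T.
  have K1 : 0 < `|K| + 1 by rewrite ltr_wpDl.
  have [d Dd xd] := QD x (e / (`|K| + 1)) (divr_gt0 e0 K1).
  exists (T d); first exact: TD.
  rewrite -linearB; apply: le_lt_trans (TK _) _.
  move: xd; rewrite ltr_pdivlMr// mulrC; apply: le_lt_trans.
  by rewrite ler_wpM2r ?hnorm_ge0// (le_trans (ler_norm K))// lerDl.
by rewrite -linearB bstarP Qx//; exact: TsD.
Qed.

End HilbertBasics.

(** * Bounded extension of densely defined linear relations *)

Section Extension.
Variables (R : realType) (H : hilbert R).
Local Notation C := R[i].
Local Notation HH := (hdouble H).
Implicit Types (x y u v : H) (F : H -> H -> Prop).

Definition graph F : set HH := [set p | F p.1 p.2].

Lemma hdot_double (p q : HH) : hdot HH p q = hdot H p.1 q.1 + hdot H p.2 q.2.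
Proof. by []. Qed.

(** Relations instead of functions: the data will be given on formal sums, and a vector may have
    several representations. That the value is unique comes out of the norm bound. *)
Definition linear_rel F :=
  F 0 0 /\ forall a u v u' v', F u v -> F u' v' -> F (a *: u + u') (a *: v + v').

Lemma subspace_graph F : linear_rel F -> subspace (graph F).
Proof. by move=> [F0 Fl]; split=> [|a [u v] [u' v']] //; exact: Fl. Qed.

Lemma adherent_graph_bound F (K : R) x y :
  (forall u v, F u v -> hnorm v <= K * hnorm u) ->
  adherent (graph F) ((x, y) : HH) -> hnorm y <= `|K| * hnorm x.
Proof.
move=> FK Fxy; rewrite -subr_le0; apply: (@le0_small _ _ (1 + `|K|)) => e e0.
have [[u v] Fuv xyuv] := Fxy e e0.
have h1 : hnorm (x - u) < e by exact: le_lt_trans (double_dnorm_ge1 ((x - u, y - v))) xyuv.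
have h2 : hnorm (y - v) < e by exact: le_lt_trans (double_dnorm_ge2 ((x - u, y - v))) xyuv.
have h3 : hnorm y <= hnorm (y - v) + hnorm v by rewrite -{1}(subrK v y) hnormD.
have h4 : hnorm u <= hnorm (x - u) + hnorm x by rewrite hnormB -{1}(subrK x u) hnormD.
have h5 : hnorm v <= `|K| * hnorm u.
  by apply: le_trans (FK _ _ Fuv) _; rewrite ler_wpM2r ?hnorm_ge0 ?ler_norm.
have := normr_ge0 K; nra.
Qed.

Lemma adherent_graph_total F (K : R) x :
  linear_rel F -> adherent [set u | exists v, F u v] x ->
  (forall u v, F u v -> hnorm v <= K * hnorm u) ->
  exists y, adherent (graph F) ((x, y) : HH).
Proof.
move=> [F0 Fl] Fx FK.
have /boolp.choice[w wP] : forall n : nat, exists p : H * H,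
    F p.1 p.2 /\ hnorm (x - p.1) < n.+1%:R^-1.
  move=> n; have e0 : 0 < n.+1%:R^-1 :> R by rewrite invr_gt0.
  by have [u [v Fuv] xu] := Fx _ e0; exists (u, v).
have [y yP] : exists y, (fun n => hnorm ((w n).2 - y)) @ \oo --> (0 : R).
  apply: (@hcauchy_cvg _ _ _ (fun n => `|K| * n.+1%:R^-1)).
    by rewrite -[0](mulr0 `|K|); apply: cvgM; [exact: cvg_cst|exact: cvg_harmonic].
  move=> m n; have [Fm xm] := wP m; have [Fn xn] := wP n.
  have := Fl (-1) _ _ _ _ Fn Fm; rewrite !scaleN1r ![- _ + _]addrC => /FK.
  move=> /le_trans; apply; apply: le_trans (_ : `|K| * hnorm ((w m).1 - (w n).1) <= _).
    by rewrite ler_wpM2r ?hnorm_ge0 ?ler_norm.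
  rewrite -mulrDr ler_wpM2l//.
  have -> : (w m).1 - (w n).1 = (x - (w n).1) - (x - (w m).1).
    by rewrite opprB [RHS]addrC addrA subrK.
  by apply: le_trans (hnormD _ _) _; rewrite hnormN addrC ltW// ltrD.
exists y => e e0; have e2 : 0 < e / 2 by rewrite divr_gt0.
move/cvgrPdist_lt: yP => /(_ _ e2) [N1 _ P1].
have [N2 _ P2] := near_infty_natSinv_lt (PosNum e2).
set n := maxn N1 N2; have := P1 n (leq_maxl _ _); have := P2 n (leq_maxr _ _).
rewrite /= sub0r normrN ger0_norm ?hnorm_ge0// hnormB => h2 h1.
exists (((w n).1, (w n).2) : HH); first exact: (wP n).1.
apply: le_lt_trans (double_dnorm_le ((x - (w n).1, y - (w n).2))) _ => /=.
rewrite [e]splitr; apply: ltrD => //; exact: lt_trans (wP n).2 _.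
Qed.

(** The adjunction identity says that [(v, - u)] is orthogonal to the graph of [F']. Orthogonality
    passes to the closure, and the argument is repeated with the roles exchanged. *)
Lemma adherent_graph_adj F F' x y x' y' :
  (forall u v u' v', F u v -> F' u' v' -> hdot H v u' = hdot H u v') ->
  adherent (graph F) ((x, y) : HH) -> adherent (graph F') ((x', y') : HH) ->
  hdot H y x' = hdot H x y'.
Proof.
move=> FF' Fxy Fxy'.
have h u v : F u v -> hdot H v x' = hdot H u y'.
  move=> Fuv; apply/subr0_eq; rewrite -hdotNl.
  apply: (@adherent_orth _ HH _ ((v, - u) : HH)) Fxy' => -[u' v'] Fuv'.
  by rewrite hdot_double /= hdotNl (FF' _ _ _ _ Fuv Fuv') subrr.
apply/esym/subr0_eq; rewrite hdotC (hdotC y) -rmorphB -hdotNl /=.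
rewrite (_ : _ + _ = 0) ?rmorph0//.
apply: (@adherent_orth _ HH _ ((y', - x') : HH)) Fxy => -[u v] Fuv.
by rewrite hdot_double /= hdotNl hdotC (hdotC x') (h _ _ Fuv) subrr.
Qed.

(** The closure of each graph is the graph of an everywhere defined bounded function: the bound
    gives uniqueness, density and completeness give totality. [F'] supplies the adjoint stored in
    the resulting operator. *)
Lemma bop_extension F F' (K K' : R) : linear_rel F -> linear_rel F' ->
  (forall x, adherent [set u | exists v, F u v] x) ->
  (forall x, adherent [set u | exists v, F' u v] x) ->
  (forall u v, F u v -> hnorm v <= K * hnorm u) ->
  (forall u v, F' u v -> hnorm v <= K' * hnorm u) ->
  (forall u v u' v', F u v -> F' u' v' -> hdot H v u' = hdot H u v') ->
  exists T : bop H, forall u v, F u v -> T u = v.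
Proof.
move=> lF lF' dF dF' FK FK' FF'.
have /boolp.choice[T TP] := fun x => adherent_graph_total lF (dF x) FK.
have /boolp.choice[T' TP'] := fun x => adherent_graph_total lF' (dF' x) FK'.
have uniq x y y' : adherent (graph F) ((x, y) : HH) ->
    adherent (graph F) ((x, y') : HH) -> y = y'.
  move=> h h'; have := adherentP (-1) (subspace_graph lF) h' h.
  rewrite scaleN1r addrC -[_ - _]/((x - x, y - y') : HH) subrr.
  move/(adherent_graph_bound FK); rewrite hnorm0 mulr0 => h0.
  by apply/subr0_eq/hnorm_eq0/eqP; rewrite eq_le h0 hnorm_ge0.
have Tlin : linear T.
  move=> a x y; apply: (uniq (a *: x + y)); first exact: TP.
  exact: (adherentP a (subspace_graph lF) (TP x) (TP y)).
have Tbd : exists A : R, forall x, hnorm (T x) <= A * hnorm x.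
  by exists `|K| => x; exact: adherent_graph_bound (TP x).
have Tadj x y : hdot H (T x) y = hdot H x (T' y).
  exact: adherent_graph_adj FF' (TP x) (TP' y).
exists (Bop Tlin Tbd Tadj) => u v Fuv; apply: (uniq u) => [|e e0]; first exact: TP.
by exists ((u, v) : HH) => //; rewrite subrr hnorm0.
Qed.

End Extension.

(** * Hilbert sums and amplifications *)

Section HilbertSum.
Variables (R : realType) (T : choiceType) (E : T -> hilbert R).
Local Notation C := R[i].

Definition norm_summable (f : forall i, E i) : Prop :=
  abs_summable (fun i => hnorm (f i) ^+ 2).

Record hseq := HSeq { hseq_val :> forall i, E i; hseqP : norm_summable hseq_val }.

Implicit Types f g : hseq.

Lemma hseq_eq f g : (forall i, f i = g i) -> f = g.
Proof.
case: f g => [f fP] [g gP] /= fg.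
have {}fg : f = g by apply: functional_extensionality_dep.
by subst g; congr HSeq; exact: Prop_irrelevance.
Qed.

Lemma norm_summable_lin a f g : norm_summable (fun i => a *: f i + g i).
Proof.
apply: abs_summable_le (abs_summableD (abs_summableZ (2 * cabs a ^+ 2) (hseqP f))
  (abs_summableZ 2 (hseqP g))) => i.
rewrite ger0_norm ?sqr_ge0//.
apply: (@le_trans _ _ ((cabs a * hnorm (f i) + hnorm (g i)) ^+ 2)).
  rewrite ler_pXn2r ?nnegrE ?hnorm_ge0 ?addr_ge0 ?mulr_ge0 ?cabs_ge0 ?hnorm_ge0//.
  by rewrite -hnormZ hnormD.
have := sqr_ge0 (cabs a * hnorm (f i) - hnorm (g i)); lra.
Qed.

Lemma norm_summable0 : norm_summable (fun i => 0 : E i).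
Proof.
rewrite /norm_summable /abs_summable esum1 ?ltry// => i _.
by rewrite hnorm0 expr0n normr0.
Qed.

(** One summability proof for this combination serves addition, opposite and scaling alike. *)
Definition hseq_lin a f g := HSeq (norm_summable_lin a f g).
Definition hseq0 := HSeq norm_summable0.

HB.instance Definition _ := gen_eqMixin hseq.
HB.instance Definition _ := gen_choiceMixin hseq.

Local Notation hadd := (hseq_lin 1).

Fact haddA : associative hadd.
Proof. by move=> f g h; apply: hseq_eq => i; rewrite /= !scale1r addrA. Qed.
Fact haddC : commutative hadd.
Proof. by move=> f g; apply: hseq_eq => i; rewrite /= !scale1r addrC. Qed.
Fact hadd0 : left_id hseq0 hadd.
Proof. by move=> f; apply: hseq_eq => i; rewrite /= scale1r add0r. Qed.
Fact haddN : left_inverse hseq0 (fun f => hseq_lin (-1) f hseq0) hadd.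
Proof. by move=> f; apply: hseq_eq => i; rewrite /= scale1r scaleN1r addr0 addNr. Qed.

HB.instance Definition _ := GRing.isZmodule.Build hseq haddA haddC hadd0 haddN.

Definition hseq_scale a f := hseq_lin a f hseq0.

Lemma hseqD f g i : (f + g) i = f i + g i.
Proof. by rewrite -[LHS]/(1 *: f i + g i) scale1r. Qed.

Lemma hscaleE a f i : hseq_scale a f i = a *: f i.
Proof. by rewrite /= addr0. Qed.

Fact hscaleA a b f : hseq_scale a (hseq_scale b f) = hseq_scale (a * b) f.
Proof. by apply: hseq_eq => i; rewrite !hscaleE scalerA. Qed.
Fact hscale1 : left_id 1 hseq_scale.
Proof. by move=> f; apply: hseq_eq => i; rewrite hscaleE scale1r. Qed.
Fact hscaleDr : right_distributive hseq_scale +%R.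
Proof. by move=> a f g; apply: hseq_eq => i; rewrite !(hseqD, hscaleE) scalerDr. Qed.
Fact hscaleDl f : {morph hseq_scale^~ f : a b / a + b}.
Proof. by move=> a b; apply: hseq_eq => i; rewrite !(hseqD, hscaleE) scalerDl. Qed.

HB.instance Definition _ := GRing.Zmodule_isLmodule.Build C hseq
  hscaleA hscale1 hscaleDr hscaleDl.

Lemma hseqZ a f i : (a *: f) i = a *: f i.
Proof. by rewrite -[LHS]/(a *: f i + 0) addr0. Qed.

Lemma hseqN f i : (- f) i = - f i.
Proof. by rewrite -[LHS]/(-1 *: f i + 0) addr0 scaleN1r. Qed.

Definition hseq_dot f g : C := csum (fun i => hdot (E i) (f i) (g i)).

Lemma hseq_dot_summable f g : csummable (fun i => hdot (E i) (f i) (g i)).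
Proof.
by apply: csummable_le (abs_summableD (hseqP f) (hseqP g)) => i; exact: hdot_cabs_le.
Qed.

Fact hseq_dotC f g : hseq_dot f g = (-1) ^+ false * Num.conj (hseq_dot g f).
Proof.
rewrite expr0 mul1r /hseq_dot -csumJ; congr csum; apply/funext => i.
exact: hdotC.
Qed.

Fact hseq_dotl g : linear_for *%R (hseq_dot^~ g).
Proof.
move=> a f f'; have s1 := hseq_dot_summable f g; have s2 := hseq_dot_summable f' g.
rewrite /hseq_dot -(csumZ a s1) -(csumD (csummableZ a s1) s2).
by congr csum; apply/funext => i; rewrite hseqD hseqZ hdotDl hdotZl.
Qed.

Fact hseq_dotr f : linear_for (Num.conj \; *%R) (hseq_dot f).
Proof.
move=> a g g'; rewrite hseq_dotC hseq_dotl expr0 mul1r rmorphD rmorphM /=.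
by rewrite [hseq_dot f g]hseq_dotC [hseq_dot f g']hseq_dotC !expr0 !mul1r.
Qed.

Lemma hseq_dotE f : hseq_dot f f = (rsum (fun i => hnorm (f i) ^+ 2))%:C%C.
Proof.
by rewrite /hseq_dot -csum_real; congr csum; apply/funext => i; rewrite hnormE.
Qed.

Lemma hseq_fsum_le f (A : set T) : finite_set A ->
  \sum_(i \in A) hnorm (f i) ^+ 2 <= rsum (fun i => hnorm (f i) ^+ 2).
Proof.
move=> fA; rewrite rsum_ge0; last by move=> i; rewrite sqr_ge0.
rewrite -lee_fin fineK; last by apply: esum_fin (hseqP f) => i; rewrite sqr_ge0.
by rewrite -fsumEFin//; apply: ereal_sup_ubound; exists A => //; split.
Qed.

Lemma hseq_coef_sqr_le f i : hnorm (f i) ^+ 2 <= rsum (fun i => hnorm (f i) ^+ 2).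
Proof.
by apply: le_trans (hseq_fsum_le f (finite_set1 i)); rewrite fsbig_set1.
Qed.

Fact hseq_dot_gt0 f : f != 0 -> 0 < hseq_dot f f.
Proof.
move=> fN; rewrite hseq_dotE ltcR.
have [j fj] : exists j, f j != 0.
  apply/not_existsP => h; move/eqP: fN; apply; apply: hseq_eq => i.
  by apply/eqP; apply/negPn/negP; exact: h.
apply: lt_le_trans (hseq_coef_sqr_le f j).
rewrite exprn_gt0// lt_def hnorm_ge0 andbT; apply: contra fj => /eqP.
by move/hnorm_eq0 => ->.
Qed.

HB.instance Definition _ := @bilinear_isBilinear.Build C hseq hseq C *%R
  (Num.conj \; *%R) hseq_dot (hseq_dotl, hseq_dotr).
HB.instance Definition _ := @isHermitianSesquilinear.Build C hseq false Num.conj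
  hseq_dot hseq_dotC.
HB.instance Definition _ := @isDotProduct.Build C hseq hseq_dot hseq_dot_gt0.

Lemma hseq_dnorm_sqr f : (dnorm hseq_dot f) ^+ 2 = rsum (fun i => hnorm (f i) ^+ 2).
Proof.
rewrite /dnorm sqr_sqrtr hseq_dotE//= rsum_ge0; last by move=> i; rewrite sqr_ge0.
by rewrite fine_ge0// esum_ge0// => i _; rewrite lee_fin sqr_ge0.
Qed.

Lemma hseq_coef_le f i : hnorm (f i) <= dnorm hseq_dot f.
Proof.
rewrite -(@ler_pXn2r _ 2)// ?nnegrE ?hnorm_ge0 ?sqrtr_ge0//.
by rewrite hseq_dnorm_sqr; exact: hseq_coef_sqr_le.
Qed.

Lemma norm_summable_fsum (F : forall i, E i) (K : R) :
  (forall A : set T, finite_set A -> \sum_(i \in A) hnorm (F i) ^+ 2 <= K) ->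
  norm_summable F /\ rsum (fun i => hnorm (F i) ^+ 2) <= K.
Proof.
move=> FK; have e i : hnorm (F i) = cabs ((hnorm (F i))%:C%C).
  by rewrite /cabs ger0_norm// lecR hnorm_ge0.
have [A fA|/asboolP p q] := @l2_of_fsum R T (fun i => (hnorm (F i))%:C%C) K.
  by rewrite (eq_fsbigr (fun i => hnorm (F i) ^+ 2)) => [|i _]; rewrite ?FK -?e.
split; last by move: q; under eq_fun do rewrite -e.
by move: p; rewrite square_summableE; under eq_fun do rewrite -e.
Qed.

Fact hseq_complete (u : nat -> hseq) :
  (forall e : R, 0 < e -> exists N : nat, forall m n : nat,
     (N <= m)%N -> (N <= n)%N -> dnorm hseq_dot (u m - u n) < e) ->
  exists l : hseq, (fun n => dnorm hseq_dot (u n - l)) @ \oo --> (0 : R).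
Proof.
move=> cu.
have lex : forall i, exists l : E i, (fun n => hnorm (u n i - l)) @ \oo --> (0 : R).
  move=> i; apply: hcomplete => e e0; have [N uN] := cu e e0.
  exists N => m n Nm Nn; apply: le_lt_trans (uN m n Nm Nn).
  by have := hseq_coef_le (u m - u n) i; rewrite hseqD hseqN.
pose l i := sval (cid (lex i)); pose lP i := svalP (cid (lex i)).
have key (e : R) : 0 < e -> exists N : nat, forall n, (N <= n)%N ->
    forall A : set T, finite_set A -> \sum_(i \in A) hnorm (u n i - l i) ^+ 2 <= e ^+ 2.
  move=> e0; have [N uN] := cu e e0; exists N => n Nn A fA.
  have cv : (fun m => \sum_(i \in A) hnorm (u n i - u m i) ^+ 2) @ \oo -->
      \sum_(i \in A) hnorm (u n i - l i) ^+ 2.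
    rewrite fsbig_finite//=; under eq_fun do rewrite fsbig_finite//=.
    apply: cvg_big => [|i _]; first exact: add_continuous.
    suff h : (fun m => hnorm (u n i - u m i)) @ \oo --> hnorm (u n i - l i).
      under eq_fun do rewrite expr2.
      by rewrite expr2; exact: cvgM.
    apply/cvgrPdist_le => d d0; move/cvgrPdist_le: (lP i) => /(_ d d0).
    apply: filterS => m; rewrite sub0r normrN ger0_norm ?hnorm_ge0// => h.
    apply: le_trans (ler_dist_hnorm _ _) _.
    by rewrite opprB addrCA addrAC subrr add0r.
  rewrite -(cvg_lim _ cv)//; apply: limr_le; first by apply/cvg_ex; eexists; exact: cv.
  exists N => // m /= Nm.
  rewrite (eq_fsbigr (fun i => hnorm ((u n - u m) i) ^+ 2)); last first.
    by move=> i _; rewrite hseqD hseqN.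
  apply: le_trans (hseq_fsum_le _ fA) _; rewrite -hseq_dnorm_sqr.
  rewrite ler_pXn2r ?nnegrE ?sqrtr_ge0 ?(ltW e0)//.
  by rewrite ltW// uN.
have [N1 N1P] := key 1 ltr01.
have [p1 _] := norm_summable_fsum (N1P N1 (leqnn _)).
have p2 : norm_summable l.
  have := norm_summable_lin (-1) (HSeq p1) (u N1) => /=.
  rewrite (_ : (fun i : T => _) = l)//.
  apply: functional_extensionality_dep => i.
  by rewrite scaleN1r opprB subrK.
exists (HSeq p2); apply/cvgrPdist_lt => e e0.
have [N NP] := key (e / 2) (divr_gt0 e0 (ltr0Sn _ _)).
exists N => // n /= Nn; rewrite sub0r normrN ger0_norm ?sqrtr_ge0//.
apply: (@le_lt_trans _ _ (e / 2)); last by lra.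
rewrite -(@ler_pXn2r _ 2)// ?nnegrE ?sqrtr_ge0//; last by lra.
rewrite hseq_dnorm_sqr.
have := (norm_summable_fsum (NP n Nn)).2.
by under [X in _ -> is_true (rsum X <= _)]funext do rewrite hseqD hseqN.
Qed.

Definition hsum : hilbert R := Hilbert hseq_complete.

End HilbertSum.

Section SumOperators.
Variables (R : realType) (T : choiceType) (E : T -> hilbert R).
Local Notation C := R[i].
Local Notation L := (hsum E).

Definition hcoord i (f : L) : E i := (f : hseq E) i.

Lemma hcoordP i a (f g : L) : hcoord i (a *: f + g) = a *: hcoord i f + hcoord i g.
Proof. by rewrite /hcoord hseqD hseqZ. Qed.

Lemma hcoordD i (f g : L) : hcoord i (f + g) = hcoord i f + hcoord i g.
Proof. by rewrite -[f in LHS]scale1r hcoordP scale1r. Qed.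

Lemma hcoordZ i a (f : L) : hcoord i (a *: f) = a *: hcoord i f.
Proof. exact: hseqZ. Qed.

Lemma hsum_eq (f g : L) : (forall i, hcoord i f = hcoord i g) -> f = g.
Proof. exact: hseq_eq. Qed.

Lemma hnorm_hcoord i (f : L) : hnorm (hcoord i f) <= hnorm f.
Proof. exact: hseq_coef_le. Qed.

Lemma hnorm_hsum (f : L) : hnorm f ^+ 2 = rsum (fun i => hnorm (hcoord i f) ^+ 2).
Proof. exact: hseq_dnorm_sqr. Qed.

Lemma hdot_hsum (f g : L) : hdot L f g = csum (fun i => hdot (E i) (hcoord i f) (hcoord i g)).
Proof. by []. Qed.

Lemma hinj_summable i (y : E i) : norm_summable (eqtype.dfwith (fun j => 0 : E j) y).
Proof.
apply: (@abs_summable_single _ _ i) => j ij.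
by rewrite dfwith_out 1?eq_sym// hnorm0 expr0n.
Qed.

Definition hinj i (y : E i) : L := HSeq (hinj_summable y).

Lemma hinjE i (y : E i) : hcoord i (hinj y) = y.
Proof. exact: dfwith_in. Qed.

Lemma hinj_neq i j (y : E i) : i != j -> hcoord j (hinj y) = 0.
Proof. exact: dfwith_out. Qed.

Lemma hdot_hinj (f : L) i (y : E i) : hdot L f (hinj y) = hdot (E i) (hcoord i f) y.
Proof.
rewrite hdot_hsum (@csum_single _ _ i) ?hinjE// => j ij.
by rewrite hinj_neq 1?eq_sym// hdot0r.
Qed.

Lemma hdot_hinjl (f : L) i (y : E i) : hdot L (hinj y) f = hdot (E i) y (hcoord i f).
Proof. by rewrite hdotC hdot_hinj -hdotC. Qed.

Lemma hnorm_hinj i (y : E i) : hnorm (hinj y) = hnorm y.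
Proof. by rewrite /hnorm /dnorm hdot_hinj hinjE. Qed.

Lemma hinjP i a (x y : E i) : hinj (a *: x + y) = a *: hinj x + hinj y.
Proof. by apply: hdot_ext => z; rewrite hdotDr hdotZr !hdot_hinj hdotDr hdotZr. Qed.

(** No convergence of finite sums is involved: the coordinates of [S f] are inner products of [f]
    with values of the adjoint, whose coordinates in turn depend only on [S] at injected vectors. *)
Lemma bop_eq_hinj (S S' : bop L) :
  (forall i (y : E i), S (hinj y) = S' (hinj y)) -> S = S'.
Proof.
move=> e; apply: bop_eq => f; apply: hsum_eq => i; apply: hdot_extl => y.
rewrite -!hdot_hinj !bstarP.
suff -> : bstar S (hinj y) = bstar S' (hinj y) by [].
apply: hsum_eq => j; apply: hdot_extl => z.
by rewrite -!hdot_hinj !bstarP !bstarK e.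
Qed.

Section Lift.
Variables (i : T) (t : bop (E i)).

Fact hlift_linear : linear (fun f : L => hinj (t (hcoord i f))).
Proof. by move=> a f g; rewrite hcoordP linearP hinjP. Qed.

Fact hlift_bounded : exists K : R, forall f : L, hnorm (hinj (t (hcoord i f))) <= K * hnorm f.
Proof.
have [K tK] := bfun_bounded t; exists `|K| => f; rewrite hnorm_hinj.
apply: le_trans (tK _) _; apply: le_trans (_ : `|K| * hnorm (hcoord i f) <= _).
  by rewrite ler_wpM2r ?hnorm_ge0 ?ler_norm.
by rewrite ler_wpM2l ?hnorm_hcoord.
Qed.

Fact hlift_adj (f g : L) : hdot L (hinj (t (hcoord i f))) g =
  hdot L f (hinj (badj t (hcoord i g))).
Proof. by rewrite hdot_hinjl badjP hdot_hinj. Qed.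

Definition hlift : bop L := Bop hlift_linear hlift_bounded hlift_adj.

End Lift.

Section Compress.
Variables (i : T) (t : bop L).

Fact compress_linear : linear (fun y : E i => hcoord i (t (hinj y))).
Proof. by move=> a x y; rewrite hinjP linearP hcoordP. Qed.

Fact compress_bounded :
  exists K : R, forall y : E i, hnorm (hcoord i (t (hinj y))) <= K * hnorm y.
Proof.
have [K tK] := bfun_bounded t; exists K => y; rewrite -(hnorm_hinj y).
exact: le_trans (hnorm_hcoord _ _) (tK _).
Qed.

Fact compress_adj (x y : E i) : hdot (E i) (hcoord i (t (hinj x))) y =
  hdot (E i) x (hcoord i (badj t (hinj y))).
Proof. by rewrite -hdot_hinj badjP hdot_hinjl. Qed.

Definition compress : bop (E i) := Bop compress_linear compress_bounded compress_adj.

End Compress.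

Lemma hliftE i (t : bop (E i)) f : hlift t f = hinj (t (hcoord i f)).
Proof. by []. Qed.

Lemma compressE i (t : bop L) y : compress i t y = hcoord i (t (hinj y)).
Proof. by []. Qed.

Lemma compressP i a (s t : bop L) : compress i (a *: s + t) = a *: compress i s + compress i t.
Proof. by apply: bop_eq => y; rewrite compressE bopD bopZ hcoordP. Qed.

Lemma compress1 i : compress i 1 = 1.
Proof. by apply: bop_eq => y; rewrite compressE bop1 hinjE. Qed.

Lemma compress0 i : compress i 0 = 0.
Proof. by apply: bop_eq. Qed.

Lemma compress_star i t : compress i (bstar t) = bstar (compress i t).
Proof. exact: bop_eq. Qed.

End SumOperators.

(** * Amplifications and commutants *)

Section Ampliation.
Variables (R : realType) (T : choiceType) (G : hilbert R).
Local Notation L := (hsum (fun _ : T => G)).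

Section Operator.
Variable z : bop G.

Fact hampl_summable (f : L) : norm_summable (fun i : T => z (hcoord i f)).
Proof.
have [K zK] := bfun_bounded z.
apply: abs_summable_le (abs_summableZ (K ^+ 2) (hseqP (f : hseq _))) => i.
rewrite ger0_norm ?sqr_ge0// -exprMn ler_pXn2r ?nnegrE ?hnorm_ge0//.
exact: le_trans (hnorm_ge0 _) (zK _).
Qed.

Definition hampl_fun (f : L) : L := HSeq (hampl_summable f).

Lemma hcoord_hampl i f : hcoord i (hampl_fun f) = z (hcoord i f).
Proof. by []. Qed.

Fact hampl_linear : linear hampl_fun.
Proof.
move=> a f g; apply: hsum_eq => i.
by rewrite hcoordP !hcoord_hampl hcoordP linearP.
Qed.

Fact hampl_bounded : exists K : R, forall f, hnorm (hampl_fun f) <= K * hnorm f.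
Proof.
have [K zK] := bfun_bounded z; exists `|K| => f.
rewrite -(@ler_pXn2r _ 2)// ?nnegrE ?hnorm_ge0 ?mulr_ge0 ?hnorm_ge0//.
rewrite exprMn !hnorm_hsum -rsumZ !rsum_ge0; last 2 first.
- by move=> i; rewrite mulr_ge0 ?sqr_ge0.
- by move=> i; rewrite sqr_ge0.
have sf := abs_summableZ (`|K| ^+ 2) (hseqP (f : hseq _)).
apply: fine_le.
- by apply: esum_fin (hampl_summable f) => i; rewrite sqr_ge0.
- by apply: esum_fin sf => i; rewrite mulr_ge0 ?sqr_ge0.
apply: le_esum => i _; rewrite lee_fin hcoord_hampl -exprMn.
rewrite ler_pXn2r ?nnegrE ?hnorm_ge0 ?mulr_ge0 ?hnorm_ge0//.
by apply: le_trans (zK _) _; rewrite ler_wpM2r ?hnorm_ge0 ?ler_norm.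
Qed.

End Operator.

Fact hampl_adj z (f g : L) : hdot L (hampl_fun z f) g = hdot L f (hampl_fun (bstar z) g).
Proof.
by rewrite !hdot_hsum; congr csum; apply/funext => i; rewrite !hcoord_hampl bstarP.
Qed.

Definition hampl z : bop L := Bop (hampl_linear z) (hampl_bounded z) (hampl_adj z).

Lemma hamplE z f i : hcoord i (hampl z f) = z (hcoord i f).
Proof. by []. Qed.

Lemma hampl_star z : hampl (bstar z) = bstar (hampl z).
Proof. exact: bop_eq. Qed.

Lemma hampl_inj z i (y : G) :
  hampl z (@hinj _ _ (fun _ : T => G) i y) = @hinj _ _ (fun _ : T => G) i (z y).
Proof.
apply: hsum_eq => j; rewrite hamplE; have [<-|ij] := eqVneq i j.
  by rewrite !(@hinjE _ _ (fun _ : T => G)).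
by rewrite !(@hinj_neq _ _ (fun _ : T => G))// linear0.
Qed.

Section Entry.
Variables (i j : T) (t : bop L).
Local Notation inj i y := (@hinj _ _ (fun _ : T => G) i y).

Fact hentry_linear : linear (fun y : G => hcoord i (t (inj j y))).
Proof. by move=> a x y; rewrite hinjP linearP hcoordP. Qed.

Fact hentry_bounded :
  exists K : R, forall y : G, hnorm (hcoord i (t (inj j y))) <= K * hnorm y.
Proof.
have [K tK] := bfun_bounded t; exists K => y.
rewrite -(hnorm_hinj (E := fun _ : T => G) (i := j) y).
exact: le_trans (hnorm_hcoord _ _) (tK _).
Qed.

Fact hentry_adj (x y : G) : hdot G (hcoord i (t (inj j x))) y =
  hdot G x (hcoord j (badj t (inj i y))).
Proof. by rewrite -(hdot_hinj (E := fun _ : T => G)) badjP hdot_hinjl. Qed.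

Definition hentry : bop G := Bop hentry_linear hentry_bounded hentry_adj.

End Entry.

(** If [Q] commutes with the amplification of [S], all its matrix entries lie in the commutant of
    [S]. Hence [z] commutes with every entry. *)
Lemma hampl_commute (S : set (bop G)) (z : bop G) (Q : bop L) :
  commutant (commutant S) z -> (forall s, S s -> hampl s * Q = Q * hampl s) ->
  hampl z * Q = Q * hampl z.
Proof.
move=> zS QS; have QC i j : commutant S (hentry i j Q).
  move=> s Ss; apply: bop_eq => y.
  have := congr1 (fun U : bop L => hcoord i (U (@hinj _ _ (fun _ : T => G) j y))) (QS s Ss).
  by rewrite !bopM hamplE hampl_inj => ->.
apply: bop_eq_hinj => j y; apply: hsum_eq => i.
have := congr1 (fun U : bop G => U y) (zS _ (QC i j)).
by rewrite !bopM hamplE hampl_inj.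
Qed.

End Ampliation.

Arguments hampl {R T G} z.

(** * Traces and vectors *)

Section RealLemmas.
Variable R : realType.

Lemma rsum_le (T : choiceType) (F G : T -> R) : abs_summable F -> abs_summable G ->
  (forall i, F i <= G i) -> rsum F <= rsum G.
Proof.
move=> sF sG FG; have sGF := abs_summableD sG (abs_summableN sF).
have -> : G = (fun i => F i + (G i - F i)) by apply/funext => i; rewrite addrC subrK.
rewrite rsumD// lerDl rsum_ge0; last by move=> i; rewrite subr_ge0.
by rewrite fine_ge0// esum_ge0// => i _; rewrite lee_fin subr_ge0.
Qed.

(** Iterating the square inequality gives [a 0 ^+ (2 ^ n) * al <= a n * al ^+ (2 ^ n)]. If [a 0]
    exceeded [K * al], powers of a ratio larger than 1 would stay below [A / al]. The factor [A] is
    thus absorbed, a spectral radius argument without spectra. *)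
Lemma power_trick (a : nat -> R) (al A K : R) : 0 <= al -> 0 < K ->
  (forall n, 0 <= a n) -> (forall n, a n ^+ 2 <= a n.+1 * al) ->
  (forall n, a n <= A * K ^+ (2 ^ n)) -> a 0%N <= K * al.
Proof.
move=> al0 K0 a0 aS aK; rewrite leNgt; apply/negP => h.
have alp : 0 < al.
  rewrite lt_def al0 andbT; apply/eqP => alE; move: h (aS 0%N).
  rewrite alE !mulr0 => h; apply/negP; rewrite -ltNge exprn_gt0//.
have Kalp : 0 < K * al by rewrite mulr_gt0.
have aP n : a 0%N ^+ (2 ^ n) * al <= a n * al ^+ (2 ^ n).
  elim: n => [|n IH]; first by rewrite expn0 !expr1.
  rewrite -(ler_pM2r alp) -mulrA -expr2 expnSr !exprM -exprMn.
  apply: le_trans (_ : (a n * al ^+ (2 ^ n)) ^+ 2 <= _).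
    rewrite ler_pXn2r ?nnegrE ?mulr_ge0 ?exprn_ge0//.
  by rewrite exprMn [leRHS]mulrAC ler_wpM2r ?sqr_ge0//; exact: aS.
pose r := a 0%N / (K * al) - 1.
have r0 : 0 < r by rewrite subr_gt0 ltr_pdivlMr// mul1r.
(* Bernoulli's inequality provides the growth that contradicts boundedness. *)
have rP m : 1 + r *+ m <= (1 + r) ^+ m.
  elim: m => [|m IH]; first by rewrite mulr0n addr0 expr0.
  rewrite exprSr; apply: le_trans (_ : (1 + r *+ m) * (1 + r) <= _).
    have : 0 <= (r *+ m) * r by rewrite mulr_ge0 ?mulrn_wge0 ?ltW.
    by rewrite mulrS; lra.
  by rewrite ler_wpM2r// addr_ge0// ltW.
have rA n : (1 + r) ^+ (2 ^ n) <= A / al.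
  rewrite ler_pdivlMr//.
  have -> : 1 + r = a 0%N / (K * al) by rewrite /r addrC subrK.
  rewrite -(ler_pM2r (exprn_gt0 (2 ^ n) Kalp)) mulrAC -exprMn.
  rewrite divfK ?gt_eqF//; apply: le_trans (aP n) _.
  by rewrite exprMn mulrA ler_wpM2r ?exprn_ge0.
have [n rn] : exists n : nat, A / al / r < n%:R.
  by exists (Num.truncn (A / al / r)).+1; exact: truncnS_gt.
have le_n : (n <= 2 ^ n)%N by exact: ltnW (ltn_expl n _).
have := rA n; move: (2 ^ n)%N le_n => N nN; apply/negP; rewrite -ltNge.
apply: lt_le_trans (rP N); move: rn; rewrite ltr_pdivrMr// => rn.
apply: lt_le_trans rn _; rewrite -[r *+ N]mulr_natl.
have : n%:R * r <= N%:R * r by rewrite ler_wpM2r ?ler_nat ?ltW.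
lra.
Qed.

End RealLemmas.

Section OperatorLemmas.
Variables (R : realType) (H : hilbert R).
Local Notation C := R[i].
Implicit Types (S T : bop H).

Lemma bstarP_lin a S T : bstar (a *: S + T) = Num.conj a *: bstar S + bstar T.
Proof. exact: bop_eq. Qed.

Lemma bstarD S T : bstar (S + T) = bstar S + bstar T.
Proof. exact: bop_eq. Qed.

Lemma bstarN S : bstar (- S) = - bstar S.
Proof.
apply: bop_eq => x; apply: hdot_ext => y.
by rewrite bopN hdotNr -!bstarP bopN hdotNl.
Qed.

Lemma bstar1 : bstar (1 : bop H) = 1.
Proof. exact: bop_eq. Qed.

Lemma bop_scaleAl a S T : a *: (S * T) = (a *: S) * T.
Proof. exact: bop_eq. Qed.

Lemma bop_scaleAr a S T : a *: (S * T) = S * (a *: T).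
Proof. by apply: bop_eq => x; rewrite !(bopM, bopZ) linearZ. Qed.

Lemma commutant_lin (X : set (bop H)) a S T :
  commutant X S -> commutant X T -> commutant X (a *: S + T).
Proof.
move=> SX TX s Xs; rewrite mulrDl mulrDr TX// -bop_scaleAl -bop_scaleAr.
by rewrite (SX s Xs).
Qed.

Lemma commutant_mul (X : set (bop H)) S T :
  commutant X S -> commutant X T -> commutant X (S * T).
Proof. by move=> SX TX s Xs; rewrite -mulrA TX// mulrA SX// mulrA. Qed.

Lemma commutant1 (X : set (bop H)) : commutant X 1.
Proof. by move=> s _; rewrite mul1r mulr1. Qed.

Lemma bop_eq_dense (D : set H) S T : (forall x, adherent D x) ->
  (forall d, D d -> S d = T d) -> S = T.
Proof.
move=> Dd ST; apply: bop_eq => x; apply: hdot_extl => y; apply/subr0_eq.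
rewrite !bstarP -hdotNr -hdotDr hdotC (@adherent_orth _ _ D) ?conjC0// => d d1.
by rewrite hdotC hdotDr hdotNr -!bstarP ST// subrr conjC0.
Qed.

Lemma bop_bound_pos S : exists2 K : R, 0 < K & forall x, hnorm (S x) <= K * hnorm x.
Proof.
have [K SK] := bfun_bounded S; exists (`|K| + 1); first by rewrite ltr_wpDl.
move=> x; apply: le_trans (SK x) _; rewrite ler_wpM2r ?hnorm_ge0//.
by rewrite (le_trans (ler_norm K))// lerDl.
Qed.

Lemma bop_power_bound S (K : R) n x : 0 < K -> (forall x, hnorm (S x) <= K * hnorm x) ->
  hnorm ((S ^+ n) x) <= K ^+ n * hnorm x.
Proof.
move=> K0 SK; elim: n => [|n IH]; first by rewrite !expr0 mul1r.
rewrite !exprS bopM; apply: le_trans (SK _) _.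
by rewrite -mulrA ler_wpM2l ?(ltW K0).
Qed.

End OperatorLemmas.

Section TraceLemmas.
Variables (R : realType) (A : fvnalg R).
Local Notation H := (vn_space A).
Local Notation tr := (@vn_tr R A).
Implicit Types x y : bop H.

Lemma vn_opp x : vn_set A x -> vn_set A (- x).
Proof. by move=> xA; rewrite -scaleN1r -[_ *: _]addr0; apply: vn_lin => //; exact: vn_zero. Qed.

Definition trace_sqr x : R := complex.Re (tr (bstar x * x)).

Lemma trace_sqr_ge0 x : vn_set A x -> 0 <= trace_sqr x.
Proof. by move=> xA; have := vn_tr_ge0 xA; rewrite lecE => /andP[]. Qed.

Lemma trace_sqr_eq0 x : vn_set A x -> trace_sqr x <= 0 -> x = 0.
Proof.
move=> xA x0; apply: (vn_tr_faithful xA); have xge := vn_tr_ge0 xA.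
have e : trace_sqr x = 0 by apply/eqP; rewrite eq_le x0 trace_sqr_ge0.
by rewrite -(RRe_real (ger0_real xge)) -/(trace_sqr x) e.
Qed.

(** The parallelogram law for the trace norm, from which the square of [x - y] is dropped. This
    replaces the triangle inequality, at the price of a factor 2. *)
Lemma trace_sqrD x y : vn_set A x -> vn_set A y ->
  trace_sqr (x + y) <= 2 * (trace_sqr x + trace_sqr y).
Proof.
move=> xA yA; have xs := vn_star xA; have ys := vn_star yA.
have nA := vn_add xA (vn_opp yA).
have := trace_sqr_ge0 nA; rewrite /trace_sqr.
have e : tr (bstar (x + y) * (x + y)) + tr (bstar (x - y) * (x - y)) =
    tr (bstar x * x) + tr (bstar x * x) + (tr (bstar y * y) + tr (bstar y * y)).
  have xx := vn_mul xs xA; have yy := vn_mul ys yA.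
  have pp := vn_mul (vn_star (vn_add xA yA)) (vn_add xA yA).
  have nn := vn_mul (vn_star nA) nA.
  rewrite -(vn_trD pp nn) -(vn_trD xx xx) -(vn_trD yy yy).
  rewrite -(vn_trD (vn_add xx xx) (vn_add yy yy)).
  congr (vn_tr _); rewrite !bstarD bstarN !mulrDl !mulrDr !(mulNr, mulrN) opprK.
  rewrite addrACA (addrACA _ _ _ (- _)) subrr addr0; congr (_ + _).
  by rewrite addrC (addrC (- _)) addrA subrK.
move=> h; have := congr1 (@complex.Re R) e; rewrite !ReD; lra.
Qed.

(* Polarisation: [Re <x xi, x eta> <= |x (xi + eta) / 2|^2]. *)
Lemma trace_sqr_vector : exists zeta : hsum (fun _ : nat => H),
  forall x, vn_set A x -> trace_sqr x <= hnorm (hampl x zeta) ^+ 2.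
Proof.
have [xi [eta [sxi seta trE]]] := vn_tr_normal A.
have abs (u : nat -> H) : (\esum_(n in [set: nat]) (hnorm (u n) ^+ 2)%:E < +oo)%E ->
    norm_summable u.
  by apply: le_lt_trans; apply: le_esum => i _; rewrite ger0_norm ?sqr_ge0.
pose f : hsum (fun _ : nat => H) := HSeq (abs _ sxi).
pose g : hsum (fun _ : nat => H) := HSeq (abs _ seta).
exists (2^-1 *: f + 2^-1 *: g) => x xA.
have xxA := vn_mul (vn_star xA) xA.
rewrite /trace_sqr trE// hnorm_hsum -[complex.Re _]/(rsum _).
have sx := normal_summable (bstar x * x) sxi seta.
apply: rsum_le => [||n]; first exact: csummable_Re.
  exact: hseqP (hampl x _ : hseq _).
rewrite hamplE hcoordP hnorm_sqr.
have -> : hcoord n (2^-1 *: g) = 2^-1 *: eta n by rewrite hcoordZ.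
rewrite -[hcoord n f]/(xi n) bopM bstarP bstarK -scalerDr linearZ linearD.
rewrite hdotZl hdotZr !(hdotDl, hdotDr) (hdotC (x (eta n)) (x (xi n))).
have := Re_hdot_ge0 (x (xi n) - x (eta n)).
rewrite !(hdotDl, hdotDr, hdotNl, hdotNr) opprK (hdotC (x (eta n)) (x (xi n))).
have -> : (2^-1 : R[i]) = (2^-1)%:C%C by rewrite fmorphV rmorph_nat.
have cr : Num.conj ((2^-1)%:C%C : R[i]) = (2^-1)%:C%C by exact: conjc_real.
rewrite cr.
move: (hdot _ _ _) (hdot _ _ _) (hdot _ _ _) => [a b] [c d] [e h] /=.
rewrite ?(mul0r, subr0, mulr0, addr0); lra.
Qed.

End TraceLemmas.

(** * Algebras with generators of equal moments *)

Section MomentIso.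
Variables (R : realType) (A : bool -> fvnalg R) (J : Type).
Variable g : forall b, J -> bop (vn_space (A b)).
Local Notation C := R[i].
Local Notation E := (fun b : bool => vn_space (A b)).
Local Notation G := (hsum E).
Local Notation inj b y := (@hinj _ _ E b y).
(** The indices behave like words: the index of a unit, product or adjoint is the same on both
    sides. So the span of the direct sums is a star-algebra with unit, and [gtr] forces the two
    traces to agree on it. *)
Hypothesis g1 : exists j, forall b, g b j = 1.
Hypothesis gM : forall i j, exists k, forall b, g b k = g b i * g b j.
Hypothesis gS : forall i, exists j, forall b, g b j = bstar (g b i).
Hypothesis gtr : forall i, vn_tr (g false i) = vn_tr (g true i).
Hypothesis ggen : forall b, commutant (commutant (range (g b))) = vn_set (A b).

Definition joint (j : J) : bop G :=
  hlift (g false j : bop (E false)) + hlift (g true j : bop (E true)).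

Lemma hcoord_joint b j f : hcoord b (joint j f) = g b j (hcoord b f).
Proof.
rewrite -[RHS]addr0 /joint bopD !hliftE hcoordD.
case: b.
  by rewrite (@hinj_neq _ _ E false true)// (@hinjE _ _ E true) addrC.
by rewrite (@hinj_neq _ _ E true false)// (@hinjE _ _ E false).
Qed.

Lemma joint_hinj b j (y : E b) : joint j (inj b y) = inj b (g b j y).
Proof.
apply: hsum_eq => b'; rewrite hcoord_joint; have [e|bb'] := eqVneq b b'.
  by subst b'; rewrite !(@hinjE _ _ E).
by rewrite !(@hinj_neq _ _ E b b')// linear0.
Qed.

Lemma joint_eq (s : bop G) j : (forall b f, hcoord b (s f) = g b j (hcoord b f)) -> s = joint j.
Proof. by move=> e; apply: bop_eq => f; apply: hsum_eq => b; rewrite e hcoord_joint. Qed.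

Lemma joint1 : exists j, joint j = 1.
Proof. by have [j e] := g1; exists j; apply/esym/joint_eq => b f; rewrite e. Qed.

Lemma jointM i j : exists k, joint k = joint i * joint j.
Proof.
have [k e] := gM i j; exists k; apply/esym/joint_eq => b f.
by rewrite e !bopM !hcoord_joint.
Qed.

Lemma joint_star i : exists j, joint j = bstar (joint i).
Proof.
have [j e] := gS i; exists j; apply/esym/joint_eq => b f.
rewrite e; apply: hdot_extl => y.
by rewrite -hdot_hinj !bstarP !bstarK joint_hinj hdot_hinj.
Qed.

Definition joint_commutant : set (bop G) := commutant (range joint).
Definition joint_alg : set (bop G) := commutant joint_commutant.

Lemma joint_commutant_star t : joint_commutant t -> joint_commutant (bstar t).
Proof.
apply: commutant_star => _ [j _ <-]; have [k <-] := joint_star j.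
by exists k.
Qed.

Lemma joint_alg_star t : joint_alg t -> joint_alg (bstar t).
Proof. by apply: commutant_star => s; exact: joint_commutant_star. Qed.

Lemma joint_mem j : joint_alg (joint j).
Proof. by apply: sub_bicommutant; exists j. Qed.

Lemma hlift_commutant b (t : bop (E b)) :
  commutant (range (g b)) t -> joint_commutant (hlift t).
Proof.
move=> tg _ [j _ <-]; apply: bop_eq => f.
rewrite !bopM !hliftE joint_hinj hcoord_joint -bopM -[in RHS]bopM tg//.
Qed.

Lemma compress_commutant b (t : bop G) :
  joint_commutant t -> commutant (range (g b)) (compress b t).
Proof.
move=> tS _ [j _ <-]; apply: bop_eq => y; rewrite !bopM !compressE -hcoord_joint.
by rewrite -joint_hinj -!bopM (tS (joint j))//; exists j.
Qed.

Lemma compress_mem b z : joint_alg z -> vn_set (A b) (compress b z).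
Proof.
move=> zR; rewrite -ggen => t tg; apply: bop_eq => y; rewrite !bopM !compressE.
have -> : inj b (t y) = hlift (t : bop (E b)) (inj b y) by rewrite hliftE (@hinjE _ _ E).
by rewrite -bopM (zR _ (hlift_commutant tg)) bopM hliftE (@hinjE _ _ E).
Qed.

(** Lifting the identity of one summand yields a projection in [joint_commutant]. Elements of
    [joint_alg] commute with it and are therefore block diagonal, which is also why compression is
    multiplicative on them. *)
Lemma hcoord_compress b z f : joint_alg z -> hcoord b (z f) = compress b z (hcoord b f).
Proof.
move=> zR; have h := zR _ (hlift_commutant (@commutant1 _ _ (range (g b)))).
have := congr1 (fun U : bop G => hcoord b (U f)) h.
by rewrite !bopM !hliftE !bop1 (@hinjE _ _ E).
Qed.

Lemma compressM b z z' : joint_alg z' ->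
  compress b (z * z') = compress b z * compress b z'.
Proof.
move=> zR; apply: bop_eq => y; rewrite bopM !compressE bopM; congr (hcoord b (z _)).
apply: hsum_eq => b'; rewrite hcoord_compress//; have [e|bb'] := eqVneq b b'.
  by subst b'; rewrite !(@hinjE _ _ E).
by rewrite !(@hinj_neq _ _ E b b')// linear0.
Qed.

Lemma compress_joint b j : compress b (joint j) = g b j.
Proof. by apply: bop_eq => y; rewrite compressE hcoord_joint (@hinjE _ _ E). Qed.

(** Linear combinations are built one term at a time so that closure under products and the
    comparison of traces are plain inductions. *)
Inductive joint_span : bop G -> Prop :=
| joint_span0 : joint_span 0
| joint_spanD a j d : joint_span d -> joint_span (a *: joint j + d).

Lemma joint_span_alg d : joint_span d -> joint_alg d.
Proof.
elim=> [|a j {}d _ dR]; last by apply: commutant_lin => //; exact: joint_mem.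
by move=> t _; rewrite mul0r mulr0.
Qed.

Lemma joint_span_lin a d d' : joint_span d -> joint_span d' -> joint_span (a *: d + d').
Proof.
move=> + sd'; elim=> [|b j {}d _ IH]; first by rewrite scaler0 add0r.
by rewrite scalerDr scalerA -addrA; exact: joint_spanD.
Qed.

Lemma joint_spanM d d' : joint_span d -> joint_span d' -> joint_span (d * d').
Proof.
move=> + sd'; elim=> [|a j {}d _ IH]; first by rewrite mul0r; exact: joint_span0.
rewrite mulrDl -bop_scaleAl; apply: joint_span_lin => //.
elim: sd' {IH} => [|b k {}d' _ IH']; first by rewrite mulr0; exact: joint_span0.
rewrite mulrDr -bop_scaleAr; have [l <-] := jointM j k; exact: joint_spanD.
Qed.

Lemma joint_span_star d : joint_span d -> joint_span (bstar d).
Proof.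
elim=> [|a j {}d _ IH]; last first.
  by rewrite bstarP_lin; have [k <-] := joint_star j; exact: joint_spanD.
by rewrite (_ : bstar 0 = 0); [exact: joint_span0|exact: bop_eq].
Qed.

Lemma joint_span_trace d : joint_span d ->
  vn_tr (compress false d) = vn_tr (compress true d).
Proof.
elim=> [|a j {}d sd IH].
  have t0 b : @vn_tr R (A b) 0 = 0.
    have := vn_tr_linear (-1) (vn_zero (A b)) (vn_zero (A b)).
    by rewrite scaler0 addr0 mulN1r addNr.
  by rewrite !compress0 !t0.
have dR := joint_span_alg sd.
rewrite !compressP !vn_tr_linear ?IH ?compress_joint ?gtr//; try exact: compress_mem.
  by rewrite -(compress_joint true); apply: compress_mem (joint_mem _).
by rewrite -(compress_joint false); apply: compress_mem (joint_mem _).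
Qed.

(** The density half of the bicommutant theorem. The projection [Q] onto the closed cyclic subspace
    of [zeta] commutes with the amplified generators, hence with the amplified [z]. As [zeta] lies
    in that subspace, so does its image under [z]. *)
Lemma joint_span_dense z (zeta : hsum (fun _ : nat => G)) : joint_alg z ->
  forall e : R, 0 < e -> exists2 d, joint_span d & hnorm (hampl (z - d) zeta) < e.
Proof.
move=> zR.
have hl a (x y : bop G) : hampl (a *: x + y) zeta = a *: hampl x zeta + hampl y zeta.
  by apply: hsum_eq => i; rewrite hcoordP !hamplE.
pose D : set (hsum (fun _ : nat => G)) := [set f | exists2 d, joint_span d & f = hampl d zeta].
have sD : subspace D.
  split=> [|a _ _ [d sd ->] [d' sd' ->]]; first by exists 0; [exact: joint_span0|exact: hsum_eq].
  by exists (a *: d + d'); [exact: joint_span_lin|rewrite hl].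
have joint_spanJ j : joint_span (joint j).
  by rewrite -[joint j]scale1r -[_ *: _]addr0; apply: joint_spanD; exact: joint_span0.
have jD j f : D f -> D (hampl (joint j) f).
  move=> [d sd ->]; exists (joint j * d); first exact: joint_spanM.
  exact: hsum_eq.
have [Q [QD Qx Qd]] := orth_projection sD.
have jQ s : range joint s -> hampl s * Q = Q * hampl s.
  move=> [j _ <-]; apply: projection_commute QD Qx _ _ => // [d|d]; first exact: jD.
  by rewrite -hampl_star; have [k <-] := joint_star j; exact: jD.
have zetaD : D zeta.
  have [j j1] := joint1; exists 1; first by rewrite -j1.
  exact: hsum_eq.
have := congr1 (fun U : bop _ => U zeta) (hampl_commute zR jQ).
rewrite !bopM (Qd _ zetaD) => zQ e e0.
have [_ [d sd ->] zd] := QD (hampl z zeta) e e0; exists d; first exact: sd.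
have -> : hampl (z - d) zeta = hampl z zeta - hampl d zeta.
  by rewrite [in LHS]addrC -scaleN1r hl scaleN1r addrC.
by rewrite [hampl z zeta]zQ.
Qed.

Fact hseq_embed_summable b (f : hsum (fun _ : nat => E b)) :
  norm_summable (fun n : nat => inj b (hcoord n f)).
Proof.
rewrite /norm_summable; under eq_fun do rewrite hnorm_hinj.
exact: hseqP (f : hseq _).
Qed.

Definition hseq_embed b (f : hsum (fun _ : nat => E b)) : hsum (fun _ : nat => G) :=
  HSeq (hseq_embed_summable f).

Lemma hnorm_hsum_le (T : choiceType) (E1 E2 : T -> hilbert R) (f1 : hsum E1) (f2 : hsum E2) :
  (forall i, hnorm (hcoord i f1) <= hnorm (hcoord i f2)) -> hnorm f1 <= hnorm f2.
Proof.
move=> le12; rewrite -(@ler_pXn2r _ 2)// ?nnegrE ?hnorm_ge0//.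
rewrite !hnorm_hsum; apply: rsum_le; [exact: hseqP|exact: hseqP|].
by move=> i; rewrite ler_pXn2r ?nnegrE ?hnorm_ge0.
Qed.

(** A single vector must control both traces at once, so that one polynomial approximates on both
    sides. It is the sum of the two vectors placed in the two summands. *)
Lemma joint_trace_bound : exists zeta : hsum (fun _ : nat => G), forall b z,
  joint_alg z -> trace_sqr (compress b z : bop (vn_space (A b))) <= hnorm (hampl z zeta) ^+ 2.
Proof.
pose zt b := sval (cid (trace_sqr_vector (A b))).
have ztP b := svalP (cid (trace_sqr_vector (A b))).
exists (hseq_embed (zt false) + hseq_embed (zt true)) => b z zR.
apply: le_trans (ztP b _ (compress_mem b zR)) _.
rewrite ler_pXn2r ?nnegrE ?hnorm_ge0//; apply: hnorm_hsum_le => n.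
apply: le_trans (hnorm_hcoord b _); rewrite !hamplE hcoord_compress//.
have -> : hcoord n (hseq_embed (zt false) + hseq_embed (zt true)) =
    inj false (hcoord n (zt false)) + inj true (hcoord n (zt true)).
  exact: hcoordD.
rewrite hcoordD.
case: b.
  by rewrite (@hinj_neq _ _ E false true)// (@hinjE _ _ E true) add0r.
by rewrite (@hinj_neq _ _ E true false)// (@hinjE _ _ E false) addr0.
Qed.

Lemma joint_alg_lin a x y : joint_alg x -> joint_alg y -> joint_alg (a *: x + y).
Proof. exact: commutant_lin. Qed.

Lemma joint_algB x y : joint_alg x -> joint_alg y -> joint_alg (x - y).
Proof. by move=> xR yR; rewrite addrC -scaleN1r; exact: joint_alg_lin. Qed.

Lemma compressB b x y : compress b (x - y) = compress b x - compress b y :> bop (E b).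
Proof. by rewrite [in LHS]addrC -scaleN1r compressP scaleN1r addrC. Qed.

(** A polynomial [d] close to [z] has small trace norm on side [b], where [z] vanishes. By equality
    of moments its trace norm is equally small on the other side, and then that of [z] is small
    there too; faithfulness concludes. *)
Lemma compress_inj0 b z : joint_alg z -> compress b z = 0 -> z = 0.
Proof.
move=> zR z0.
have [zeta zetaP] := joint_trace_bound.
pose q b' (w : bop G) := trace_sqr (compress b' w : bop (vn_space (A b'))).
have qspan b1 b2 d : joint_span d -> q b1 d = q b2 d.
  move=> sd; have e : q false d = q true d.
    rewrite /q /trace_sqr -!compress_star -!compressM; try exact: joint_span_alg.
    by rewrite (joint_span_trace (joint_spanM (joint_span_star sd) sd)).
  by case: b1; case: b2.
have z0' b' : compress b' z = 0.
  apply: trace_sqr_eq0; first exact: compress_mem.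
  (* 4 arises from [trace_sqrD] applied to [z - d] and [d], each of squared trace norm at most
     [e]. *)
  apply: (@le0_small _ _ 4) => e e0.
  pose e' := Num.sqrt e; have e'0 : 0 < e' by rewrite sqrtr_gt0.
  have [d sd zd] := joint_span_dense zeta zR e'0.
  have dR := joint_span_alg sd.
  have qzd c : q c (z - d) <= e.
    apply: le_trans (zetaP c _ (joint_algB zR dR)) _.
    by rewrite -[e]sqr_sqrtr ?(ltW e0)// ler_pXn2r ?nnegrE ?hnorm_ge0 ?sqrtr_ge0// ltW.
  have qd : q b' d <= e.
    rewrite (qspan b' b)//; apply: le_trans (qzd b).
    have q0 : compress b (z - d) = - compress b d by rewrite compressB z0 sub0r.
    by rewrite /q q0 /trace_sqr bstarN mulrNN.
  have := trace_sqrD (compress_mem b' (joint_algB zR dR)) (compress_mem b' dR).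
  rewrite {1}compressB subrK -/(q b' (z - d)) -/(q b' d) => h.
  have := qzd b'; lra.
by apply: bop_eq => f; apply: hsum_eq => b'; rewrite hcoord_compress// z0'.
Qed.

Lemma compress_inj b z z' : joint_alg z -> joint_alg z' ->
  compress b z = compress b z' -> z = z'.
Proof.
move=> zR zR' e; apply/subr0_eq/(@compress_inj0 b); first exact: joint_algB.
by rewrite compressB e subrr.
Qed.

(** * Surjectivity of the compressions *)

Section Surjectivity.
Variable b : bool.
Local Notation Hb := (vn_space (A b)).

(* Formal sums [sum_k t_k (y_k)] with [t_k] in the commutant; [y] in the
   algebra acts on them through [y_k |-> y y_k]. *)
Definition fsum (y : bop Hb) (s : seq (bop G * Hb)) : G :=
  \sum_(p <- s) p.1 (inj b (y p.2)).

Definition fsum_dom (s : seq (bop G * Hb)) : Prop := forall p, p \in s -> joint_commutant p.1.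

(** The inner product of [t a] and [t' c] only involves the compression of [bstar t' * t]. This
    compression commutes with the algebra, so [y] passes through it and moves to the other side as
    its adjoint. *)
Lemma fsum_adj y w w' s s' : vn_set (A b) y -> fsum_dom s -> fsum_dom s' ->
  hdot G (fsum (y * w) s) (fsum w' s') = hdot G (fsum w s) (fsum (bstar y * w') s').
Proof.
move=> yA sS sS'; rewrite /fsum !hdot_suml; apply: eq_big_seq => p /sS.
case: p => t k; rewrite -![(t, k).1]/t -![(t, k).2]/k => tS.
rewrite !hdot_sumr; apply: eq_big_seq => p' /sS'.
case: p' => t' k'; rewrite -![(t', k').1]/t' -![(t', k').2]/k' => tS'.
have ttS : joint_commutant (bstar t' * t).
  by apply: commutant_mul tS; exact: joint_commutant_star.
have flip (a c : Hb) : hdot G (t (inj b a)) (t' (inj b c)) =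
      hdot Hb (compress b (bstar t' * t) a) c.
  by rewrite -[t']bstarK -bstarP -bopM hdot_hinj bstarK.
rewrite !flip !bopM -bstarP -bopM -[in RHS]bopM.
have := yA; rewrite -ggen => /(_ _ (compress_commutant ttS)) e.
by have := congr1 (fun U : bop Hb => U (w k)) e; rewrite !bopM => <-.
Qed.

(** [B] depends on the formal sum and says nothing uniform by itself. Only the growth rate in [n]
    matters, and [power_trick] eliminates [B]. *)
Lemma fsum_bound (y : bop Hb) s (K : R) : (forall k, hnorm (y k) <= K * hnorm k) -> 0 < K ->
  exists B : R, forall n, hnorm (fsum (y ^+ n) s) <= B * K ^+ n.
Proof.
move=> yK K0; elim: s => [|[t k] s [B IH]].
  by exists 0 => n; rewrite /fsum big_nil hnorm0 mul0r.
have [L L0 tL] := bop_bound_pos t; exists (L * hnorm k + B) => n.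
rewrite /fsum big_cons; apply: le_trans (hnormD _ _) _; rewrite mulrDl; apply: lerD (IH n).
apply: le_trans (tL _) _; rewrite hnorm_hinj -mulrA ler_wpM2l ?(ltW L0)//.
by rewrite mulrC; exact: bop_power_bound.
Qed.

Lemma vn_exp (h : bop Hb) n : vn_set (A b) h -> vn_set (A b) (h ^+ n).
Proof.
move=> hA; elim: n => [|n IH]; first by rewrite expr0; exact: vn_one.
by rewrite exprS; exact: vn_mul.
Qed.

Lemma bstar_exp (h : bop Hb) n : bstar h = h -> bstar (h ^+ n) = h ^+ n.
Proof.
move=> hh; elim: n => [|n IH]; first by rewrite expr0 bstar1.
by rewrite exprS bstarM IH hh -exprSr exprS.
Qed.

(* For [h = x* x] one has [|U(h^m) s|^2 <= |U(h^2m) s| |U(1) s|], and iterating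
   over [m = 2^n] bounds [|U(h) s|] by [|h| |U(1) s|]. *)
Lemma fsum_bounded x : vn_set (A b) x ->
  exists K : R, forall s, fsum_dom s -> hnorm (fsum x s) <= K * hnorm (fsum 1 s).
Proof.
move=> xA; pose h := bstar x * x.
have hA : vn_set (A b) h by apply: vn_mul => //; exact: vn_star.
have hh : bstar h = h by rewrite bstarM bstarK.
(* The argument bounds [x] by the square root of [K]; [K + 1] dominates that root. *)
have [K K0 hK] := bop_bound_pos h; exists (K + 1) => s sS.
have [B BP] := fsum_bound s hK K0.
have CS y w : hnorm (fsum y s) ^+ 2 = complex.Re (hdot G (fsum w s) (fsum 1 s)) ->
    hnorm (fsum y s) ^+ 2 <= hnorm (fsum w s) * hnorm (fsum 1 s).
  by move=> ->; exact: CauchySchwarz_Re.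
have pw : hnorm (fsum h s) <= K * hnorm (fsum 1 s).
  pose a n := hnorm (fsum (h ^+ (2 ^ n)) s).
  have aS n : a n ^+ 2 <= a n.+1 * hnorm (fsum 1 s).
    apply: CS; have := fsum_adj (h ^+ (2 ^ n)) 1 (vn_exp (2 ^ n) hA) sS sS.
    by rewrite bstar_exp// mulr1 -exprD addnn -mul2n -expnS hnorm_sqr => ->.
  have -> : hnorm (fsum h s) = a 0%N by rewrite /a expn0 expr1.
  by apply: power_trick aS (fun n => BP _) => // [|n]; exact: hnorm_ge0.
have xh : hnorm (fsum x s) ^+ 2 <= hnorm (fsum h s) * hnorm (fsum 1 s).
  apply: CS; have := fsum_adj x 1 (vn_star xA) sS sS.
  by rewrite bstarK mulr1 hnorm_sqr => ->.
rewrite -(@ler_pXn2r _ 2)// ?nnegrE ?mulr_ge0 ?addr_ge0 ?hnorm_ge0 ?(ltW K0)//.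
apply: (le_trans xh); apply: le_trans (_ : K * hnorm (fsum 1 s) * hnorm (fsum 1 s) <= _).
  by rewrite ler_wpM2r ?hnorm_ge0.
rewrite -mulrA -expr2 exprMn ler_wpM2r ?sqr_ge0//.
have := sqr_ge0 K; lra.
Qed.

Definition fsum_rel x : G -> G -> Prop := fun u v =>
  exists s, [/\ fsum_dom s, u = fsum 1 s & v = fsum x s].

Lemma fsum_cat y s s' : fsum y (s ++ s') = fsum y s + fsum y s'.
Proof. by rewrite /fsum big_cat. Qed.

Lemma fsum_scale y a s :
  fsum y [seq (a *: p.1, p.2) | p <- s] = a *: fsum y s.
Proof. by rewrite /fsum big_map scaler_sumr. Qed.

Lemma fsum_apply (t : bop G) y s : fsum y [seq (t * p.1, p.2) | p <- s] = t (fsum y s).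
Proof. by rewrite /fsum big_map linear_sum. Qed.

Lemma fsum_linear_rel x : linear_rel (fsum_rel x).
Proof.
split=> [|a u v u' v' [s [sS -> ->]] [s' [sS' -> ->]]].
  by exists [::]; split=> //; rewrite /fsum big_nil.
exists ([seq (a *: p.1, p.2) | p <- s] ++ s'); split; rewrite ?fsum_cat ?fsum_scale//.
move=> p; rewrite mem_cat => /orP[/mapP[q /sS qS ->] /=|]; last exact: sS'.
by rewrite -[_ *: _]addr0; apply: commutant_lin => // t _; rewrite mul0r mulr0.
Qed.

Lemma fsum_dom_apply t s : joint_commutant t -> fsum_dom s ->
  fsum_dom [seq (t * p.1, p.2) | p <- s].
Proof. by move=> tS sS p /mapP[q /sS qS ->]; exact: commutant_mul. Qed.

(** The span of the translates is invariant under the commutant, so the projection [Q] onto its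
    closure belongs to [joint_alg]. [Q] fixes the summand [b], so its compression is 1, and
    injectivity of the compression gives [Q = 1]. *)
Lemma fsum_dense x : forall f, adherent [set u | exists v, fsum_rel x u v] f.
Proof.
pose D : set G := [set u | exists v, fsum_rel x u v].
have sD : subspace D.
  split=> [|a u u' [v uv] [v' uv']]; first by exists 0; exact: (fsum_linear_rel x).1.
  by exists (a *: v + v'); exact: (fsum_linear_rel x).2.
have [Q [QD Qx Qd]] := orth_projection sD.
have tD t f : joint_commutant t -> D f -> D (t f).
  move=> tS [_ [s [sS -> _]]]; exists (fsum x [seq (t * p.1, p.2) | p <- s]).
  exists [seq (t * p.1, p.2) | p <- s]; split; rewrite ?fsum_apply//.
  exact: fsum_dom_apply.
have QR : joint_alg Q.
  move=> t tS; apply/esym/(projection_commute sD QD Qx) => f; apply: tD => //.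
  exact: joint_commutant_star.
have Q1 : Q = 1.
  apply: (@compress_inj b) => //; first exact: commutant1.
  apply: bop_eq => y; rewrite compress1 bop1 compressE Qd ?(@hinjE _ _ E)//.
  exists (fsum x [:: (1, y)]), [:: (1, y)]; split=> //.
    by move=> p; rewrite inE => /eqP ->; exact: commutant1.
  by rewrite /fsum big_seq1.
by move=> f; have := QD f; rewrite Q1.
Qed.

Lemma compress_surj x : vn_set (A b) x -> exists2 z, joint_alg z & compress b z = x.
Proof.
move=> xA; have xsA := vn_star xA.
have [K xK] := fsum_bounded xA; have [K' xK'] := fsum_bounded xsA.
have [|||z zP] := @bop_extension R G (fsum_rel x) (fsum_rel (bstar x)) K K'
  (fsum_linear_rel x) (fsum_linear_rel (bstar x)) (@fsum_dense x) (@fsum_dense (bstar x)).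
- by move=> _ _ [s [sS -> ->]]; exact: xK.
- by move=> _ _ [s [sS -> ->]]; exact: xK'.
- move=> _ _ _ _ [s [sS -> ->]] [s' [sS' -> ->]].
  by have := fsum_adj 1 1 xA sS sS'; rewrite !mulr1.
exists z.
  (* On formal sums [t] multiplies the coefficients on the left while [z] acts on the vectors, so
     the two actions commute. *)
  move=> t tS; apply: bop_eq_dense (@fsum_dense x) _ => _ [v [s [sS -> _]]].
  have sS1 := fsum_dom_apply tS sS.
  rewrite !bopM (zP (fsum 1 s) (fsum x s)); last by exists s.
  rewrite -(fsum_apply t 1) -(fsum_apply t x); apply: zP; by exists [seq (t * p.1, p.2) | p <- s].
apply: bop_eq => y; rewrite compressE.
rewrite (zP _ (inj b (x y))) ?(@hinjE _ _ E)//.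
exists [:: (1, y)]; split; rewrite /fsum ?big_seq1// => p.
by rewrite inE => /eqP ->; exact: commutant1.
Qed.

End Surjectivity.

Theorem moment_isomorphism : vn_isomorphic (A false) (A true).
Proof.
(* [Z] inverts the compression on the algebra and is arbitrary elsewhere. [ZE], a consequence of
   injectivity, then transfers each algebraic property from the compression to [Z]. *)
have /boolp.choice[Z ZP] : forall x : bop (vn_space (A false)), exists z : bop G,
    vn_set (A false) x -> joint_alg z /\ compress false z = x.
  move=> x; have [xA|xA] := boolp.pselect (vn_set (A false) x); last by exists 0.
  by have [z zR zx] := compress_surj xA; exists z.
have ZR x xA := (ZP x xA).1; have Zx x xA := (ZP x xA).2.
have ZE x z : joint_alg z -> compress false z = x -> Z x = z.
  move=> zR zx; have xA : vn_set (A false) x by rewrite -zx; exact: compress_mem.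
  by apply: (@compress_inj false) => //; [exact: ZR|rewrite Zx].
exists (fun x => compress true (Z x)); split.
- split=> [x xA|x x' /set_mem xA /set_mem xA' e|y yA].
  + exact: compress_mem (ZR _ xA).
  + by rewrite -(Zx _ xA) -(Zx _ xA') (@compress_inj true _ _ _ _ e)//; exact: ZR.
  + have [z zR zy] := compress_surj yA; exists (compress false z).
      exact: compress_mem.
    by rewrite (ZE _ z).
- move=> a x y xA yA; rewrite (ZE _ (a *: Z x + Z y)) ?compressP//.
    by apply: joint_alg_lin; exact: ZR.
  by rewrite !Zx.
- move=> x y xA yA; have yR := ZR _ yA.
  rewrite (ZE _ (Z x * Z y)) ?(compressM _ _ yR)//; last by rewrite !Zx.
  by apply: commutant_mul => //; exact: ZR.
- move=> x xA; have xR := ZR _ xA.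
  rewrite (ZE _ (bstar (Z x))); first exact: compress_star.
    exact: joint_alg_star.
  by rewrite compress_star Zx.
Qed.

End MomentIso.

(** * The square root of the generator of L Z *)

Section IntSums.
Variable R : realType.
Implicit Types (a : nat -> R) (F : int -> R).

Lemma cvg_partial_sum_ge0 a : (forall i, 0 <= a i) -> abs_summable a ->
  (fun n => \sum_(i < n) a i) @ \oo --> fine (\esum_(i in [set: nat]) (a i)%:E)%E.
Proof.
move=> a0 sa; have fa := esum_fin a0 sa.
have c : (fun n => (\sum_(i < n) a i)%:E) @ \oo -->
    (fine (\esum_(i in [set: nat]) (a i)%:E)%E)%:E.
  rewrite fineK//.
  have -> : (fun n => (\sum_(i < n) a i)%:E) = (fun n => \sum_(0 <= i < n) (a i)%:E)%E.
    by apply/funext => n; rewrite big_mkord sumEFin.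
  rewrite -nneseries_esumT; last by move=> i; rewrite lee_fin.
  by apply: is_cvg_nneseries => i _ _; rewrite lee_fin.
exact: fine_cvg c.
Qed.

Lemma cvg_partial_sum a : abs_summable a ->
  (fun n => \sum_(i < n) a i) @ \oo --> rsum a.
Proof.
move=> sa.
have c1 := cvg_partial_sum_ge0 (fun i => maxr0_ge0 (a i)) (abs_summable_pos sa).
have c2 := cvg_partial_sum_ge0 (fun i => maxr0_ge0 (- a i)) (abs_summable_pos (abs_summableN sa)).
have -> : (fun n => \sum_(i < n) a i) =
    (fun n => \sum_(i < n) Num.max (a i) 0 - \sum_(i < n) Num.max (- a i) 0).
  by apply/funext => n; rewrite -sumrB; apply: eq_bigr => i _; exact: maxr0B.
exact: cvgB c1 c2.
Qed.

Lemma rsum_telescope (phi : nat -> R) : phi @ \oo --> (0 : R) ->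
  abs_summable (fun n => phi n - phi n.+1) -> rsum (fun n => phi n - phi n.+1) = phi 0%N.
Proof.
move=> phi0 sphi; have c := cvg_partial_sum sphi.
have c' : (fun n => \sum_(i < n) (phi i - phi i.+1)) @ \oo --> phi 0%N.
  have -> : (fun n => \sum_(i < n) (phi i - phi i.+1)) = (fun n => phi 0%N - phi n).
    apply/funext => n; elim: n => [|n IH]; first by rewrite big_ord0 subrr.
    by rewrite big_ord_recr /= IH addrA subrK.
  by rewrite -[X in _ --> X]subr0; apply: cvgB phi0; exact: cvg_cst.
exact: (cvg_unique _ c c').
Qed.

Lemma abs_summable_telescope (phi : nat -> R) :
  phi @ \oo --> (0 : R) -> (forall n, phi n.+1 <= phi n) ->
  abs_summable (fun n => phi n - phi n.+1).
Proof.
move=> phi0 phid; have phige0 n : 0 <= phi n.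
  have nd : nonincreasing_seq phi by apply/nonincreasing_seqP.
  rewrite -(cvg_lim _ phi0)//; apply: nonincreasing_cvgn_ge => //.
  by apply/cvg_ex; exists 0.
rewrite /abs_summable -nneseries_esumT; last by move=> i; rewrite lee_fin.
apply: (@le_lt_trans _ _ (phi 0%N)%:E); last exact: ltry.
apply: lime_le; first by apply: is_cvg_nneseries => i _ _; rewrite lee_fin.
apply: nearW => n; rewrite sumEFin lee_fin big_mkord.
suff -> : \sum_(i < n) `|phi i - phi i.+1| = phi 0%N - phi n by rewrite gerBl.
elim: n => [|n IH]; first by rewrite big_ord0 subrr.
by rewrite big_ord_recr /= IH ger0_norm ?subr_ge0// addrA subrK.
Qed.

(** Nonnegative integers sit at even places and negative ones at odd places, which fits the
    splitting of sums by parity. *)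
Definition int_of_parity (n : nat) : int := if odd n then Negz n./2 else Posz n./2.

Lemma int_of_parity_bij : bijective int_of_parity.
Proof.
exists (fun k : int => match k with Posz n => n.*2 | Negz n => n.*2.+1 end) => [n|[n|n]].
- rewrite /int_of_parity -[RHS]odd_double_half; by case: (odd n).
- by rewrite /int_of_parity odd_double doubleK.
- by rewrite /int_of_parity /= odd_double /= uphalf_double.
Qed.

Lemma int_of_parity_even n : int_of_parity n.*2 = Posz n.
Proof. by rewrite /int_of_parity odd_double doubleK. Qed.

Lemma int_of_parity_odd n : int_of_parity n.*2.+1 = Negz n.
Proof. by rewrite /int_of_parity /= odd_double /= uphalf_double. Qed.

Lemma abs_summable_int F : abs_summable (fun n => F (Posz n)) ->
  abs_summable (fun n => F (Negz n)) -> abs_summable F.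
Proof.
rewrite /abs_summable => s1 s2.
rewrite (@esum_bij _ _ _ _ (fun k => `|F k|) int_of_parity_bij)//.
rewrite (@esum_parity _ (fun n => `|F (int_of_parity n)|))//.
under eq_esum do rewrite int_of_parity_even.
under [X in (_ + X)%E]eq_esum do rewrite int_of_parity_odd.
by rewrite lte_add_pinfty.
Qed.

Lemma abs_summable_inj (T T' : choiceType) (e : T -> T') (F : T' -> R) : injective e ->
  abs_summable F -> abs_summable (fun i => F (e i)).
Proof.
move=> ie; apply: le_lt_trans.
rewrite -(esum_image setT e (fun k => `|F k|%:E)); last by move=> x y _ _; exact: ie.
rewrite esum_mkcond; apply: le_esum => i _.
by case: ifP; rewrite lee_fin.
Qed.

Lemma rsum_int F : abs_summable F ->
  rsum F = rsum (fun n => F (Posz n)) + rsum (fun n => F (Negz n)).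
Proof.
move=> sF; rewrite (rsum_bij F int_of_parity_bij) rsum_parity; last first.
  exact: abs_summable_inj (bij_inj int_of_parity_bij) sF.
by congr (_ + _); apply: eq_rsum => n; rewrite ?int_of_parity_even ?int_of_parity_odd.
Qed.

Definition odd_inv (k : int) : R := ((2 * k - 1)%:~R)^-1.

Lemma odd_inv_neq0 (k : int) : (2 * k - 1)%:~R != 0 :> R.
Proof. by rewrite intr_eq0; apply/eqP; lia. Qed.

Lemma odd_invE k : odd_inv k = (2 * k%:~R - 1)^-1.
Proof. by rewrite /odd_inv rmorphB rmorphM. Qed.

(** This symmetry later yields both the adjoint of the root, which is the root times an inverse
    translation, and the effect of the flip. *)
Lemma odd_inv_refl k : odd_inv (1 - k) = - odd_inv k.
Proof.
rewrite !odd_invE rmorphB /= rmorph1 (_ : 2 * (1 - k%:~R) - 1 = - (2 * k%:~R - 1)) ?invrN//; ring.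
Qed.

Lemma harmonic_telescope n : (n.+1%:R^-1 - n.+2%:R^-1 : R) = ((n%:R + 1) * (n%:R + 2))^-1.
Proof.
have n0 : 0 <= n%:R :> R by [].
rewrite -[n.+1%:R]natr1 -[n.+2%:R]natr1 -[n.+1%:R]natr1.
by field; apply/andP; split; apply/eqP; lra.
Qed.

Lemma odd_inv_sqr_summable : abs_summable (fun k => odd_inv k ^+ 2).
Proof.
have sphi : abs_summable (fun n : nat => n.+1%:R^-1 - n.+2%:R^-1 : R).
  apply: (@abs_summable_telescope (fun n => n.+1%:R^-1)); first exact: cvg_harmonic.
  by move=> n; rewrite lef_pV2 ?posrE ?ltr0n// ler_nat.
(* The constant 6 is attained at [k = 1], where the denominator is 1 and the left side is 2 times
   3. *)
have bound n (y : R) : (n%:R + 1) * (n%:R + 2) <= 6 * y ^+ 2 ->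
    `|(y^-1) ^+ 2| <= 6 * (n.+1%:R^-1 - n.+2%:R^-1).
  have n0 : 0 <= n%:R :> R by [].
  rewrite ger0_norm ?sqr_ge0// harmonic_telescope => h.
  have p0 : 0 < (n%:R + 1) * (n%:R + 2) :> R by rewrite mulr_gt0//; lra.
  have y0 : 0 < y ^+ 2 by lra.
  rewrite ler_pdivlMr// exprVn mulrC ler_pdivrMr//.
apply: abs_summable_int.
  apply: abs_summable_le (abs_summableZ 6 sphi) => n; apply: bound.
  case: n => [|n]; first by rewrite /= mulr0 sub0r; lra.
  have n0 : 0 <= n%:R :> R by [].
  rewrite rmorphB rmorphM /= -[Posz n.+1]/(n.+1%:Z) -pmulrn -natr1.
  nra.
apply: abs_summable_le (abs_summableZ 6 sphi) => n; apply: bound.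
have n0 : 0 <= n%:R :> R by [].
rewrite NegzE rmorphB rmorphM /= rmorphN /= -pmulrn -natr1.
nra.
Qed.

Lemma odd_inv_cvgS : (fun n : nat => odd_inv n.+1) @ \oo --> (0 : R).
Proof.
have b n : 0 <= odd_inv n.+1 <= n.+1%:R^-1.
  have n0 : 0 <= n%:R :> R by [].
  have -> : odd_inv n.+1 = (2 * n%:R + 1)^-1.
    by rewrite odd_invE -[Posz n.+1]/(n.+1%:Z) -pmulrn -natr1; congr GRing.inv; ring.
  rewrite invr_ge0 -natr1 lef_pV2 ?posrE; lra.
apply: squeeze_cvgr (@cvg_cst _ _ _ _ _) (@cvg_harmonic R).
by apply: nearW => n; exact: b.
Qed.

Definition shift_prod (m : int) : R := rsum (fun k => odd_inv k * odd_inv (k - m)).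

Lemma shift_prod_summable m : abs_summable (fun k => odd_inv k * odd_inv (k - m)).
Proof.
have s1 := odd_inv_sqr_summable.
have s2 : abs_summable (fun k => odd_inv (k - m) ^+ 2).
  by apply: (abs_summable_inj (e := fun k => k - m)) s1; exact: addIr.
apply: abs_summable_le (abs_summableD s1 s2) => k.
have := sqr_ge0 (odd_inv k - odd_inv (k - m)).
have := sqr_ge0 (odd_inv k + odd_inv (k - m)).
by rewrite ler_norml => h1 h2; apply/andP; split; lra.
Qed.

(** Partial fractions: for [m != 0] the autocorrelation [shift_prod m] becomes a multiple of a
    telescoping sum. *)
Lemma shift_diffE m k : odd_inv (k - m) - odd_inv k = 2 * m%:~R * (odd_inv k * odd_inv (k - m)).
Proof.
have h1 := odd_inv_neq0 k; have h2 := odd_inv_neq0 (k - m).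
rewrite !odd_invE; move: h1 h2; rewrite !(rmorphB, rmorphM) /= => h1 h2.
by field; rewrite h1 h2.
Qed.

Lemma shift_diff_summable m : abs_summable (fun k => odd_inv (k - m) - odd_inv k).
Proof.
rewrite (_ : (fun k => _) = (fun k => 2 * m%:~R * (odd_inv k * odd_inv (k - m)))).
  by apply: abs_summableZ; exact: shift_prod_summable.
by apply/funext => k; exact: shift_diffE.
Qed.

Lemma rsum_shift_diff1 : rsum (fun k => odd_inv (k - 1) - odd_inv k) = 0.
Proof.
have s := shift_diff_summable 1.
(* After this shift the nonnegative half telescopes to [odd_inv 0] and the negative half, by
   reflection, to [odd_inv 1]. These are -1 and 1. *)
have be : bijective (fun k : int => 1 + k).
  by exists (fun k => k - 1) => k; lia.
rewrite (rsum_bij _ be); have {}s := abs_summable_inj (bij_inj be) s.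
rewrite rsum_int//.
have e1 (n : nat) : odd_inv (1 + Posz n - 1) - odd_inv (1 + Posz n) = odd_inv n - odd_inv n.+1.
  by congr (odd_inv _ - odd_inv _); lia.
have e2 (n : nat) : odd_inv (1 + Negz n - 1) - odd_inv (1 + Negz n) =
    odd_inv n.+1 - odd_inv n.+2.
  rewrite (_ : 1 + Negz n - 1 = 1 - n.+2%:Z) 1?(_ : 1 + Negz n = 1 - n.+1%:Z); try lia.
  by rewrite !odd_inv_refl opprK addrC.
have iP : injective Posz by move=> a c [].
have iN : injective Negz by move=> a c [].
have sP := abs_summable_inj iP s; have sN := abs_summable_inj iN s.
have c0 : (fun n : nat => odd_inv n) @ \oo --> (0 : R).
  by rewrite -cvg_shiftS; exact: odd_inv_cvgS.
have /= E1 := rsum_telescope c0; have /= E2 := rsum_telescope odd_inv_cvgS.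
rewrite (eq_rsum e1) (eq_rsum e2) E1; last by move: sP; under eq_fun do rewrite e1.
rewrite E2; last by move: sN; under eq_fun do rewrite e2.
by rewrite -[1%Z]subr0 odd_inv_refl subrr.
Qed.

(** [odd_inv] is not absolutely summable, so the sum cannot be split into two equal ones. Instead
    the difference for [n + 1] is the one for [n] plus a translate of the one for 1, all of them
    summable. *)
Lemma rsum_shift_diff (m : int) : rsum (fun k => odd_inv (k - m) - odd_inv k) = 0.
Proof.
have step (n : int) : rsum (fun k => odd_inv (k - (n + 1)) - odd_inv k) =
    rsum (fun k => odd_inv (k - n) - odd_inv k).
  have be : bijective (fun k : int => k - n) by exists (fun k => k + n) => k; lia.
  have s1 := shift_diff_summable 1.
  have s2 : abs_summable (fun k => odd_inv (k - n - 1) - odd_inv (k - n)).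
    exact: abs_summable_inj (bij_inj be) s1.
  have -> : (fun k => odd_inv (k - (n + 1)) - odd_inv k) = (fun k =>
      (odd_inv (k - n - 1) - odd_inv (k - n)) + (odd_inv (k - n) - odd_inv k)).
    by apply/funext => k; rewrite addrA subrK opprD addrA.
  rewrite (rsumD s2 (shift_diff_summable n)).
  by rewrite -(rsum_bij (fun k => odd_inv (k - 1) - odd_inv k) be) rsum_shift_diff1 add0r.
have h0 : rsum (fun k => odd_inv (k - 0) - odd_inv k) = 0.
  rewrite (eq_rsum (G := fun _ => 0)) => [|k]; last by rewrite subr0 subrr.
  by rewrite (@rsum_single _ _ (0 : int)).
elim/int_ind: m => // n IH.
  by rewrite -addn1 PoszD step.
by have := step (- n.+1%:Z); rewrite (_ : - n.+1%:Z + 1 = - n%:Z) ?IH; last lia.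
Qed.

Lemma shift_prod_eq0 m : m != 0 -> shift_prod m = 0.
Proof.
move=> m0; have := rsum_shift_diff m.
rewrite (eq_rsum (shift_diffE m)) rsumZ => /eqP.
by rewrite !mulf_eq0 intr_eq0 (negbTE m0) pnatr_eq0 /= => /eqP.
Qed.

Lemma shift_prod0_gt0 : 0 < shift_prod 0.
Proof.
have e : shift_prod 0 = rsum (fun k => odd_inv k ^+ 2).
  by apply: eq_rsum => k; rewrite subr0 expr2.
rewrite e rsum_ge0; last by move=> k; exact: sqr_ge0.
have s := odd_inv_sqr_summable.
rewrite -lte_fin fineK; last by apply: esum_fin s => k; exact: sqr_ge0.
rewrite (esumID [set (1 : int)]); last by move=> i _; rewrite lee_fin sqr_ge0.
rewrite setTI esum_set1 ?lee_fin ?sqr_ge0//.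
apply: (@lt_le_trans _ _ (odd_inv 1 ^+ 2)%:E).
  by rewrite lte_fin exprn_even_gt0//= invr_eq0 odd_inv_neq0.
by rewrite leeDl// esum_ge0// => i _; rewrite lee_fin sqr_ge0.
Qed.

End IntSums.

(** * Operators prescribed on a total family *)

Section Families.
Variables (R : realType) (H : hilbert R) (I : eqType).
Local Notation C := R[i].
Implicit Types d e : I -> H.

Definition lin_comb d (s : seq (C * I)) : H := \sum_(p <- s) p.1 *: d p.2.

Definition comb_rel d e : H -> H -> Prop := fun u v =>
  exists s, u = lin_comb d s /\ v = lin_comb e s.

Lemma lin_comb_cat d s s' : lin_comb d (s ++ s') = lin_comb d s + lin_comb d s'.
Proof. by rewrite /lin_comb big_cat. Qed.

Lemma lin_comb_scale d a s : lin_comb d [seq (a * p.1, p.2) | p <- s] = a *: lin_comb d s.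
Proof. by rewrite /lin_comb big_map scaler_sumr; apply: eq_bigr => p _; rewrite scalerA. Qed.

Lemma comb_linear_rel d e : linear_rel (comb_rel d e).
Proof.
split; first by exists [::]; rewrite /lin_comb !big_nil.
move=> a _ _ _ _ [s [-> ->]] [s' [-> ->]].
by exists ([seq (a * p.1, p.2) | p <- s] ++ s'); rewrite !lin_comb_cat !lin_comb_scale.
Qed.

Lemma hdot_lin_comb d d' e e' s s' :
  (forall i j, hdot H (d i) (d' j) = hdot H (e i) (e' j)) ->
  hdot H (lin_comb d s) (lin_comb d' s') = hdot H (lin_comb e s) (lin_comb e' s').
Proof.
move=> de; rewrite /lin_comb !hdot_suml; apply: eq_bigr => p _.
rewrite !hdotZl !hdot_sumr; congr (_ * _); apply: eq_bigr => q _.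
by rewrite !hdotZr de.
Qed.

(** Equal Gram matrices make [d i] to [e i] and [d i] to [e' i] isometric on linear combinations, so
    both are bounded by 1. The family [e'] lists the values of the adjoint. *)
Lemma bop_of_families d e e' :
  (forall y, (forall i, hdot H y (d i) = 0) -> y = 0) ->
  (forall i j, hdot H (e i) (e j) = hdot H (d i) (d j)) ->
  (forall i j, hdot H (e' i) (e' j) = hdot H (d i) (d j)) ->
  (forall i j, hdot H (e i) (d j) = hdot H (d i) (e' j)) ->
  exists T : bop H, forall i, T (d i) = e i.
Proof.
move=> dtot ee ee' ed.
have lin1 f i : lin_comb f [:: (1, i)] = f i by rewrite /lin_comb big_seq1 scale1r.
have dense f x : adherent [set u | exists v, comb_rel d f u v] x.
  apply: adherent_dense x.
    split=> [|a u u' [v uv] [v' uv']]; first by exists 0; exact: (comb_linear_rel d f).1.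
    by exists (a *: v + v'); exact: (comb_linear_rel d f).2.
  move=> y yd; apply: dtot => i; apply: yd; exists (f i), [:: (1, i)].
  by rewrite !lin1.
have isom f : (forall i j, hdot H (f i) (f j) = hdot H (d i) (d j)) ->
    forall u v, comb_rel d f u v -> hnorm v <= 1 * hnorm u.
  by move=> fd _ _ [s [-> ->]]; rewrite mul1r /hnorm /dnorm (hdot_lin_comb s s fd).
have [|T TP] := @bop_extension R H (comb_rel d e) (comb_rel d e') 1 1
  (comb_linear_rel d e) (comb_linear_rel d e') (dense e) (dense e') (isom _ ee) (isom _ ee').
  by move=> _ _ _ _ [s [-> ->]] [s' [-> ->]]; exact: hdot_lin_comb.
by exists T => i; apply: TP; exists [:: (1, i)]; rewrite !lin1.
Qed.

End Families.

(** * Operators commuting with translations *)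

Section GroupCommutant.
Variables (R : realType) (G : zmodType).
Local Notation C := R[i].
Local Notation H := (l2_hilbert R G).
Local Notation delta g := (l2_delta R (g : G)).

Lemma delta_total (y : H) : (forall g, hdot H y (delta g) = 0) -> y = 0.
Proof. by move=> y0; apply: l2_eq => g; rewrite -hdot_delta y0. Qed.

Lemma bop_eq_delta (S T : bop H) : (forall g, S (delta g) = T (delta g)) -> S = T.
Proof.
move=> e; apply: bop_eq => f; apply: l2_eq => g; rewrite -!hdot_delta !bstarP.
congr (hdot _ _ _); apply: l2_eq => h.
by rewrite -!hdot_delta [LHS]hdotC [RHS]hdotC -!bstarP e.
Qed.

Lemma translateM (g h : G) : translate R g * translate R h = translate R (g + h).
Proof. by apply: bop_eq => f; apply: l2_eq => k /=; rewrite opprD addrA. Qed.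

Lemma translate0 : translate R (0 : G) = 1.
Proof. by apply: bop_eq => f; apply: l2_eq => k /=; rewrite subr0. Qed.

(** An operator commuting with translations is convolution by its value at [delta 0], and
    convolution on an abelian group is commutative. Consequently the commutant of the translations
    lies inside their bicommutant, which puts the root into L Z. *)
Lemma commutant_translate_abelian (y y' : bop H) :
  commutant (range (translate R (G := G))) y -> commutant (range (translate R (G := G))) y' ->
  y * y' = y' * y.
Proof.
move=> yT yT'.
have conv (x x' : bop H) : commutant (range (translate R (G := G))) x -> forall n,
    ((x * x') (delta 0) : l2 R G) n =
    csum (fun k => (x' (delta 0) : l2 R G) k * (x (delta 0) : l2 R G) (n - k)).
  move=> xT n; rewrite -hdot_delta bopM bstarP.
  rewrite -[LHS]/(csum _); congr csum; apply/funext => k; congr (_ * _).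
  have xTk : x * translate R k = translate R k * x by apply: xT; exists k.
  rewrite -translateE -bopM -xTk bopM translate_delta add0r.
  by rewrite -[in RHS]hdot_delta -[in LHS]hdot_delta bstarP bstarK -hdotC bstarP.
apply: bop_eq_delta => g; rewrite -[g]add0r -translate_delta.
have com (x : bop H) : commutant (range (translate R (G := G))) x ->
    x * translate R g = translate R g * x by apply; exists g.
rewrite -!(bopM (_ * _)) !(com _ (commutant_mul _ _))// !(bopM (translate _ _)).
congr (translate R g _); apply: l2_eq => n; rewrite !conv//.
have be : bijective (fun k : G => n - k)
  by exists (fun k => n - k) => k; rewrite opprB addrCA subrr addr0.
rewrite (csum_bij _ be); congr csum; apply/funext => k.
by rewrite opprB addrCA subrr addr0 mulrC.
Qed.

End GroupCommutant.

(** * The unitary root and the flip *)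

Section Root.
Variable R : realType.
Local Notation C := R[i].
Local Notation H := (l2_hilbert R int).
Local Notation delta n := (l2_delta R (n : int)).
Local Notation T n := (translate R (n : int)).
Local Notation trans := (range (translate R (G := int))).

(* Up to the normalisation, the Fourier coefficients of e^{i t / 2} on ]0, 2 pi[. *)
Definition root_coef (k : int) : C := Complex 0 ((Num.sqrt (shift_prod R 0))^-1 * odd_inv R k).

Lemma conj_root_coef k : Num.conj (root_coef k) = - root_coef k.
Proof. by rewrite /root_coef; congr Complex; rewrite oppr0. Qed.

Lemma root_coef_refl k : root_coef (1 - k) = - root_coef k.
Proof. by rewrite /root_coef odd_inv_refl mulrN; congr Complex; rewrite oppr0. Qed.

Fact root_pred : l2_pred root_coef.
Proof.
apply/asboolP; rewrite square_summableE.
have := abs_summableZ ((Num.sqrt (shift_prod R 0))^-1 ^+ 2) (@odd_inv_sqr_summable R).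
congr abs_summable; apply/funext => k.
by rewrite cabs_sqr /= expr0n add0r exprMn.
Qed.

Definition root_vector : H := L2 root_pred.

(** The Fourier form of the fact that the root has modulus 1. The two imaginary units cancel and
    leave the autocorrelation of [odd_inv], normalised at 0. *)
Lemma root_vector_orth m : hdot H root_vector (T m root_vector) = if m == 0 then 1 else 0.
Proof.
rewrite -[LHS]/(csum _).
have -> : (fun k : int => (root_vector : l2 R int) k * Num.conj ((T m root_vector : l2 R int) k)) =
    (fun k => ((shift_prod R 0)^-1 * (odd_inv R k * odd_inv R (k - m)))%:C%C).
  apply/funext => k; rewrite translateE conj_root_coef.
  have := shift_prod0_gt0 R => /ltW s0; rewrite -[in RHS](sqr_sqrtr s0).
  rewrite -[root_vector _]/(root_coef k) /root_coef.
  rewrite -exprVn; move: (Num.sqrt _)^-1 (odd_inv _ _) (odd_inv _ _) => c x y.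
  by apply/eqP; rewrite eq_complex /=; apply/andP; split; apply/eqP; ring.
rewrite csum_real rsumZ -/(shift_prod R m); case: eqVneq => [->|m0].
  by rewrite mulVf ?gt_eqF ?shift_prod0_gt0.
by rewrite (shift_prod_eq0 _ m0) mulr0.
Qed.

Lemma translate_apply m n f : T m (T n f) = T (m + n) f.
Proof. by rewrite -bopM translateM. Qed.

Lemma root_translate_orth m n : hdot H (T m root_vector) (T n root_vector) =
  hdot H (delta m) (delta n).
Proof.
rewrite translate_dot -[translate_fun _ _]/(T (- m) (T n root_vector)) translate_apply.
rewrite root_vector_orth hdot_delta l2_deltaE.
by rewrite addrC subr_eq0.
Qed.

Lemma root_exists : exists r : bop H, forall n, r (delta n) = T n root_vector.
Proof.
(* The shift by -1 in the adjoint family reflects that the conjugate of e^{i t / 2} is e^{-i t} e^{i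
   t / 2}. *)
apply: (@bop_of_families R H int (fun n => delta n) (fun n => T n root_vector)
  (fun n => T (n - 1) root_vector)) => [y y0|m n|m n|m n].
- exact: delta_total.
- exact: root_translate_orth.
- by rewrite root_translate_orth !hdot_delta !l2_deltaE (inj_eq (addIr _)).
- rewrite hdot_delta hdotC hdot_delta !translateE conj_root_coef -root_coef_refl.
  by congr root_coef; lia.
Qed.

Definition root : bop H := sval (cid root_exists).

Lemma root_delta n : root (delta n) = T n root_vector.
Proof. exact: svalP (cid root_exists) n. Qed.

Lemma root_commute : commutant trans root.
Proof.
move=> _ [n _ <-]; apply: bop_eq_delta => m.
by rewrite !bopM translate_delta !root_delta translate_apply addrC.
Qed.

Lemma star_rootE : bstar root = T (-1) * root.
Proof.
apply: bop_eq_delta => m; apply: l2_eq => n.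
rewrite -hdot_delta bstarP bstarK root_delta hdotC hdot_delta bopM root_delta.
rewrite !translateE conj_root_coef -root_coef_refl -[LHS]/(root_coef _) -[RHS]/(root_coef _).
by congr root_coef; lia.
Qed.

Lemma star_rootM : bstar root * root = 1.
Proof.
apply: bop_eq_delta => m; apply: l2_eq => n.
by rewrite -hdot_delta bopM bstarP bstarK !root_delta root_translate_orth hdot_delta.
Qed.

(** As the adjoint is [T (-1) * root], the isometry relation already states that the square is
    [T 1]; no convolution is evaluated. *)
Lemma root_sqr : root * root = T 1.
Proof.
have := star_rootM; rewrite star_rootE -mulrA => e.
by rewrite -[LHS]mul1r -translate0 -(subrr 1) -translateM -mulrA e mulr1.
Qed.

Lemma root_star : root * bstar root = 1.
Proof.
by rewrite star_rootE mulrA root_commute -?mulrA ?root_sqr ?translateM ?addNr ?translate0//; exists (-1).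
Qed.

Lemma commutant_root x : commutant trans x -> x * root = root * x.
Proof. by move=> xT; apply: commutant_translate_abelian => //; exact: root_commute. Qed.

Lemma root_groupvn : groupvn_set root.
Proof. by move=> x /commutant_root ->. Qed.

Lemma translateX n : T 1 ^+ n = T n.
Proof.
elim: n => [|n IH]; first by rewrite expr0 translate0.
by rewrite exprS IH translateM -intS.
Qed.

(** Even powers are nontrivial translations, of trace 0. The odd power [2 m + 1] has as trace the
    root coefficient at [- m], which is imaginary but not zero, so only the real part vanishes. *)
Lemma root_trace n : (0 < n)%N -> complex.Re (groupvn_tr (root ^+ n)) = 0.
Proof.
move=> n0; have r2 m : root ^+ m.*2 = T m by rewrite -translateX -mul2n exprM expr2 root_sqr.
rewrite /groupvn_tr -(odd_double_half n); case: (boolP (odd n)) => on.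
  rewrite add1n exprS r2 bopM translate_delta add0r root_delta hdot_delta translateE.
  by [].
rewrite add0n r2 translate_delta add0r hdot_delta l2_deltaE eq_sym.
case: eqP => // h; have {}h : n./2 = 0%N by lia.
by move: n0; rewrite -(odd_double_half n) (negbTE on) h.
Qed.

Lemma flip_exists : exists J : bop H, forall n, J (delta n) = delta (- n).
Proof.
have orth m n : hdot H (delta (- m)) (delta (- n)) = hdot H (delta m) (delta n).
  by rewrite !hdot_delta !l2_deltaE eqr_opp.
apply: (@bop_of_families R H int (fun n => delta n) (fun n => delta (- n))
  (fun n => delta (- n))) => //; first exact: delta_total.
by move=> m n; rewrite !hdot_delta !l2_deltaE eqr_oppLR.
Qed.

Definition flip : bop H := sval (cid flip_exists).

Lemma flip_delta n : flip (delta n) = delta (- n).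
Proof. exact: svalP (cid flip_exists) n. Qed.

Lemma flipK : flip * flip = 1.
Proof. by apply: bop_eq_delta => n; rewrite bopM !flip_delta opprK. Qed.

Lemma flipE f n : (flip f : l2 R int) n = (f : l2 R int) (- n).
Proof.
have fs : bstar flip = flip.
  apply: bop_eq_delta => m; apply: l2_eq => k.
  rewrite -!hdot_delta bstarP bstarK !flip_delta !hdot_delta !l2_deltaE.
  by rewrite eqr_oppLR.
by rewrite -!hdot_delta bstarP fs flip_delta.
Qed.

Lemma flip_translate n : flip * T n = T (- n) * flip.
Proof. by apply: bop_eq_delta => m; rewrite !bopM !(translate_delta, flip_delta) opprD. Qed.

Lemma flip_root : flip * root * flip = - bstar root.
Proof.
apply: bop_eq_delta => m; apply: l2_eq => n.
rewrite bopN !bopM flip_delta root_delta flipE star_rootE bopM root_delta.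
rewrite l2N !translateE -root_coef_refl -[LHS]/(root_coef _) -[RHS]/(root_coef _).
by congr root_coef; lia.
Qed.

End Root.

(** * Pairs of free symmetries *)

Fixpoint alternating (b : bool) (n : nat) : seq bool :=
  if n is m.+1 then b :: alternating (~~ b) m else [::].

Lemma size_alternating b n : size (alternating b n) = n.
Proof. by elim: n b => //= n IH b; rewrite IH. Qed.

Lemma nth_alternating b n k : (k < n)%N -> nth false (alternating b n) k = b (+) odd k.
Proof.
elim: n b k => // n IH b [|k] /= kn; first by rewrite addbF.
by rewrite IH// addNb addbN.
Qed.

Lemma alternating_or_repeat (l : seq bool) :
  (exists b n, l = alternating b n) \/ (exists l1 x l2, l = l1 ++ [:: x, x & l2]).
Proof.
elim: l => [|x l [[b [n ->]]|[l1 [y [l2 ->]]]]]; first by left; exists false, 0%N.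
  case: n => [|n]; first by left; exists x, 1%N.
  have [xb|xb] := eqVneq x b.
    by right; exists [::], b, (alternating (~~ b) n); rewrite xb.
  left; exists x, n.+2 => /=; suff -> : b = ~~ x by rewrite negbK.
  by move: xb; case: x; case: b.
by right; exists (x :: l1), y, l2.
Qed.

Section FreeSymmetries.
Variable R : realType.
Local Notation C := R[i].

(** In C^2 the elements of trace 0 are the multiples of the symmetry (1, -1). Freeness of two copies
    therefore reduces to the vanishing of the trace on alternating words in two symmetries. *)
Definition free_symmetries (M : fvnalg R) (u : bool -> bop (vn_space M)) : Prop :=
  [/\ forall b, bstar (u b) = u b, forall b, u b * u b = 1,
      forall b n, (0 < n)%N -> vn_tr (\prod_(i <- alternating b n) u i) = 0 &
      commutant (commutant (range u)) = vn_set M].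

(** A word that is not alternating contains a repeated letter, whose square is 1; deleting it
    shortens the word by two. Alternating words have trace 0 unless empty. *)
Lemma free_symmetries_moment (M N : fvnalg R) u v (l : seq bool) :
  @free_symmetries M u -> @free_symmetries N v ->
  vn_tr (\prod_(i <- l) u i) = vn_tr (\prod_(i <- l) v i).
Proof.
move=> [_ u2 ualt _] [_ v2 valt _].
have [k] := ubnP (size l); elim: k l => // k IH l lk.
have [[b [[|n] ->]]|[l1 [x [l2 lE]]]] := alternating_or_repeat l.
- by rewrite !big_nil !vn_tr1.
- by rewrite ualt// valt.
- have := IH (l1 ++ l2); rewrite lE !big_cat !big_cons /=.
  rewrite !(mulrA (u x)) u2 !(mulrA (v x)) v2 !mul1r; apply.
  by move: lk; rewrite lE !size_cat /=; lia.
Qed.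

Lemma bstar_prod (H : hilbert R) (u : bool -> bop H) (l : seq bool) :
  (forall b, bstar (u b) = u b) -> bstar (\prod_(i <- l) u i) = \prod_(i <- rev l) u i.
Proof.
move=> us; elim: l => [|b l IH]; first by rewrite !big_nil bstar1.
by rewrite big_cons bstarM IH us rev_cons -cats1 big_cat big_seq1.
Qed.

Lemma commutant_words (H : hilbert R) (u : bool -> bop H) :
  commutant (range (fun l : seq bool => \prod_(i <- l) u i)) = commutant (range u).
Proof.
apply/seteqP; split=> t tu.
  by move=> _ [b _ <-]; apply: tu; exists [:: b]; rewrite ?big_seq1.
move=> _ [l _ <-]; elim: l => [|b l IH]; first by rewrite big_nil mulr1 mul1r.
by rewrite big_cons mulrA (tu (u b)); [rewrite -!mulrA IH|exists b].
Qed.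

(** Words index the generators of both algebras: concatenation gives products and reversal gives
    adjoints, uniformly on the two sides. *)
Lemma free_symmetries_iso (M N : fvnalg R) u v :
  @free_symmetries M u -> @free_symmetries N v -> vn_isomorphic M N.
Proof.
move=> fu fv; have [us _ _ ug] := fu; have [vs _ _ vg] := fv.
pose A (b : bool) : fvnalg R := if b then N else M.
pose g (b : bool) : seq bool -> bop (vn_space (A b)) :=
  match b return seq bool -> bop (vn_space (A b)) with
  | true => fun l => \prod_(i <- l) v i
  | false => fun l => \prod_(i <- l) u i
  end.
apply: (@moment_isomorphism R A (seq bool) g).
- by exists [::] => -[] /=; rewrite big_nil.
- by move=> l l'; exists (l ++ l') => -[] /=; rewrite big_cat.
- by move=> l; exists (rev l) => -[] /=; rewrite bstar_prod.
- by move=> l; exact: free_symmetries_moment.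
- by case; rewrite /= commutant_words.
Qed.

Local Notation H2 := (l2_hilbert R bool).

Definition C2_sign : bop H2 := coord_proj R false - coord_proj R true.

Lemma coord_projE j (f : H2) i :
  (coord_proj R j f : l2 R bool) i = if i == j then (f : l2 R bool) i else 0.
Proof.
rewrite -[LHS]/((coord_fun j f : l2 R bool) i) /coord_fun l2Z l2_deltaE.
by case: eqVneq => [->|_]; rewrite ?mulr1 ?mulr0.
Qed.

Lemma C2_signE (f : H2) i : (C2_sign f : l2 R bool) i = (-1) ^+ i * (f : l2 R bool) i.
Proof.
rewrite /C2_sign bopD bopN l2D l2N !coord_projE.
by case: i; rewrite /= ?expr1 ?expr0 ?mulN1r ?mul1r ?subr0 ?sub0r.
Qed.

Lemma C2_sign_mem : C2_set C2_sign.
Proof. by exists (fun i : bool => (-1) ^+ i) => f i; rewrite C2_signE. Qed.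

Lemma C2_sign_sqr : C2_sign * C2_sign = 1.
Proof.
apply: bop_eq => f; apply: l2_eq => i.
by rewrite bopM !C2_signE mulrA -expr2 sqrr_sign mul1r.
Qed.

Lemma C2_sign_star : bstar C2_sign = C2_sign.
Proof.
apply: bop_eq => f; apply: l2_eq => i; rewrite -[LHS]hdot_delta bstarP bstarK.
have -> : C2_sign (l2_delta R i) = (-1) ^+ i *: l2_delta R i.
  apply: l2_eq => k; rewrite C2_signE l2Z l2_deltaE.
  by case: eqVneq => [->|]; rewrite ?mulr0.
by rewrite hdotZr hdot_delta C2_signE rmorph_sign.
Qed.

Definition C2_diag (x : bop H2) (i : bool) : C := (x (l2_delta R i) : l2 R bool) i.

Lemma C2_setE x : C2_set x -> forall f i, (x f : l2 R bool) i = C2_diag x i * (f : l2 R bool) i.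
Proof. by move=> [a xa] f i; rewrite /C2_diag !xa l2_deltaE eqxx mulr1. Qed.

Definition C2_mean x : C := 2^-1 * (C2_diag x false + C2_diag x true).
Definition C2_diff x : C := 2^-1 * (C2_diag x false - C2_diag x true).

Lemma C2_decomp x : C2_set x -> x = C2_mean x *: (1 : bop H2) + C2_diff x *: C2_sign.
Proof.
move=> xC; apply: bop_eq => f; apply: l2_eq => i.
rewrite (C2_setE xC) bopD !bopZ bop1 l2D !l2Z C2_signE /C2_mean /C2_diff.
by case: i => /=; field.
Qed.

Lemma C2_trE x : C2_tr x = C2_mean x.
Proof. by rewrite /C2_tr !hdot_delta. Qed.

Lemma C2_sign_tr : C2_tr C2_sign = 0.
Proof.
rewrite C2_trE /C2_mean /C2_diag !C2_signE !l2_deltaE /=.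
by rewrite expr0 expr1 !mulr1 subrr mulr0.
Qed.

Lemma prod_alternating_nth (H : hilbert R) (u : bool -> bop H) b n k : (k < n)%N ->
  [seq u i | i <- alternating b n]`_k = u (b (+) odd k).
Proof. by move=> kn; rewrite (nth_map false) ?size_alternating// nth_alternating. Qed.

Lemma trace_embedding_C2 (M : fvnalg R) (phi : bop (vn_space (C2 R)) -> bop (vn_space M)) x :
  trace_embedding phi -> C2_set x ->
  phi x = C2_mean x *: (1 : bop (vn_space M)) + C2_diff x *: phi C2_sign.
Proof.
move=> [_ h1 hl _ _] xC; have C0 : vn_set (C2 R) 0 by exact: vn_zero.
have C1 : vn_set (C2 R) 1 by exact: vn_one.
have phi0 : phi 0 = 0.
  by have := hl (-1) _ _ C0 C0; rewrite scaler0 addr0 scaleN1r addNr.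
have sC : vn_set (C2 R) (C2_diff x *: C2_sign + 0).
  by apply: vn_lin => //; exact: C2_sign_mem.
rewrite {1}(C2_decomp xC) -[_ *: C2_sign]addr0 hl// h1 hl//; last exact: C2_sign_mem.
by rewrite phi0 addr0.
Qed.

Lemma free_product_symmetries (M : fvnalg R) phi1 phi2 :
  is_free_product (C2 R) (C2 R) M phi1 phi2 ->
  exists u, @free_symmetries M u.
Proof.
move=> [e1 e2 fr gen].
pose phi b := if b then phi2 else phi1.
have ephi b : trace_embedding (phi b : bop (vn_space (C2 R)) -> bop (vn_space M)) by case: b.
have phiE b : phi b @` vn_set (C2 R) =
  (if b then phi2 @` vn_set (C2 R) else phi1 @` vn_set (C2 R)) by case: b.
have [u uE] : exists u : bool -> bop (vn_space M), forall b, u b = phi b C2_sign.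
  by exists (fun b => phi b C2_sign).
exists u.
have sC : vn_set (C2 R) C2_sign by exact: C2_sign_mem.
have us b : bstar (u b) = u b.
  by have [_ _ _ _ [h _]] := ephi b; rewrite uE -h// C2_sign_star.
have u2 b : u b * u b = 1.
  by have [_ h1 _ h _] := ephi b; rewrite uE -h// C2_sign_sqr.
split=> // [b n n0|].
  rewrite -(big_map u xpredT id); apply: (fr b) => [|k].
    by case: n n0.
  rewrite size_map size_alternating => kn; rewrite prod_alternating_nth//.
  split; last first.
    have [_ _ _ _ [_ h]] := ephi (b (+) odd k).
    by rewrite uE h//; exact: C2_sign_tr.
  by rewrite -phiE uE; exists C2_sign.
rewrite -gen; congr commutant; apply/seteqP; split=> t tu.
  move=> x xB; have [b [y yC <-]] : exists b, (phi b @` vn_set (C2 R)) x.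
    by case: xB => [?|?]; [exists false|exists true].
  rewrite (trace_embedding_C2 (ephi b) yC) -uE mulrDr mulrDl -!bop_scaleAr -!bop_scaleAl.
  by rewrite mulr1 mul1r tu//; exists b.
by move=> _ [b _ <-]; apply: tu; rewrite uE; case: b; [right|left]; exists C2_sign.
Qed.

Section Embedding.
Variables (M : fvnalg R) (v : bool -> bop (vn_space M)).
Hypothesis fv : free_symmetries v.

Lemma free_symmetries_mem b : vn_set M (v b).
Proof. by have [_ _ _ <-] := fv; apply: sub_bicommutant; exists b. Qed.

Lemma vn_trZ a x : vn_set M x -> vn_tr (a *: x) = a * vn_tr x.
Proof.
move=> xM; have M0 := vn_zero M.
have t0 : @vn_tr R M 0 = 0.
  by have := vn_tr_linear (-1) M0 M0; rewrite scaler0 addr0 mulN1r addNr.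
by rewrite -[a *: x]addr0 vn_tr_linear// t0 addr0.
Qed.

Definition C2_embed b (x : bop H2) : bop (vn_space M) :=
  C2_mean x *: (1 : bop (vn_space M)) + C2_diff x *: v b.

Lemma C2_diag_lin a x y i : C2_diag (a *: x + y) i = a * C2_diag x i + C2_diag y i.
Proof. by rewrite /C2_diag bopD bopZ l2D l2Z. Qed.

Lemma C2_diag1 i : C2_diag 1 i = 1.
Proof. by rewrite /C2_diag bop1 l2_deltaE eqxx. Qed.

Lemma C2_diag_mul x y i : C2_set x -> C2_set y -> C2_diag (x * y) i = C2_diag x i * C2_diag y i.
Proof. by move=> xC yC; rewrite {1}/C2_diag bopM (C2_setE xC). Qed.

Lemma C2_diag_star x i : C2_diag (bstar x) i = Num.conj (C2_diag x i).
Proof. by rewrite /C2_diag -!hdot_delta bstarP bstarK -hdotC. Qed.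

Lemma C2_embed_mem b x : vn_set M (C2_embed b x).
Proof.
apply: vn_lin; first exact: vn_one.
by rewrite -[_ *: _]addr0; apply: vn_lin; [exact: free_symmetries_mem|exact: vn_zero].
Qed.

Lemma C2_embed_tr b x : vn_tr (C2_embed b x) = C2_mean x.
Proof.
have [_ _ valt _] := fv; have := valt b 1%N isT; rewrite big_seq1 => v0.
have vM := free_symmetries_mem b.
rewrite vn_tr_linear ?vn_trZ ?v0 ?vn_tr1 ?mulr1 ?mulr0 ?addr0//; first exact: vn_one.
by rewrite -[_ *: _]addr0; apply: vn_lin => //; exact: vn_zero.
Qed.

Lemma C2_embed_trace_embedding b :
  trace_embedding (C2_embed b : bop (vn_space (C2 R)) -> bop (vn_space M)).
Proof.
have [vs v2 _ _] := fv.
split=> [x _||a x y _ _|x y xC yC|].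
- exact: C2_embed_mem.
- rewrite /C2_embed /C2_mean /C2_diff !C2_diag1 subrr mulr0 scale0r addr0.
  by rewrite -mulr2n mulVf ?pnatr_eq0// scale1r.
- apply: bop_eq => f; rewrite bopD bopZ /C2_embed !bopD !bopZ.
  rewrite scalerDr !scalerA addrACA -!scalerDl.
  by congr (_ *: _ + _ *: _); rewrite /C2_mean /C2_diff !C2_diag_lin; ring.
- have mE : C2_mean (x * y) = C2_mean x * C2_mean y + C2_diff x * C2_diff y.
    by rewrite /C2_mean /C2_diff !C2_diag_mul//; field.
  have dE : C2_diff (x * y) = C2_mean x * C2_diff y + C2_diff x * C2_mean y.
    by rewrite /C2_mean /C2_diff !C2_diag_mul//; field.
  have vE p q f : v b (p *: f + q *: v b f) = p *: v b f + q *: f.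
    by rewrite linearD !linearZ /= -[v b (v b f)]bopM v2.
  apply: bop_eq => f; rewrite /C2_embed mE dE bopM !bopD !bopZ !bop1 vE.
  rewrite !scalerDr !scalerA !scalerDl addrACA.
  by rewrite [X in _ + X]addrC.
- split=> x xC; last by rewrite C2_embed_tr -C2_trE.
  rewrite /C2_embed bstarP_lin bstar1 -[_ *: v b in RHS]addr0 bstarP_lin vs.
  rewrite (_ : bstar 0 = 0) ?addr0; last exact: bop_eq.
  rewrite /C2_mean /C2_diff !C2_diag_star !rmorphM !rmorphD rmorphN /=.
  by rewrite fmorphV rmorph_nat.
Qed.

Lemma symmetries_free_product :
  is_free_product (C2 R) (C2 R) M (C2_embed false) (C2_embed true).
Proof.
have [vs v2 valt vg] := fv.
have E b : (if b then C2_embed true @` vn_set (C2 R) else C2_embed false @` vn_set (C2 R)) =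
  C2_embed b @` vn_set (C2 R) by case: b.
have vE b : C2_embed b C2_sign = v b.
  rewrite /C2_embed /C2_mean /C2_diff /C2_diag !C2_signE !l2_deltaE /= expr0 expr1 !mulr1.
  by rewrite subrr mulr0 scale0r add0r opprK -mulr2n mulVf ?pnatr_eq0// scale1r.
split; try exact: C2_embed_trace_embedding.
  move=> b s s0 sP.
  (* A centred element of the image of C^2 has mean 0 and so is a multiple of one symmetry. An
     alternating product of such elements collapses to a scalar times an alternating word. *)
  have key (b' : bool) (s' : seq (bop (vn_space M))) : (forall k, (k < size s')%N ->
      (C2_embed (b' (+) odd k) @` vn_set (C2 R)) s'`_k /\ vn_tr s'`_k = 0) ->
      exists c, \prod_(x <- s') x = c *: \prod_(i <- alternating b' (size s')) v i.
    elim: s' b' => [|x s' IH] b' xP; first by exists 1; rewrite !big_nil scale1r.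
    have [[y yC yx] x0] := xP 0%N isT; rewrite /= addbF in yx x0.
    have [k ks|c cE] := IH (~~ b'); first by rewrite addNb -addbN; exact: (xP k.+1).
    exists (C2_diff y * c); rewrite !big_cons cE -yx /C2_embed.
    have -> : C2_mean y = 0 by rewrite -(C2_embed_tr b') yx.
    by rewrite scale0r add0r -bop_scaleAl -bop_scaleAr scalerA.
  have [|c ->] := key b s; first by move=> k ks; have := sP k ks; rewrite E.
  rewrite vn_trZ; first by rewrite valt ?mulr0//; case: (s) s0.
  elim: (alternating _ _) => [|i l IH]; first by rewrite big_nil; exact: vn_one.
  by rewrite big_cons; apply: vn_mul => //; exact: free_symmetries_mem.
rewrite -vg; congr commutant; apply/seteqP; split=> t tu.
  move=> _ [b _ <-]; apply: tu; rewrite -vE.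
  by case: b; [right|left]; exists C2_sign => //; exact: C2_sign_mem.
move=> x xB; have [b [y yC <-]] : exists b, (C2_embed b @` vn_set (C2 R)) x.
  by case: xB => [?|?]; [exists false|exists true].
rewrite /C2_embed mulrDr mulrDl -!bop_scaleAr -!bop_scaleAl mulr1 mul1r tu//.
Qed.

End Embedding.

End FreeSymmetries.

(** * Two free symmetries generating M_2(L Z) *)

Section Antidiagonal.
Variables (R : realType) (H : hilbert R).
Local Notation K := (hdouble H).
Local Notation HH := (hsort H * hsort H)%type.
Variable s : bop H.

Definition antidiag_fun (x : K) : K := ((bstar s (dproj true x), s (dproj false x)) : HH).

Fact antidiag_linear : linear antidiag_fun.
Proof.
by move=> a x y; congr pair; rewrite !dprojD !dprojZ linearP.
Qed.

Fact antidiag_bounded : exists A : R, forall x, hnorm (antidiag_fun x) <= A * hnorm x.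
Proof.
have [A A0 sA] := bop_bound_pos s; have [B B0 sB] := bop_bound_pos (bstar s).
exists (B + A) => x; apply: le_trans (double_dnorm_le _) _; rewrite mulrDl.
apply: lerD; [apply: le_trans (sB _) _|apply: le_trans (sA _) _].
  by rewrite ler_wpM2l ?(ltW B0)//; exact: double_dnorm_ge2.
by rewrite ler_wpM2l ?(ltW A0)//; exact: double_dnorm_ge1.
Qed.

Fact antidiag_adj (x y : K) : hdot K (antidiag_fun x) y = hdot K x (antidiag_fun y).
Proof.
rewrite !hdot_double /= addrC; congr (_ + _).
  by rewrite bstarP.
by rewrite -[badj s _]/(bstar s _) bstarP bstarK.
Qed.

Definition antidiag : bop K := Bop antidiag_linear antidiag_bounded antidiag_adj.

Lemma antidiag_star : bstar antidiag = antidiag.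
Proof. exact: bop_eq. Qed.

Lemma bentry_antidiag i j : bentry i j antidiag =
  if i then (if j then 0 else s) else (if j then bstar s else 0).
Proof.
apply: bop_eq => x; rewrite -[LHS]/(dproj i (antidiag_fun (dinj j x))).
by case: i; case: j => //=; rewrite ?linear0 //; apply: (linear0 (bstar s)).
Qed.

End Antidiagonal.

Section MatrixSymmetries.
Variable R : realType.
Local Notation C := R[i].
Local Notation H := (l2_hilbert R int).
Local Notation r := (root R).
Local Notation N := (M2 (LZ R)).
Local Notation trans := (range (translate R (G := int))).

Definition M2_symmetry (b : bool) : bop (vn_space N) := antidiag (if b then r else 1 : bop H).

Lemma M2_symmetry_star b : bstar (M2_symmetry b) = M2_symmetry b.
Proof. exact: antidiag_star. Qed.

Lemma antidiag_sqr (s : bop H) : bstar s * s = 1 -> s * bstar s = 1 -> antidiag s * antidiag s = 1.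
Proof.
move=> s1 s2; apply: bentry_eq => i j; rewrite bentryM !bentry_antidiag bentry1.
by case: i; case: j; rewrite /= ?mulr0 ?mul0r ?addr0 ?add0r ?s1 ?s2.
Qed.

Lemma M2_symmetry_sqr b : M2_symmetry b * M2_symmetry b = 1.
Proof.
apply: antidiag_sqr; case: b; rewrite ?bstar1 ?mulr1//; [exact: star_rootM|exact: root_star].
Qed.

Lemma M2_symmetry_mem b : vn_set N (M2_symmetry b).
Proof.
have m0 : groupvn_set (0 : bop H) by exact: (vn_zero (groupvn R int)).
have m1 : groupvn_set (1 : bop H) by exact: (vn_one (groupvn R int)).
have mr : groupvn_set r by exact: root_groupvn.
move=> i j; rewrite bentry_antidiag.
by case: i; case: j => //; case: b => //; rewrite ?bstar1//; exact: groupvn_star.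
Qed.

(** What kills [y] is a sign. [y * flip R] commutes with translations, hence with [r], so [y] times
    the flip-conjugate of [r] is [r * y]. That conjugate is [- bstar r], and the hypothesis turns
    the same product into [- (r * y)]. *)
Lemma M2_off_diagonal (y : bop H) : y * r = bstar r * y -> y * bstar r = r * y -> y = 0.
Proof.
move=> yr yrs.
have yT1 : y * translate R 1 = translate R (-1) * y.
  have -> : translate R (-1 : int) = bstar (translate R (1 : int)) by rewrite translate_star.
  by rewrite -root_sqr bstarM mulrA yr -mulrA yr mulrA.
have yTN1 : y * translate R (-1) = translate R 1 * y.
  have -> : translate R (-1 : int) = bstar (translate R (1 : int)) by rewrite translate_star.
  by rewrite -root_sqr bstarM mulrA yrs -mulrA yrs mulrA.
have yT (n : int) : y * translate R n = translate R (- n) * y.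
  elim/int_ind: n => [|n IH|n IH]; first by rewrite oppr0 !translate0 mulr1 mul1r.
    by rewrite intS -translateM mulrA yT1 -mulrA IH mulrA translateM opprD.
  by rewrite intS opprD -translateM mulrA yTN1 -mulrA IH mulrA translateM opprD opprK.
have zT : commutant trans (y * flip R).
  by move=> _ [n _ <-]; rewrite -mulrA flip_translate mulrA yT opprK mulrA.
have := commutant_root zT => e.
have ry : r * y = - (r * y).
  have h : y * flip R * r * flip R = r * y by rewrite e -!mulrA flipK mulr1.
  by rewrite -{1}h -!mulrA (mulrA (flip R)) flip_root mulrN yrs.
have r0 : r * y = 0.
  apply: bop_eq => f; have := congr1 (fun U : bop H => U f) ry.
  rewrite bopN => h; set w := (r * y) f in h *.
  have : 2%:R *: w = 0 by rewrite scaler_nat mulr2n {1}h addNr.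
  by move/eqP; rewrite scaler_eq0 pnatr_eq0 /= => /eqP.
by rewrite -[y]mul1r -star_rootM -mulrA r0 mulr0.
Qed.

Lemma M2_symmetry_generate : commutant (commutant (range M2_symmetry)) = vn_set N.
Proof.
apply/seteqP; split.
  rewrite -[X in _ `<=` X]vn_bicommutant; apply/commutant_le/commutant_le.
  by move=> _ [b _ <-]; exact: M2_symmetry_mem.
(* By passing to commutants it remains to show that any [X] commuting with both symmetries commutes
   with all of M_2(L Z). Comparing entries, [X] turns out to be diagonal with two equal entries that
   commute with the translations. *)
rewrite -[X in X `<=` _]vn_bicommutant; apply: commutant_le => X XS.
pose x i j := bentry i j X.
have com b i j : bentry i j (X * M2_symmetry b) = bentry i j (M2_symmetry b * X).
  by rewrite XS//; exists b.
have e (b i j : bool) := com b i j.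
have x10 : x false true = x true false.
  have := e false false false.
  by rewrite !bentryM !bentry_antidiag /= bstar1 !mulr0 !mul0r !mulr1 !mul1r !add0r.
have x11 : x false false = x true true.
  have := e false false true.
  by rewrite !bentryM !bentry_antidiag /= bstar1 !mulr0 !mul0r !mulr1 !mul1r !addr0 !add0r.
have y0 : x false true = 0.
  apply: M2_off_diagonal.
    have := e true false false; rewrite !bentryM !bentry_antidiag /= !mulr0 !mul0r !add0r.
    by rewrite -/(x _ _) -/(x _ _) -x10.
  have := e true true true; rewrite !bentryM !bentry_antidiag /= !mulr0 !mul0r !addr0.
  by rewrite -/(x _ _) -/(x _ _) -x10.
have xr : x true true * r = r * x true true.
  have := e true true false; rewrite !bentryM !bentry_antidiag /= !mulr0 !mul0r !addr0 !add0r.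
  by rewrite -/(x _ _) -/(x _ _) x11.
have xrs : x true true * bstar r = bstar r * x true true.
  have := e true false true; rewrite !bentryM !bentry_antidiag /= !mulr0 !mul0r !addr0 !add0r.
  by rewrite -/(x _ _) -/(x _ _) x11.
have xT1 : x true true * translate R 1 = translate R 1 * x true true.
  by rewrite -root_sqr mulrA xr -mulrA xr mulrA.
have xTN1 : x true true * translate R (-1) = translate R (-1) * x true true.
  have -> : translate R (-1 : int) = bstar (translate R (1 : int)) by rewrite translate_star.
  by rewrite -root_sqr bstarM mulrA xrs -mulrA xrs mulrA.
have xT : commutant trans (x true true).
  move=> _ [n _ <-]; elim/int_ind: n => [|n IH|n IH]; first by rewrite translate0 mulr1 mul1r.
    by rewrite intS -translateM mulrA xT1 -[LHS]mulrA IH mulrA.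
  by rewrite intS opprD -translateM mulrA xTN1 -[LHS]mulrA IH mulrA.
move=> S SM; apply: bentry_eq => i j; rewrite !bentryM -!/(x _ _).
have sx k l : bentry k l S * x true true = x true true * bentry k l S by exact: (SM k l).
by case: i; case: j; rewrite -?x10 ?x11 y0 ?mulr0 ?mul0r ?addr0 ?add0r sx.
Qed.

Lemma M2_diag_mul (c c' d d' : bop H) (x y : bop (vn_space N)) :
  (forall i j, bentry i j x = if i == j then (if i then c' else c) else 0) ->
  (forall i j, bentry i j y = if i == j then (if i then d' else d) else 0) ->
  forall i j, bentry i j (x * y) = if i == j then (if i then c' * d' else c * d) else 0.
Proof.
by move=> xE yE i j; rewrite bentryM !xE !yE; case: i; case: j; rewrite /= ?mulr0 ?mul0r ?addr0 ?add0r.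
Qed.

(** Changing either the first letter or the diagonal position replaces [r] by its adjoint, whence
    the exclusive or. *)
Lemma M2_symmetry_even b m i j :
  bentry i j (\prod_(k <- alternating b m.*2) M2_symmetry k) =
  if i == j then (if i (+) b then bstar r ^+ m else r ^+ m) else 0.
Proof.
elim: m i j => [|m IH] i j; first by rewrite big_nil bentry1 !expr0; case: (_ (+) _).
have two k l : bentry k l (M2_symmetry b * M2_symmetry (~~ b)) =
    if k == l then (if k then (if b then r else bstar r) else (if b then bstar r else r)) else 0.
  rewrite bentryM !bentry_antidiag.
  by case: (b); case: k; case: l; rewrite /= ?bstar1 ?mulr0 ?mul0r ?mulr1 ?mul1r ?addr0 ?add0r.
have IH' k l : bentry k l (\prod_(k <- alternating b m.*2) M2_symmetry k) =
    if k == l then (if k then (if b then r ^+ m else bstar r ^+ m)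
                    else (if b then bstar r ^+ m else r ^+ m)) else 0.
  by rewrite IH; case: k; case: (b).
rewrite doubleS /= !big_cons negbK mulrA (M2_diag_mul two IH').
by case: i; case: (b); rewrite /= -exprS.
Qed.

Lemma groupvn_tr_conj (x : bop H) : groupvn_tr (bstar x) = Num.conj (groupvn_tr x).
Proof. by rewrite /groupvn_tr bstarP bstarK -hdotC. Qed.

Lemma M2_symmetry_alternating b n : (0 < n)%N ->
  vn_tr (\prod_(k <- alternating b n) M2_symmetry k : bop (vn_space N)) = 0.
Proof.
move=> n0; rewrite -(odd_double_half n); case: (boolP (odd n)) => on; last first.
  rewrite add0n -[LHS]/(M2_tr _) /M2_tr !M2_symmetry_even !eqxx.
  have m0 : (0 < n./2)%N.
    move: n0 on; rewrite -{1}(odd_double_half n).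
    by case: (odd n) => //=; rewrite add0n double_gt0.
  rewrite -[@vn_tr R (LZ R)]/(@groupvn_tr R int).
  (* The diagonal entries may each have nonzero trace; these are conjugate and imaginary, so only
     their sum vanishes. *)
  have t0 : groupvn_tr (r ^+ n./2) + groupvn_tr (bstar r ^+ n./2) = 0.
    have -> : bstar r ^+ n./2 = bstar (r ^+ n./2).
      elim: (n./2) => [|k IH]; first by rewrite bstar1.
      by rewrite exprS exprSr bstarM IH.
    rewrite groupvn_tr_conj; have := root_trace R m0.
    by case: (groupvn_tr _) => x y /= ->; apply/eqP; rewrite eq_complex /= addr0 subrr !eqxx.
  have t0' := t0; rewrite addrC in t0'.
  by case: (b); rewrite /= ?t0 ?t0' mulr0.
(* A word of odd length is an antidiagonal matrix times a diagonal one, so its diagonal entries are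
   0. *)
rewrite add1n /= big_cons -[LHS]/(M2_tr _) /M2_tr !bentryM !M2_symmetry_even !bentry_antidiag /=.
by rewrite !mulr0 !mul0r !addr0 /groupvn_tr hdot0l addr0 mulr0.
Qed.

Lemma M2_free_symmetries : free_symmetries M2_symmetry.
Proof.
split; [exact: M2_symmetry_star|exact: M2_symmetry_sqr|exact: M2_symmetry_alternating|].
exact: M2_symmetry_generate.
Qed.

End MatrixSymmetries.

Theorem proposition2p3 (R : realType) :
  (exists (M : fvnalg R) (phi1 phi2 : bop (vn_space (C2 R)) -> bop (vn_space M)),
     is_free_product (C2 R) (C2 R) M phi1 phi2) /\
  (forall (M : fvnalg R) (phi1 phi2 : bop (vn_space (C2 R)) -> bop (vn_space M)),
     is_free_product (C2 R) (C2 R) M phi1 phi2 ->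
     vn_isomorphic M (M2 (LZ R))).
Proof.
split.
  exists (M2 (LZ R)), (C2_embed (@M2_symmetry R) false), (C2_embed (@M2_symmetry R) true).
  exact: symmetries_free_product (M2_free_symmetries R).
move=> M phi1 phi2 /free_product_symmetries[u fu].
exact: free_symmetries_iso fu (M2_free_symmetries R).
Qed.
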